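(* Let $k$ be an algebraically closed field, and let $A$ be a just infinite $k$-algebra satisfying a polynomial identity (so its center $Z(A)$ is a domain). Then $A$ is stably just infinite if and only if the field of fractions $Q(Z(A))$ of $Z(A)$ is a finitely generated field extension of $k$ with $\operatorname{trdeg}_k(Q(Z(A)))\leq 1$.
   Context: All rings are associative unital algebras over a field. A $k$-algebra $A$ is called just infinite if $\dim_k(A)=\infty$ and every nonzero two-sided ideal of $A$ has finite codimension in $A$; just infinite algebras are prime. A just infinite $k$-algebra $A$ is stably just infinite if $A\otimes_k K$ is just infinite over $K$ for every field extension $K/k$. *)

(* Defs.v *)
From HB Require Import structures.
From mathcomp Require Import all_boot all_order all_algebra.
From mathcomp Require Import finmap.
From mathcomp Require Import mpoly.
Set Implicit Arguments. Unset Strict Implicit. Unset Printing Implicit Defensive.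
Import GRing.Theory.
Local Open Scope ring_scope.

Definition in_span (R : pzRingType) (V : lmodType R) (s : seq V) (v : V) : Prop :=
  exists c : 'I_(size s) -> R, v = \sum_(i < size s) c i *: s`_i.

Definition lin_indep (R : pzRingType) (V : lmodType R) (s : seq V) : Prop :=
  forall c : 'I_(size s) -> R,
    \sum_(i < size s) c i *: s`_i = 0 -> forall i, c i = 0.

Definition fin_dim (R : pzRingType) (V : lmodType R) : Prop :=
  exists s : seq V, forall v, in_span s v.

Definition two_sided_ideal (R : pzRingType) (A : algType R) (I : A -> Prop) : Prop :=
  [/\ I 0,
      (forall x y, I x -> I y -> I (x - y)),
      (forall a x, I x -> I (a * x)) &
      (forall a x, I x -> I (x * a))].

Definition fin_codim (R : pzRingType) (A : algType R) (I : A -> Prop) : Prop :=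
  exists s : seq A, forall a, exists c : 'I_(size s) -> R,
    I (a - \sum_(i < size s) c i *: s`_i).

Definition just_infinite (R : pzRingType) (A : algType R) : Prop :=
  ~ fin_dim A /\
  forall I : A -> Prop, two_sided_ideal I -> (exists x, I x /\ x <> 0) -> fin_codim I.

(* For a field extension e : k -> K, the K-algebra B together with phi : A -> B
   is (isomorphic to) A (x)_k K: phi is a k-algebra map (k acting on B via e),
   and the induced K-linear map A (x)_k K -> B, a (x) l |-> l *: phi a,
   is surjective (the image of phi spans B over K) and injective
   (k-linearly independent families are sent to K-linearly independent ones). *)
Definition is_base_change (k K : fieldType) (e : {rmorphism k -> K})
    (A : algType k) (B : algType K) (phi : A -> B) : Prop :=
  [/\ (forall x y, phi (x + y) = phi x + phi y),
      (forall x y, phi (x * y) = phi x * phi y),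
      phi 1 = 1 &
      (forall (c : k) x, phi (c *: x) = e c *: phi x)] /\
  (forall b : B, exists s : seq A, in_span (map phi s) b) /\
  (forall s : seq A, lin_indep s -> lin_indep (map phi s)).

Definition stably_just_infinite (k : fieldType) (A : algType k) : Prop :=
  just_infinite A /\
  forall (K : fieldType) (e : {rmorphism k -> K}) (B : algType K) (phi : A -> B),
    is_base_change e phi -> just_infinite B.

Definition ncpoly (k : fieldType) (n : nat) := {fsfun seq 'I_n -> k with 0}.

Definition ncpoly_eval (k : fieldType) (A : algType k) (n : nat) (f : ncpoly k n)
    (a : 'I_n -> A) : A :=
  \sum_(w <- finsupp f) f w *: \prod_(i <- w) a i.

Definition is_PI (k : fieldType) (A : algType k) : Prop :=
  exists (n : nat) (f : ncpoly k n), f <> [fsfun] /\ forall a : 'I_n -> A, ncpoly_eval f a = 0.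

Definition central (R : pzRingType) (A : algType R) (z : A) : Prop :=
  forall a : A, z * a = a * z.

Definition is_frac_field_of_center (k : fieldType) (A : algType k) (L : fieldType)
    (iota : A -> L) : Prop :=
  [/\ (forall z w, central z -> central w -> iota (z + w) = iota z + iota w),
      (forall z w, central z -> central w -> iota (z * w) = iota z * iota w),
      iota 1 = 1,
      (forall z w, central z -> central w -> iota z = iota w -> z = w) &
      (forall x : L, exists z w, [/\ central z, central w, iota w != 0 & x = iota z / iota w])].

Definition subfield (L : fieldType) (P : L -> Prop) : Prop :=
  [/\ P 1, (forall x y, P x -> P y -> P (x - y)),
      (forall x y, P x -> P y -> P (x * y)) & (forall x, P x -> P x^-1)].

Definition fg_field_ext (k L : fieldType) (e : {rmorphism k -> L}) : Prop :=
  exists s : seq L, forall P : L -> Prop,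
    subfield P -> (forall c, P (e c)) -> (forall x, x \in s -> P x) -> forall x, P x.

Definition alg_indep (k L : fieldType) (e : {rmorphism k -> L}) (s : seq L) : Prop :=
  forall p : {mpoly k[size s]}, mmap e (fun i => s`_i) p = 0 -> p = 0.

Definition trdeg_le (k L : fieldType) (e : {rmorphism k -> L}) (d : nat) : Prop :=
  forall s : seq L, alg_indep e s -> (size s <= d)%N.

(* Main.v *)
Require Import Defs.
From HB Require Import structures.
From mathcomp Require Import all_boot all_order all_algebra.
From mathcomp Require Import finmap.
From mathcomp Require Import mpoly.
From mathcomp Require Import boolp.
Set Implicit Arguments. Unset Strict Implicit. Unset Printing Implicit Defensive.
Import GRing.Theory.
Local Open Scope ring_scope.

(* Let Z be the center of A. By Posner's theorem every nonzero ideal of A meets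
   Z, and A has finite rank over Z; hence Z contains some t outside k, which is
   transcendental because k is algebraically closed.

   If A is stably just infinite, then 'X - t generates an ideal of finite
   codimension in B = A (x) k(X). So boundedly many elements of Z are dependent
   over k[t], that is, Q(Z) is finite over k(t).

   Conversely, if Q(Z) is finite over k(t), then A has finite rank over k[t]. A
   nonzero ideal J of A (x) K contains a nonzero element z of Z (x) K. The
   determinant of z acting on Q(Z) (x) K over K[t] is a polynomial f with f(t) in
   J, nonzero because commuting matrices over k have common eigenvectors.
   Finally B / f(t)B is finite-dimensional over K: for a root c of f in k because
   (t - c)A has finite codimension in A, and for the remaining factor, which is
   coprime to k[t], because A has finite rank over k[t]. *)

(** * Linear spans *)

(** The base change [B] is not given as prime, so Posner's theorem is applied over [k] only. In [B]
    an element of an ideal is expanded over [k]-independent scalars, and its coefficients are made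
    central by operations with elements of [A]. The nonvanishing of the determinant is tested after
    specializing [t] to a point of [k]: the commuting matrices then have entries and eigenvalues in
    [k], where independence of the scalars can be used. The extension [k(X)] is the right test
    because ['X - t] is central in [B] and, modulo it, polynomials in [X] act as polynomials in [t].

    Posner's theorem itself passes through the central closure of [A], a prime algebra over the
    extended centroid. There a multilinear identity forces finite dimension, and a generalized
    polynomial with central values then produces central elements in the ideals of [A]. One
    construction, a ring of germs over a filter of ideals, gives Martindale's quotients (with the
    fraction field of the center inside) and, for another filter, the localization of [A[X]] at the
    nonzero polynomials over [k]. *)

Section LinearSpan.
Variables (F : fieldType) (V : lmodType F).
Implicit Types (s t : seq V) (v : V).

(** The recursion peels off one vector at a time, so spans are handled by induction on lists rather
    than by coefficients indexed by ordinals; [in_spanP] and [lin_indepP] lead back to [in_span] and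
    [lin_indep]. *)
Fixpoint lspan s v : Prop :=
  if s is x :: s' then exists c : F, lspan s' (v - c *: x) else v = 0.

Fixpoint lfree s : Prop :=
  if s is x :: s' then ~ lspan s' x /\ lfree s' else True.

Lemma lspan0 s : lspan s 0.
Proof. by elim: s => //= x s IH; exists 0; rewrite scale0r subr0. Qed.

Lemma lspanD s u v : lspan s u -> lspan s v -> lspan s (u + v).
Proof.
elim: s u v => [|x s IH] u v /= => [-> ->|[c hc] [d hd]]; first by rewrite addr0.
exists (c + d); rewrite scalerDl opprD addrACA; exact: IH.
Qed.

Lemma lspanZ s a v : lspan s v -> lspan s (a *: v).
Proof.
elim: s v => [|x s IH] v /= => [->|[c hc]]; first by rewrite scaler0.
by exists (a * c); rewrite -scalerA -scalerBr; apply: IH.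
Qed.

Lemma lspanN s v : lspan s v -> lspan s (- v).
Proof. by move=> h; rewrite -scaleN1r; apply: lspanZ. Qed.

Lemma lspanB s u v : lspan s u -> lspan s v -> lspan s (u - v).
Proof. by move=> hu hv; apply: lspanD => //; apply: lspanN. Qed.

Lemma lspan_sum s (I : Type) (r : seq I) (P : pred I) (G : I -> V) :
  (forall i, P i -> lspan s (G i)) -> lspan s (\sum_(i <- r | P i) G i).
Proof. by move=> h; apply: big_ind => //; [exact: lspan0|exact: lspanD]. Qed.

Lemma lspan_mem s v : v \in s -> lspan s v.
Proof.
elim: s => //= x s IH; rewrite inE => /orP[/eqP ->|/IH h].
  by exists 1; rewrite scale1r subrr; apply: lspan0.
by exists 0; rewrite scale0r subr0.
Qed.

Lemma lspan_ind (P : V -> Prop) s :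
  P 0 -> (forall c u v, P u -> P v -> P (c *: u + v)) ->
  (forall x, x \in s -> P x) -> forall v, lspan s v -> P v.
Proof.
move=> P0 PD; elim: s => [_ v ->//|x s IH] /= Ps v [c hc].
rewrite -(subrK (c *: x) v) addrC; apply: PD; first by apply: Ps; rewrite mem_head.
by apply: IH hc => y ys; apply: Ps; rewrite inE ys orbT.
Qed.

Lemma lspan_trans s t v : (forall x, x \in s -> lspan t x) -> lspan s v -> lspan t v.
Proof.
move=> h; apply: lspan_ind => //; first exact: lspan0.
by move=> c u w hu hw; apply: lspanD => //; apply: lspanZ.
Qed.

Lemma lspan_sub s t v : {subset s <= t} -> lspan s v -> lspan t v.
Proof. by move=> h; apply: lspan_trans => x /h; apply: lspan_mem. Qed.

Lemma lspan_coef (T : eqType) (f : T -> V) (r : seq T) v : uniq r ->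
  lspan (map f r) v -> exists c : T -> F, v = \sum_(i <- r) c i *: f i.
Proof.
elim: r v => [|x r IH] v /= => [_ ->|/andP[xr ur] [c /(IH _ ur)[d hd]]].
  by exists (fun=> 0); rewrite big_nil.
exists (fun i => if i == x then c else d i); rewrite big_cons eqxx.
apply/eqP; rewrite addrC -subr_eq hd; apply/eqP/eq_big_seq => i ir.
by case: eqP => // ix; rewrite ix (negPf xr) in ir.
Qed.

Lemma lspan_nth s v : lspan s v ->
  exists c : nat -> F, v = \sum_(i < size s) c i *: s`_i.
Proof.
rewrite -{1}(mkseq_nth 0 s) => /lspan_coef; case; first exact: iota_uniq.
by move=> c ->; exists c; rewrite -(big_mkord xpredT (fun i => c i *: s`_i)) /index_iota subn0.
Qed.

Lemma in_spanP s v : in_span s v <-> lspan s v.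
Proof.
split=> [[c ->]|/lspan_nth[c ->]]; last by exists c.
by apply: lspan_sum => i _; apply/lspanZ/lspan_mem/mem_nth.
Qed.

Lemma lfree_coef (T : eqType) (f : T -> V) (r : seq T) (c : T -> F) :
  lfree (map f r) -> \sum_(i <- r) c i *: f i = 0 -> forall i, i \in r -> c i = 0.
Proof.
elim: r => //= x r IH [nx fr]; rewrite big_cons => e.
have c0 : c x = 0.
  apply/eqP/negPn/negP => cn; apply: nx.
  rewrite -[f x](scalerK cn); apply: lspanZ.
  move/eqP: e; rewrite addr_eq0 => /eqP ->; apply/lspanN.
  rewrite big_seq; apply: lspan_sum => i ir.
  by apply/lspanZ/lspan_mem/map_f.
move: e; rewrite c0 scale0r add0r => /(IH fr) h i.
by rewrite inE => /orP[/eqP ->|/h].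
Qed.

Lemma lfreeP s : lfree s <->
  forall c : nat -> F, \sum_(i < size s) c i *: s`_i = 0 -> forall i, (i < size s)%N -> c i = 0.
Proof.
split=> [fs c e i lei|].
  apply: (@lfree_coef _ (nth 0 s) (iota 0 (size s))); last by rewrite mem_iota.
    by rewrite map_nth_iota0 // take_size.
  by rewrite -[iota _ _]/(iota 0 (size s)) -{1}(subn0 (size s)) -/(index_iota 0 (size s)) big_mkord.
elim: s => //= x s IH h; split=> [/lspan_nth[c hc]|].
  pose d i := if i is j.+1 then - c j else 1.
  have: d 0%N = 0 by apply: h => //; rewrite big_ord_recl /= scale1r {1}hc -big_split /= big1 // => i _; rewrite scaleNr subrr.
  by move/eqP; rewrite oner_eq0.
apply: IH => c hc i lei.
apply: (h (fun j => if j is j'.+1 then c j' else 0) _ i.+1) => //.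
by rewrite big_ord_recl /= scale0r add0r.
Qed.

Lemma lin_indepP s : lin_indep s <-> lfree s.
Proof.
rewrite lfreeP; split=> [h c e i lei|h c].
  by apply: (h (fun j : 'I_(size s) => c j) e (Ordinal lei)).
move=> e i; pose d j := if insub j is Some k then c k else 0.
have dE (j : 'I_(size s)) : d j = c j by rewrite /d valK.
by rewrite -dE; apply: h => //; rewrite -[RHS]e; apply: eq_bigr => j _; rewrite dE.
Qed.

Lemma lfree_uniq s : lfree s -> uniq s.
Proof.
elim: s => //= x s IH [nx /IH ->]; rewrite andbT; apply/negP => xs.
by apply: nx; apply: lspan_mem.
Qed.

(** Steinitz: if [s] were longer than [t], the matrix of coefficients would have a nonzero row
    vector in its kernel, which is a relation in [s]. *)
Lemma lfree_exchange s t : lfree s -> (forall x, x \in s -> lspan t x) ->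
  (size s <= size t)%N.
Proof.
move=> /lfreeP fs hst; rewrite leqNgt; apply/negP => lts.
have /choice[M hM] : forall i : 'I_(size s), exists c : nat -> F,
    s`_i = \sum_(j < size t) c j *: t`_j.
  by move=> i; apply/lspan_nth/hst/mem_nth.
pose N : 'M[F]_(size s, size t) := \matrix_(i, j) M i j.
have : kermx N != 0.
  by rewrite -mxrank_eq0 mxrank_ker -lt0n subn_gt0 (leq_ltn_trans (rank_leq_col N)).
case/rowV0Pn=> w /sub_kermxP wN w0; case/eqP: w0.
pose d j := if insub j is Some k then w 0 k else 0.
have dE (j : 'I_(size s)) : d j = w 0 j by rewrite /d valK.
apply/rowP => i; rewrite mxE -dE; apply: fs => //.
under eq_bigr do rewrite dE hM scaler_sumr.
rewrite exchange_big /=; apply: big1 => j _.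
have /rowP/(_ j) := wN; rewrite !mxE => e.
rewrite -[RHS](scale0r t`_j) -e scaler_suml; apply: eq_bigr => i' _.
by rewrite scalerA mxE.
Qed.

Lemma lfree_full s t : lfree s -> (forall x, x \in s -> lspan t x) ->
  (size t <= size s)%N -> forall v, lspan t v -> lspan s v.
Proof.
move=> fs hst le v hv; apply: contrapT => nv.
have /lfree_exchange/(_ _)/= : lfree (v :: s) by [].
move/(_ t) => h; suff: (size s < size t)%N by rewrite ltnNge le.
by apply: h => x; rewrite inE => /orP[/eqP ->|/hst].
Qed.

Lemma lbasis_extract s :
  exists b, [/\ lfree b, {subset b <= s} & forall x, x \in s -> lspan b x].
Proof.
elim: s => [|x s [b [fb bs sb]]]; first by exists [::].
have [xb|xb] := pselect (lspan b x).
  exists b; split=> // [y /bs ys|y]; first by rewrite inE ys orbT.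
  by rewrite inE => /orP[/eqP ->|/sb].
exists (x :: b); split=> //.
  by move=> y; rewrite !inE => /orP[->//|/bs ->]; rewrite orbT.
move=> y ys; have [yx|/eqP yx] := eqVneq y x.
  by rewrite yx; apply: lspan_mem; rewrite mem_head.
have : y \in s by move: ys; rewrite inE => /orP[/eqP|].
by move/sb; apply: lspan_sub => z zb; rewrite inE zb orbT.
Qed.

(** A free family in [P] that never spans [P] could be lengthened beyond [N]. The given [s0] stays
    at the end of the list, which later locates the vector [1] in a basis of the center. *)
Lemma lbasis_max (P : V -> Prop) (s0 : seq V) (N : nat) :
  lfree s0 -> (forall x, x \in s0 -> P x) ->
  (forall s, lfree s -> (forall x, x \in s -> P x) -> (size s <= N)%N) ->
  exists s, [/\ lfree (s ++ s0), forall x, x \in s ++ s0 -> P x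
             & forall x, P x -> lspan (s ++ s0) x].
Proof.
move=> f0 P0 bd; apply: contrapT => nex.
have grow : forall m, exists s, [/\ lfree (s ++ s0), forall x, x \in s ++ s0 -> P x & size s = m].
  elim=> [|m [s [fs Ps sm]]]; first by exists [::].
  have [x [Px nx]] : exists x, P x /\ ~ lspan (s ++ s0) x.
    apply: contrapT => h; apply: nex; exists s; split=> // x Px.
    by apply: contrapT => nx; apply: h; exists x.
  exists (x :: s); split=> /=; [by []| |by rewrite sm].
  by move=> y; rewrite inE => /orP[/eqP ->|/Ps].
have [s [fs Ps sm]] := grow N.+1.
by have := bd _ fs Ps; rewrite size_cat sm addSn ltnNge leq_addr.
Qed.

Lemma fin_dimP : fin_dim V <-> exists s, forall v, lspan s v.
Proof. by split=> -[s h]; exists s => v; apply/in_spanP; apply: h. Qed.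

Lemma not_fin_dim_lfree : ~ fin_dim V -> forall n, exists s, lfree s /\ size s = n.
Proof.
move=> nfd; elim=> [|n [s [fs sn]]]; first by exists [::].
have [x nx] : exists x, ~ lspan s x.
  apply: contrapT => h; apply: nfd; apply/fin_dimP; exists s => v.
  by apply: contrapT => nv; apply: h; exists v.
by exists (x :: s); rewrite /= sn.
Qed.

End LinearSpan.

Lemma lspan_map (F : fieldType) (U V : lmodType F) (f : U -> V) s v :
  linear f -> lspan s v -> lspan (map f s) (f v).
Proof.
move=> lf; have f0 : f 0 = 0 by have := lf (-1) 0 0; rewrite !scaleN1r !addNr.
apply: (lspan_ind (P := fun v => lspan (map f s) (f v))).
- by rewrite f0; apply: lspan0.
- by move=> c u w hu hw; rewrite lf; apply: lspanD => //; apply: lspanZ.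
- by move=> x xs; apply/lspan_mem/map_f.
Qed.

Lemma lspan_cat (F : fieldType) (V : lmodType F) (s t : seq V) v :
  lspan (s ++ t) v <-> exists u w, [/\ lspan s u, lspan t w & v = u + w].
Proof.
split=> [|[u [w [hu hw ->]]]]; last first.
  by apply: lspanD; [apply: lspan_sub hu|apply: lspan_sub hw] => x; rewrite mem_cat => ->; rewrite ?orbT.
apply: (lspan_ind (P := fun v => exists u w, [/\ lspan s u, lspan t w & v = u + w])).
- by exists 0, 0; rewrite addr0; split=> //; apply: lspan0.
- move=> c _ _ [u [w [hu hw ->]]] [u' [w' [hu' hw' ->]]].
  exists (c *: u + u'), (c *: w + w'); split; [| |by rewrite scalerDr addrACA].
    by apply: lspanD => //; apply: lspanZ.
  by apply: lspanD => //; apply: lspanZ.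
- move=> x; rewrite mem_cat => /orP[xs|xt].
    by exists x, 0; rewrite addr0; split=> //; [apply: lspan_mem|apply: lspan0].
  by exists 0, x; rewrite add0r; split=> //; [apply: lspan0|apply: lspan_mem].
Qed.

(** * Multilinear identities *)

Definition mlin_eval (F : fieldType) (R : algType F) d (al : seq nat -> F) (y : nat -> R) : R :=
  \sum_(w <- permutations (iota 0 d)) al w *: \prod_(j <- w) y j.

(** Relabeling the variables moves any monomial of a multilinear identity to [iota 0 d], so it is no
    loss to require this coefficient to be nonzero. *)
Definition mlin_id (F : fieldType) (R : algType F) : Prop :=
  exists d al, al (iota 0 d) <> 0 /\ forall y : nat -> R, mlin_eval d al y = 0.

Fixpoint words d m : seq (seq nat) :=
  if m is m'.+1 then [seq j :: w | j <- iota 0 d, w <- words d m'] else [:: [::]].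

Lemma mem_words d m w : (w \in words d m) = (size w == m) && all (fun j => j < d)%N w.
Proof.
elim: m w => [|m IH] [|j w] //=.
  by apply/negbTE/allpairsP => -[[? ?] []].
rewrite eqSS; apply/allpairsP/idP => [[[i v] /= [hi hv [-> ->]]]|].
  by move: hi hv; rewrite mem_iota IH => /= -> /andP[-> ->].
by case/and3P=> sw jd aw; exists (j, w); rewrite mem_iota IH sw aw jd.
Qed.

Lemma uniq_words d m : uniq (words d m).
Proof.
elim: m => //= m IH; apply: allpairs_uniq; rewrite ?iota_uniq //.
by move=> [? ?] [? ?] _ _ /= [-> ->].
Qed.

(* Full polarization: a word w0 of maximal length d in f is spread over d new
   variables, and the summand of f that uses each of them is extracted by
   successively subtracting the value at y_t = 0. *)
Lemma PI_mlin (k : fieldType) (A : algType k) : is_PI A -> mlin_id A.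
Proof.
case=> n [f [fn fid]].
have [w0 [w0f w0max]] : exists w0, w0 \in finsupp f /\
    forall w, w \in finsupp f -> (size w <= size w0)%N.
  have : finsupp f <> fset0.
    by move=> f0; apply: fn; apply/fsfunP => w; rewrite fsfun0E fsfun_dflt // f0.
  move=> nf0; have : (finsupp f : seq _) != [::].
    apply/eqP => e; apply: nf0; apply/fsetP => w; rewrite inE; apply/negbTE.
    by have -> : (w \in finsupp f) = (w \in (finsupp f : seq _)) by []; rewrite e.
  have gen (s : seq (seq 'I_n)) : s != [::] ->
      exists w0, w0 \in s /\ forall w, w \in s -> (size w <= size w0)%N.
    elim: s => //= x [_ _|x' s /(_ isT) [w1 [w1s w1m]] _].
      by exists x; rewrite mem_head; split=> // w; rewrite inE => /eqP ->.
    have [le|lt] := leqP (size w1) (size x).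
      exists x; rewrite mem_head; split=> // w; rewrite inE => /orP[/eqP ->//|/w1m h].
      exact: leq_trans h le.
    exists w1; rewrite inE w1s orbT; split=> // w; rewrite inE => /orP[/eqP ->|/w1m//].
    exact: ltnW.
  by case/gen=> w [ws wm]; exists w.
set d := size w0.
(* [C w t] says that reading the positions [t] in [w0] spells [w]. Such [t] index the monomials of
   [w] after the substitution [a], which sends a letter to the sum of the new variables at its
   positions in [w0]. *)
pose C (w : seq 'I_n) (t : seq nat) := map (onth w0) t == map Some w.
pose a (y : nat -> A) i := \sum_(j <- iota 0 d | onth w0 j == Some i) y j.
have aE y w : \prod_(i <- w) a y i =
    \sum_(t <- words d (size w) | C w t) \prod_(j <- t) y j.
  elim: w => [|i w IH]; first by rewrite big_nil /= big_mkcond big_seq1 /C /= big_nil.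
  rewrite big_cons IH [RHS]big_mkcond /= big_allpairs_dep /= /a big_distrl /=.
  rewrite [LHS]big_mkcond /=; apply: eq_bigr => j _.
  rewrite /C /= ; case: ifP => hj; last first.
    by rewrite big1 // => t _; rewrite eqseq_cons hj.
  rewrite big_distrr [LHS]big_mkcond /=; apply: eq_bigr => t _.
  by rewrite eqseq_cons hj /= big_cons.
have S T (y : nat -> A) : \sum_(w <- finsupp f) f w *:
    \sum_(t <- words d (size w) | C w t && all (fun j => j \in t) T) \prod_(j <- t) y j = 0.
  elim: T y => [|s T IH] y.
    apply: etrans (fid (a y)); apply: eq_bigr => w _; congr (_ *: _).
    by rewrite aE; apply: eq_bigl => t; rewrite andbT.
  pose z j := if j == s then 0 else y j.
  have := congr2 (fun u v => u - v) (IH y) (IH z); rewrite subr0 -sumrB => h; apply: etrans h.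
  apply: eq_bigr => w _.
  rewrite -scalerBr -sumrB; congr (_ *: _) => /=.
  rewrite [LHS]big_mkcond [RHS]big_mkcond /=; apply: eq_bigr => t _.
  case: (C w t) => //=; rewrite andbC; case: (all _ T) => //=.
  case: ifP => st.
    have -> : \prod_(j <- t) z j = 0.
      have [t1 t2] := splitPr st; rewrite big_cat big_cons /= {2}/z eqxx mul0r mulr0 //.
    by rewrite subr0.
  apply/esym/eqP; rewrite subr_eq0; apply/eqP/eq_big_seq => j jt.
  by rewrite /z; case: eqP => // js; rewrite -js jt in st.
(* The coefficient of [t] is that of the word which [t] spells in [w0]; at the identity this is
   [f w0], which is nonzero. *)
exists d, (fun t => f (pmap (onth w0) t)); split.
  have -> : pmap (onth w0) (iota 0 d) = w0.
    rewrite /d; elim: (w0) => //= x s IH; congr (_ :: _).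
    by rewrite -[RHS]IH (iotaDl 1 0); elim: (iota 0 _) => //= m l ->.
  by apply/eqP; rewrite -mem_finsupp.
move=> y; apply: etrans (S (iota 0 d) y); rewrite /mlin_eval.
rewrite [RHS](eq_big_seq (fun w => \sum_(t <- permutations (iota 0 d) | C w t)
    f w *: \prod_(j <- t) y j)); last first.
  move=> w wf; rewrite scaler_sumr.
  (* A word shorter than [d] cannot involve all [d] variables; a word of length [d] involving all of
     them is a permutation. *)
  have [sw|sw] := eqVneq (size w) d; last first.
    have lt : (size w < d)%N by rewrite ltn_neqAle sw w0max.
    rewrite big_seq_cond [RHS]big_seq_cond !big_pred0 //.
      move=> t; apply/negbTE; rewrite mem_permutations; apply/negP => /andP[/perm_size].
      rewrite size_iota => st /eqP/(congr1 size); rewrite !size_map => e.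
      by rewrite -e st ltnn in lt.
    move=> t; apply/negbTE/negP; rewrite mem_words => /and3P[/andP[/eqP st _] _ /allP h].
    have := uniq_leq_size (iota_uniq 0 d) h.
    by rewrite size_iota st leqNgt lt.
  rewrite sw -big_filter_cond.
  rewrite -[LHS]big_filter -[RHS]big_filter; apply: perm_big; apply: uniq_perm.
  - by rewrite !filter_uniq // uniq_words.
  - by rewrite filter_uniq // permutations_uniq.
  move=> t; rewrite !mem_filter mem_permutations mem_words; case: (C w t) => //=; last by rewrite andbF.
  apply/idP/idP.
    case/andP=> /allP h /andP[/eqP st _]; rewrite perm_sym; apply: uniq_perm; rewrite ?iota_uniq //.
      by rewrite (leq_size_uniq (iota_uniq 0 d) h) // size_iota st.
    by apply: (uniq_min_size (iota_uniq 0 d) h _).2; rewrite size_iota st.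
  move=> p; rewrite (perm_size p) size_iota eqxx /=; apply/andP; split.
    by apply/allP => j; rewrite (perm_mem p).
  by apply/allP => j; rewrite (perm_mem p) mem_iota.
rewrite /= [RHS](exchange_big_dep xpredT) //=; apply: eq_big_seq => t.
rewrite mem_permutations => pt.
have Ct w : C w t = (w == pmap (onth w0) t).
  have : all (fun j => j < d)%N t by apply/allP => j; rewrite (perm_mem pt) mem_iota.
  rewrite /C; elim: t w {pt} => [|j t IH] w /=; first by case: w.
  case/andP=> jd ht; have [x hx] : exists x, onth w0 j = Some x.
    by have := onthTE w0 j; rewrite jd; case: onth => // x _; exists x.
  case: w => [|i w]; rewrite hx //= !eqseq_cons.
  by rewrite IH // [i == x]eq_sym.
rewrite [RHS](eq_bigl _ _ Ct).
have [ws|ws] := boolP (pmap (onth w0) t \in finsupp f).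
  by rewrite -[RHS]big_filter (filter_pred1_uniq (fset_uniq _) ws) big_seq1.
rewrite fsfun_dflt // scale0r [RHS]big_seq_cond big_pred0 // => w.
by apply/negbTE/negP => /andP[wf /eqP e]; rewrite -e wf in ws.
Qed.

Definition infinite_field (F : fieldType) := forall s : seq F, exists x, x \notin s.

Definition prime_ring (R : nzRingType) :=
  forall p q : R, (forall x, p * x * q = 0) -> p = 0 \/ q = 0.

(** For a prime algebra this is Martindale's elementwise form of the condition that the extended
    centroid is [F]. *)
Definition centrally_closed (F : fieldType) (R : algType F) :=
  forall p q : R, p != 0 -> (forall x, p * x * q = q * x * p) -> exists c : F, q = c *: p.

Lemma infinite_nonroot (F : fieldType) (p : {poly F}) :
  infinite_field F -> p != 0 -> exists2 x, x != 0 & ~~ root p x.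
Proof.
move=> infF p0; apply: contrapT => h.
have grow n : exists s : seq F, [/\ uniq s, size s = n & all (root ('X * p)) s].
  elim: n => [|n [s [us sn rs]]]; first by exists [::].
  have [x xs] := infF s; exists (x :: s); rewrite /= xs us sn rs andbT; split=> //.
  rewrite rootM rootX; case: eqVneq => //= xn0.
  by rewrite andbT; apply/negPn/negP => rx; apply: h; exists x.
have [s [us sn rs]] := grow (size ('X * p)).
have Xp0 : 'X * p != 0 by rewrite mulf_neq0 // polyX_eq0.
by have := max_poly_roots Xp0 rs us; rewrite sn ltnn.
Qed.

(** * Perturbation of linearly independent families *)

Section FreePerturbation.
Variables (F : fieldType) (V : lmodType F).
Implicit Types (s t : seq V).

Lemma lfree_map (T : eqType) (f : T -> V) (r : seq T) : uniq r ->
  (forall c : T -> F, \sum_(i <- r) c i *: f i = 0 -> forall i, i \in r -> c i = 0) ->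
  lfree (map f r).
Proof.
elim: r => //= x r IH /andP[xr ur] h; split.
  case/(lspan_coef ur)=> c hc.
  suff: (-1 : F) = 0 by move/eqP; rewrite oppr_eq0 oner_eq0.
  rewrite -(h (fun i => if i == x then -1 else c i) _ x) ?mem_head ?eqxx //.
  rewrite big_cons eqxx scaleN1r {1}hc addrC; apply/eqP; rewrite subr_eq0; apply/eqP.
  by apply: eq_big_seq => i ir; case: eqP => // ix; rewrite ix (negPf xr) in ir.
apply: IH => // c hc i ir.
have := h (fun j => if j == x then 0 else c j); rewrite big_cons eqxx scale0r add0r.
rewrite (eq_big_seq (fun j => c j *: f j)) ?hc => [|j jr].
  move/(_ erefl i); rewrite inE ir orbT => /(_ isT).
  by case: eqP => // ix; rewrite ix (negPf xr) in ir.
by case: eqP => // ix; rewrite ix (negPf xr) in jr.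
Qed.

Lemma lfree_extend s t : lfree s ->
  exists e, lfree (e ++ s) /\ forall x, x \in t -> lspan (e ++ s) x.
Proof.
move=> fs; elim: t => [|x t [e [fe te]]]; first by exists [::].
have [xe|xe] := pselect (lspan (e ++ s) x).
  by exists e; split=> // y; rewrite inE => /orP[/eqP ->|/te].
exists (x :: e); split=> // y; rewrite inE => /orP[/eqP ->|/te].
  by apply: lspan_mem; rewrite mem_head.
by apply: lspan_sub => z; rewrite /= inE => ->; rewrite orbT.
Qed.

Lemma lfree_cat_disj s t u w : lfree (s ++ t) -> lspan s u -> lspan t w ->
  u + w = 0 -> w = 0.
Proof.
elim: s u => [u _ -> w0|x s IH u /= [nx fr] [c hc] hw uw0].
  by rewrite add0r => ->.
have [c0|cn] := eqVneq c 0.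
  by move: hc; rewrite c0 scale0r subr0 => hu; apply: IH hu hw uw0.
case: nx; rewrite -[x](scalerK cn); apply: lspanZ; apply/lspan_cat.
exists (- (u - c *: x)), (- w); split; [exact: lspanN|exact: lspanN|].
by rewrite -opprD addrAC uw0 add0r opprK.
Qed.

(** Modulo a complement [e] of the first components, the perturbed family is given by the matrix
    [1 + a G]. Its determinant is a polynomial in [a] with value 1 at 0, so it vanishes for finitely
    many [a] only. *)
Lemma lfree_perturb (r : seq (V * V)) : infinite_field F ->
  lfree (map fst r) ->
  exists2 a : F, a != 0 & lfree [seq p.1 + a *: p.2 | p <- r].
Proof.
move=> infF fr.
pose n := size r; pose v i := tnth (in_tuple r) i.
have rE : r = map v (enum 'I_n) by rewrite map_tnth_enum.
have [e [fe he]] := lfree_extend (map snd r) fr.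
have ur : uniq (enum 'I_n) by apply: enum_uniq.
have fE : map fst r = [seq (v i).1 | i <- enum 'I_n] by rewrite {1}rE -map_comp.
rewrite fE in fr fe he.
have /choice[G hG] : forall i : 'I_n, exists c : 'I_n -> F,
    lspan e ((v i).2 - \sum_j c j *: (v j).1).
  move=> i; have /he/lspan_cat[u [w [hu hw ->]]] : (v i).2 \in map snd r.
    by apply: map_f; apply: mem_tnth.
  have [c ->] := lspan_coef ur hw.
  by exists c; rewrite big_enum addrK.
pose M : 'M[{poly F}]_n := 1%:M + 'X *: map_mx polyC (\matrix_(i, j) G i j).
have ME a : map_mx (horner_eval a) M = 1%:M + a *: (\matrix_(i, j) G i j).
  apply/matrixP => i j; rewrite !mxE /= horner_evalE !hornerE.
  by case: (i == j); rewrite ?hornerE.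
have detM : \det M != 0.
  apply/eqP => h; have : (\det M).[0] = 0 by rewrite h horner0.
  rewrite -horner_evalE -det_map_mx ME scale0r addr0 det1.
  by move/eqP; rewrite oner_eq0.
have [a a0 na] := infinite_nonroot infF detM; exists a => //.
rewrite rE -map_comp; apply: lfree_map => // c; rewrite big_enum /= => hc i _.
pose d : 'rV[F]_n := \row_i c i.
suff d0 : d = 0 by have /rowP/(_ i) := d0; rewrite !mxE.
have dM : d *m map_mx (horner_eval a) M = 0.
  apply/rowP => j; rewrite [RHS]mxE.
  pose c' j := c j + a * \sum_i c i * G i j.
  suff /(lfree_coef fr)/(_ j) : \sum_(i <- enum 'I_n) c' i *: (v i).1 = 0.
    rewrite mem_enum => /(_ isT) <-; rewrite ME mulmxDr mulmx1 -scalemxAr !mxE.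
    by congr (_ + _ * _); apply: eq_bigr => l _; rewrite !mxE.
  apply: (@lfree_cat_disj _ _ (\sum_i c i *: (a *: ((v i).2 - \sum_j G i j *: (v j).1))) _ fe).
  - by apply: lspan_sum => l _; do 2 apply: lspanZ.
  - by apply: lspan_sum => l _; apply/lspanZ/lspan_mem/map_f; rewrite mem_enum.
  rewrite -[RHS]hc big_enum /=.
  have -> : \sum_l c' l *: (v l).1 = \sum_l (c l *: (v l).1 + c l *: (a *: \sum_j G l j *: (v j).1)).
    rewrite big_split /=; under eq_bigr do rewrite scalerDl.
    rewrite big_split /=; congr (_ + _).
    under eq_bigr do rewrite mulr_sumr scaler_suml.
    rewrite exchange_big /=; apply: eq_bigr => l _.
    rewrite !scaler_sumr; apply: eq_bigr => m _.
    by rewrite !scalerA; congr (_ *: _); rewrite mulrCA mulrA.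
  rewrite -big_split /=; apply: eq_bigr => l _.
  by rewrite scalerBr scalerBr addrC -addrA [X in _ + X]addrC subrK -scalerDr.
have u : map_mx (horner_eval a) M \in unitmx.
  by rewrite unitmxE det_map_mx unitfE; move: na; rewrite rootE.
by rewrite -[d](mulmxK u) dM mul0mx.
Qed.

End FreePerturbation.

(** * Finite codimension of common kernels *)

Section FiniteCodimension.
Variables (F : fieldType) (V W : lmodType F).

Definition lsubspace (X : V -> Prop) :=
  X 0 /\ forall c u v, X u -> X v -> X (c *: u + v).

Lemma lsubspace_span (X : V -> Prop) s v :
  lsubspace X -> (forall x, x \in s -> X x) -> lspan s v -> X v.
Proof. by move=> [X0 XD] Xs; apply: lspan_ind. Qed.

Lemma lsubspaceB (X : V -> Prop) u v : lsubspace X -> X u -> X v -> X (u - v).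
Proof. by move=> [_ XD] Xu Xv; rewrite -scaleN1r addrC; apply: XD. Qed.

Lemma lspan_preimage (X : V -> Prop) (g : V -> W) (s : seq W) :
  (forall y, y \in s -> exists x, X x /\ y = g x) ->
  exists t, (forall x, x \in t -> X x) /\ map g t = s.
Proof.
elim: s => [|y s IH] h; first by exists [::].
have [|t [Xt <-]] := IH; first by move=> z zs; apply: h; rewrite inE zs orbT.
have [x [Xx ->]] := h _ (mem_head _ _); exists (x :: t); split=> // z.
by rewrite inE => /orP[/eqP ->|/Xt].
Qed.

(** Induction on the list of maps: on the part of [X] killed by the later maps of the list, [g i]
    still has finite rank, and lifting a basis of its image gives the vectors to be added to [s].
    The space [X] itself may be infinite-dimensional. *)
Lemma finite_codim_ker (I : eqType) (r : seq I) (g : I -> V -> W) (X : V -> Prop) (t : seq W) :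
  lsubspace X -> (forall i, i \in r -> linear (g i)) ->
  (forall i x, i \in r -> X x -> lspan t (g i x)) ->
  exists s, (forall x, x \in s -> X x) /\
    forall x, X x -> exists y, lspan s y /\ forall i, i \in r -> g i (x - y) = 0.
Proof.
move=> sX; elim: r => [_ _|i r IH lg bg].
  by exists [::]; split=> // x _; exists 0; split.
have gB j u v : j \in i :: r -> g j (u - v) = g j u - g j v.
  by move=> jr; rewrite -scaleN1r addrC lg // scaleN1r addrC.
have g0 j : j \in i :: r -> g j 0 = 0.
  by move=> jr; rewrite -[X in g j X](subrr 0) gB // subrr.
have [||s [Xs hs]] := IH; first by move=> j jr; apply: lg; rewrite inE jr orbT.
  by move=> j x jr; apply: bg; rewrite inE jr orbT.
pose X' x := X x /\ forall j, j \in r -> g j x = 0.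
have sX' : lsubspace X'.
  split; [split; first exact: sX.1|].
    by move=> j jr; rewrite g0 // inE jr orbT.
  move=> c u v [Xu gu] [Xv gv]; split; first exact: sX.2.
  by move=> j jr; rewrite lg ?inE ?jr ?orbT // gu // gv // scaler0 addr0.
have [||e [fe Pe Se]] := @lbasis_max F W (fun w => exists x, X' x /\ w = g i x) [::] (size t) Logic.I.
- by [].
- move=> u fu hu; apply: (lfree_exchange fu) => w /hu[x [[Xx _] ->]].
  by apply: bg => //; rewrite mem_head.
rewrite cats0 in fe Pe Se; have [s' [Xs' gs']] := lspan_preimage Pe.
exists (s ++ s'); split.
  by move=> x; rewrite mem_cat => /orP[/Xs|/Xs'[]].
move=> x Xx; have [y [hy gy]] := hs x Xx.
have Xy : X y by apply: lsubspace_span hy.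
have X'xy : X' (x - y) by split=> //; apply: lsubspaceB.
have := Se (g i (x - y)) (ex_intro _ _ (conj X'xy erefl)).
rewrite -gs' => hz.
have [z [hz1 hz2]] : exists z, lspan s' z /\ g i (x - y) = g i z.
  move: hz; apply: (lspan_ind (P := fun w => exists z, lspan s' z /\ w = g i z)).
  - by exists 0; split; [exact: lspan0|rewrite g0 ?mem_head].
  - move=> c _ _ [u [hu ->]] [v [hv ->]]; exists (c *: u + v).
    by split; [apply: lspanD => //; apply: lspanZ|rewrite lg ?mem_head].
  - by move=> _ /mapP[u us' ->]; exists u; split=> //; apply: lspan_mem.
have X'z : X' z by apply: lsubspace_span hz1.
exists (y + z); split; first by apply/lspan_cat; exists y, z.
move=> j; rewrite opprD addrA inE => /orP[/eqP ->|jr].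
  by rewrite gB ?mem_head // hz2 subrr.
by rewrite gB ?inE ?jr ?orbT // gy // X'z.2 // subrr.
Qed.

End FiniteCodimension.

(* Amitsur's lemma. *)
Lemma dependent_maps_finite_rank (F : fieldType) (I : eqType) (V W : lmodType F)
    (T : I -> V -> W) (r : seq I) (w : seq W) :
  infinite_field F -> (forall i, linear (T i)) -> uniq r -> lfree w ->
  (forall x, ~ lfree (map (T^~ x) r ++ w)) ->
  exists c : I -> F, (exists2 i, i \in r & c i != 0) /\
    exists t, forall x, lspan t (\sum_(i <- r) c i *: T i x).
Proof.
move=> infF lT + fw; elim: r => [_ /(_ 0)//|i r IH] /= /andP[ir ur] h.
have [h1|/existsNP[x0 /contrapT fx0]] := pselect (forall x, ~ lfree (map (T^~ x) r ++ w)).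
  have [c [[j jr cj] [t ht]]] := IH ur h1.
  exists (fun l => if l == i then 0 else c l); split.
    exists j; first by rewrite inE jr orbT.
    by case: (j =P i) => // ji; rewrite -ji jr in ir.
  exists t => x; rewrite big_cons eqxx scale0r add0r.
  rewrite (eq_big_seq (fun l => c l *: T l x)) // => l lr.
  by case: eqP => // li; rewrite -li lr in ir.
have dep x : lfree (map (T^~ x) r ++ w) -> lspan (map (T^~ x) r ++ w) (T i x).
  by move=> fx; apply: contrapT => nx; apply: (h x).
have /lspan_cat[u [w0 [/(lspan_coef ur)[d hd] hw0 e0]]] := dep _ fx0.
exists (fun l => if l == i then 1 else - d l); split.
  by exists i; rewrite ?mem_head // eqxx oner_eq0.
pose S x := T i x - \sum_(l <- r) d l *: T l x.
have SE x : \sum_(l <- i :: r) (if l == i then 1 else - d l) *: T l x = S x.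
  rewrite /S big_cons eqxx scale1r -sumrN; congr (_ + _); apply: eq_big_seq => l lr.
  by case: eqP => [li|_]; [rewrite -li lr in ir|rewrite scaleNr].
exists (map (T^~ x0) r ++ w) => x; rewrite SE; apply: contrapT => nS.
(* If [S x] were outside the span, the family of its value, the [T l x0] and [w] would be free.
   Perturbing [T l x0] to [T l (a x + x0)] keeps it free, although [a S x = S (a x + x0) - w0] lies
   in the span of the perturbed values and [w]. *)
pose q := (S x, 0 : W) :: [seq (T l x0, T l x) | l <- r] ++ [seq (u', 0) | u' <- w].
have fq : lfree (map fst q).
  by rewrite /= map_cat -!map_comp (eq_map (g := id) (fun=> erefl)) map_id.
have [a a0] := lfree_perturb infF fq.
rewrite /= scaler0 addr0 map_cat -!map_comp.
rewrite [X in _ ++ X](@eq_map _ _ _ id) => [|y]; last by rewrite /= scaler0 addr0.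
rewrite map_id [X in X ++ _](@eq_map _ _ _ (T^~ (a *: x + x0))) => [|l]; last first.
  by rewrite /= lT addrC.
case=> nSx fr; apply: nSx; rewrite -[S x](scalerK a0); apply: lspanZ.
have -> : a *: S x = S (a *: x + x0) - w0.
  have -> : w0 = S x0 by rewrite /S e0 hd addrAC subrr add0r.
  rewrite /S lT scalerBr; under [in RHS]eq_bigr do rewrite lT scalerDr.
  rewrite big_split /= scaler_sumr; under eq_bigr do rewrite scalerA mulrC -scalerA.
  by rewrite opprD addrACA addrK.
apply: lspanB; last by apply/lspan_cat; exists 0, w0; rewrite add0r; split=> //; exact: lspan0.
apply: lspanB; first exact: dep.
rewrite big_seq; apply: lspan_sum => l lr; apply/lspanZ/lspan_mem.
by rewrite mem_cat map_f.
Qed.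

(** * Centrally closed prime algebras with an identity *)

Section PrimePI.
Variables (F : fieldType) (R : algType F).
Hypothesis infF : infinite_field F.
Hypothesis primeR : prime_ring R.
Hypothesis closedR : centrally_closed R.

Lemma mulr_linear (a : R) : linear (fun x : R => x * a).
Proof. by move=> c u v; rewrite mulrDl scalerAl. Qed.

Lemma mull_linear (a : R) : linear (fun x : R => a * x).
Proof. by move=> c u v; rewrite mulrDr scalerAr. Qed.

(* Used with N = {0} and with N = the maps of finite rank. *)
Lemma shorten_gpi (N : (R -> R) -> Prop) (s : seq (R * R)) :
  (forall f g, N f -> N g -> N (fun x => f x - g x)) ->
  (forall f a, N f -> N (fun x => f (x * a))) ->
  (forall f a, N f -> N (fun x => f x * a)) ->
  lfree (map fst s) -> (exists2 m, m \in s & m.2 != 0) ->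
  N (fun x => \sum_(m <- s) m.1 * x * m.2) ->
  exists p q, [/\ p != 0, q != 0 & N (fun x => p * x * q)].
Proof.
move=> NB Ncomp Nmul.
have [n] := ubnP (size s); elim: n s => // n IH [|[p q] s] /=; first by move=> _ _ [].
rewrite ltnS => sn [np fs] [m ms m2] Nf.
have [q0|qn] := eqVneq q 0.
  apply: (IH s) => //.
    move: ms; rewrite inE => /orP[/eqP mE|ms]; last by exists m.
    by rewrite mE q0 eqxx in m2.
  by congr N: Nf; apply/funext => x; rewrite big_cons q0 mulr0 add0r.
(* The combination [f (x q v) - f x v q] cancels the term with coefficient [q] and replaces every
   other coefficient [m.2] by [q v m.2 - m.2 v q]. *)
have [[v [m' m's m'n]]|hcom] :=
    pselect (exists v, exists2 m' : R * R, m' \in s & q * v * m'.2 - m'.2 * v * q != 0).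
  pose g (m : R * R) := (m.1, q * v * m.2 - m.2 * v * q).
  apply: (IH (map g s)).
  - by rewrite size_map.
  - by rewrite -map_comp (eq_map (g := fst)).
  - by exists (g m'); [apply: map_f|].
  have := NB _ _ (Ncomp _ (q * v) Nf) (Nmul _ (v * q) Nf); congr N; apply/funext => x.
  rewrite !big_cons /= mulrDl !mulrA opprD addrACA subrr add0r big_map !mulr_suml -sumrB.
  by apply: eq_bigr => l _; rewrite /= mulrBr !mulrA.
(* If all these new coefficients vanish, central closedness makes every [m.2] a multiple of [q], and
   the sum collapses to a single term. *)
have /choice[c hc] : forall m : R * R, exists c : F, m \in s -> m.2 = c *: q.
  move=> l; have [ls|] := boolP (l \in s); last by exists 0.
  have [|c hc] := @closedR q l.2 qn; last by exists c.
  move=> v; apply/eqP; rewrite -subr_eq0; apply/negPn/negP => h.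
  by apply: hcom; exists v, l.
exists (p + \sum_(l <- s) c l *: l.1), q; split=> //.
  apply/eqP => /eqP; rewrite addr_eq0 => /eqP e; apply: np; rewrite e; apply: lspanN.
  by rewrite big_seq; apply: lspan_sum => l ls; apply/lspanZ/lspan_mem/map_f.
congr N: Nf; apply/funext => x; rewrite big_cons /= !mulrDl !mulr_suml; congr (_ + _).
by apply: eq_big_seq => l ls; rewrite {1}(hc _ ls) -scalerAr !scalerAl.
Qed.

Lemma gpi_trivial (s : seq (R * R)) : lfree (map fst s) ->
  (forall x, \sum_(m <- s) m.1 * x * m.2 = 0) -> forall m, m \in s -> m.2 = 0.
Proof.
move=> fs hs m ms; apply/eqP/negPn/negP => mn.
have [|||p [q [/eqP p0 /eqP q0 h]]] :=
    @shorten_gpi (fun f => forall x, f x = 0) s _ _ _ fs (ex_intro2 _ _ m ms mn) hs.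
- by move=> f g hf hg x; rewrite hf hg subrr.
- by move=> f a hf x.
- by move=> f a hf x; rewrite hf mul0r.
by case: (primeR h).
Qed.

Lemma finite_rank_gpi (s : seq (R * R)) : lfree (map fst s) ->
  (exists2 m, m \in s & m.2 != 0) ->
  (exists t, forall x, @lspan F R t (\sum_(m <- s) m.1 * x * m.2)) ->
  exists p q t, [/\ p != 0, q != 0 & forall x, @lspan F R t (p * x * q)].
Proof.
move=> fs nz hs.
have [|||p [q [p0 q0 [t ht]]]] :=
    @shorten_gpi (fun f => exists t, forall x, @lspan F R t (f x)) s _ _ _ fs nz hs.
- move=> f g [t ht] [u hu]; exists (t ++ u) => x; apply/lspan_cat.
  by exists (f x), (- g x); split=> //; apply: lspanN.
- by move=> f a [t ht]; exists t.
- by move=> f a [t ht]; exists (map (fun x => x * a) t) => x; apply: lspan_map (ht x) => //; apply: mulr_linear.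
by exists p, q, t.
Qed.

Definition no_finite_rank := forall p q t, p != 0 -> q != 0 ->
  ~ forall x, @lspan F R t (p * x * q).

(** Otherwise Amitsur's lemma yields a nontrivial combination of the maps [x -> p x q] of finite
    rank, which [finite_rank_gpi] shortens to a single such map, against [no_finite_rank]. *)
Lemma extend_free_words (U : seq R) : no_finite_rank -> lfree U ->
  exists x, lfree ([seq p * x * q | p <- U, q <- U] ++ U).
Proof.
move=> nfr fU; apply: contrapT => /forallNP h.
pose r := [seq (p, q) | p <- U, q <- U].
have uU := lfree_uniq fU.
have [||//||c [[m mr cm] [t ht]]] :=
    @dependent_maps_finite_rank F (R * R)%type R R (fun m x => m.1 * x * m.2) r U infF.
- by move=> m a u v; rewrite mulrDr mulrDl scalerAl scalerAr.
- by apply: allpairs_uniq => // -[? ?] [? ?] _ _ /= [-> ->].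
- by move=> x; have := h x; rewrite map_allpairs.
pose s := [seq (p, \sum_(q <- U) c (p, q) *: q) | p <- U].
have [|||p [q [t' [p0 q0 ht']]]] := @finite_rank_gpi s _ _ _.
- by rewrite -map_comp (eq_map (g := id)) ?map_id.
- have /allpairsP[[p q] /= [pU qU mE]] := mr.
  exists (p, \sum_(q <- U) c (p, q) *: q) => /=; first exact: (map_f (fun p => (p, _))).
  apply/eqP => e; move: cm; rewrite mE.
  rewrite -(map_id U) in fU.
  by rewrite (lfree_coef fU e) ?eqxx.
- exists t => x; have := ht x; rewrite /r big_allpairs /s big_map.
  congr lspan; apply: eq_bigr => p _; rewrite /= mulr_sumr.
  by apply: eq_bigr => q _; rewrite -scalerAr.
exact: (nfr _ _ _ p0 q0 ht').
Qed.

(** The recursion mirrors the family of [extend_free_words]: the newest variable occurs at most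
    once, between two older words. Older variables may repeat, so more than the multilinear words is
    produced, but all of those are included. *)
Fixpoint split_words d : seq (seq nat) :=
  if d is d'.+1 then
    [seq u ++ d' :: v | u <- split_words d', v <- split_words d'] ++ split_words d'
  else [:: [::]].

Lemma split_words_lt d w : w \in split_words d -> all (fun j => j < d)%N w.
Proof.
elim: d w => [|d IH] w /=; first by rewrite inE => /eqP ->.
have wk v : all (fun j => j < d)%N v -> all (fun j => j < d.+1)%N v.
  by apply: sub_all => j; apply: leqW.
rewrite mem_cat => /orP[/allpairsP[[u v] /= [/IH hu /IH hv ->]]|/IH/wk//].
by rewrite all_cat /= ltnSn !wk.
Qed.

Lemma mem_split_words d w : uniq w -> all (fun j => j < d)%N w -> w \in split_words d.
Proof.
elim: d w => [|d IH] w uw aw; first by case: w uw aw => // ? ?.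
have sm v : all (fun j => j < d.+1)%N v -> d \notin v -> all (fun j => j < d)%N v.
  move=> av dv; apply/allP => j jv; have := allP av _ jv.
  by rewrite ltnS leq_eqVlt => /orP[/eqP jd|//]; rewrite -jd jv in dv.
have [dw|dw] := boolP (d \in w); last by rewrite /= mem_cat IH ?orbT // sm.
case/splitPr: dw uw aw => u v; rewrite cat_uniq all_cat /= => /and3P[uu].
rewrite negb_or => /andP[du _] /andP[dv uv] /and3P[au _ av].
by rewrite mem_cat; apply/orP; left; apply: allpairs_f; rewrite IH // sm.
Qed.

Lemma uniq_of_eval (y : nat -> R) (W : seq (seq nat)) :
  lfree [seq \prod_(j <- w) y j | w <- W] -> uniq W.
Proof. by move=> h; apply: map_uniq (lfree_uniq h). Qed.

Lemma free_split_words d : no_finite_rank ->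
  exists y : nat -> R, lfree [seq \prod_(j <- w) y j | w <- split_words d].
Proof.
move=> nfr; elim: d => [|d [y fy]].
  exists (fun=> 0); rewrite /= big_nil; split=> //.
  by apply/eqP; rewrite oner_eq0.
have [x fx] := extend_free_words nfr fy.
pose z j := if j == d then x else y j; exists z.
have zE w : w \in split_words d -> \prod_(j <- w) z j = \prod_(j <- w) y j.
  move=> /split_words_lt/allP hw; apply: eq_big_seq => j /hw; rewrite /z.
  by case: eqP => // ->; rewrite ltnn.
rewrite /= map_cat map_allpairs.
rewrite [X in _ ++ X](_ : _ = [seq \prod_(j <- w) y j | w <- split_words d]); last first.
  by apply/eq_in_map => w /zE.
congr (lfree (_ ++ _)): fx; rewrite allpairs_mapl allpairs_mapr.
apply/eq_in_allpairs => u v hu hv.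
by rewrite big_cat big_cons /= {2}/z eqxx !zE // mulrA.
Qed.

(** Without maps [x -> p x q] of finite rank, the split words have independent values at some point;
    they include all monomials of the identity. *)
Lemma mlin_id_finite_rank : mlin_id R -> ~ no_finite_rank.
Proof.
move=> [d [al [al0 hid]]] nfr; have [y fy] := free_split_words d nfr.
have uW := uniq_of_eval fy; set W := split_words d in fy uW.
have pW w : w \in permutations (iota 0 d) -> w \in W.
  rewrite mem_permutations => p; apply: mem_split_words.
    by rewrite (perm_uniq p) iota_uniq.
  by apply/allP => j; rewrite (perm_mem p) mem_iota.
pose c w := if w \in permutations (iota 0 d) then al w else 0.
have iW : iota 0 d \in permutations (iota 0 d) by rewrite mem_permutations.
apply: al0; have <- : c (iota 0 d) = al (iota 0 d) by rewrite /c iW.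
apply: (lfree_coef fy) (pW _ iW); rewrite -[RHS](hid y) /mlin_eval.
rewrite (eq_bigr (fun w => if w \in permutations (iota 0 d) then al w *: \prod_(j <- w) y j else 0)).
  rewrite -big_mkcond -big_filter; apply: perm_big; apply: uniq_perm.
  - by rewrite filter_uniq.
  - exact: permutations_uniq.
  by move=> w; rewrite mem_filter; apply/andP/idP => [[]//|/[dup]/pW].
by move=> w _; rewrite /c; case: ifP => // _; rewrite scale0r.
Qed.

(** If [p R q] is finite-dimensional, take [a = q y p], nonzero for some [y] by primeness: then
    [a x a = q y (p x q) y p]. *)
Lemma small_corner : mlin_id R ->
  exists (a : R) t, a != 0 /\ forall x, @lspan F R t (a * x * a).
Proof.
move=> /mlin_id_finite_rank h; apply: contrapT => h'; apply: h => p q t p0 q0 ht.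
have [y hy] : exists y, q * y * p != 0.
  apply: contrapT => /forallNP hn; have [/eqP|/eqP] : q = 0 \/ p = 0; [|by rewrite (negPf q0)..|by rewrite (negPf p0)].
  by apply: primeR => y; apply/eqP/negPn/negP/hn.
apply: h'; exists (q * y * p), (map (fun x => q * y * x * (y * p)) t); split=> // x.
rewrite (_ : _ * x * _ = q * y * (p * x * q) * (y * p)); last by rewrite !mulrA.
apply: lspan_map (ht x) => c u v.
by rewrite mulrDr mulrDl -scalerAr -scalerAl.
Qed.

(** * One-sided ideals over a finite-dimensional corner *)

Section Corner.
Variables (a : R) (t : seq R).
Hypothesis a0 : a != 0.
Hypothesis cornerE : forall x, @lspan F R t (a * x * a).

Let X (u : R) := exists r, u = r * a.
Let Y (v : R) := exists r, v = a * r.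

Let subX : @lsubspace F R X.
Proof.
split; first by exists 0; rewrite mul0r.
by move=> c _ _ [r ->] [r' ->]; exists (c *: r + r'); rewrite mulrDl scalerAl.
Qed.

Let subY : @lsubspace F R Y.
Proof.
split; first by exists 0; rewrite mulr0.
by move=> c _ _ [r ->] [r' ->]; exists (c *: r + r'); rewrite mulrDr scalerAr.
Qed.

Let pairYX u v : X u -> Y v -> @lspan F R t (v * u).
Proof. by move=> [r ->] [r' ->]; rewrite -mulrA (mulrA r') mulrA; apply: cornerE. Qed.

(** Products of [aR] with [Ra] lie in the finite-dimensional [aRa], so the orthogonality conditions
    cut out subspaces of finite codimension in [Ra] and in [aR]. If these two annihilated each
    other, an element of the former killed by the finitely many elements of [s2] would be killed by
    all of [aR], hence be zero by primeness; so [Ra] would be finite-dimensional. *)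
Lemma orthogonal_pair (s : seq (R * R)) :
  (forall t', exists r, ~ @lspan F R t' (r * a)) ->
  (forall m, m \in s -> X m.1 /\ Y m.2) ->
  exists u v, [/\ X u, Y v, v * u != 0 & forall m, m \in s -> v * m.1 = 0 /\ m.2 * u = 0].
Proof.
move=> inf hs; apply: contrapT => hno.
have [||s1 [Xs1 h1]] := @finite_codim_ker F R R R (map snd s) (fun v u => v * u) X t subX.
- by move=> v _; apply: mull_linear.
- by move=> v u /mapP[m /hs[_ Ym] ->] Xu; apply: pairYX.
have [||s2 [Ys2 h2]] := @finite_codim_ker F R R R (map fst s) (fun u v => v * u) Y t subY.
- by move=> u _; apply: mulr_linear.
- by move=> u v /mapP[m /hs[Xm _] ->] Yv; apply: pairYX.
pose N u := X u /\ forall m, m \in s -> m.2 * u = 0.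
have subN : @lsubspace F R N.
  split; first by split; [exact: subX.1|move=> m _; rewrite mulr0].
  move=> c u v [Xu hu] [Xv hv]; split; first exact: subX.2.
  by move=> m ms; rewrite mull_linear hu // hv // scaler0 addr0.
have [||s3 [Ns3 h3]] := @finite_codim_ker F R R R s2 (fun v u => v * u) N t subN.
- by move=> v _; apply: mull_linear.
- by move=> v u /Ys2 Yv [Xu _]; apply: pairYX.
have [r []] := inf (s1 ++ s3); apply/lspan_cat.
have [y [hy ky]] := h1 (r * a) (ex_intro _ r erefl).
exists y, (r * a - y); split; [exact: hy| |by rewrite addrC subrK].
have Nu : N (r * a - y).
  split; first by apply: (lsubspaceB subX); [exists r|apply: lsubspace_span hy].
  by move=> m ms; apply: ky; apply: map_f.
set u := r * a - y in Nu *; have [z [hz kz]] := h3 u Nu.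
suff -> : u = z by [].
have Nw : N (u - z) by apply: (lsubspaceB subN) => //; apply: lsubspace_span hz.
apply/eqP; rewrite -subr_eq0; apply/eqP.
suff /primeR[/eqP|//] : forall x, a * x * (u - z) = 0 by rewrite (negPf a0).
move=> x; have [v [hv kv]] := h2 (a * x) (ex_intro _ x erefl).
rewrite -(subrK v (a * x)) mulrDl.
have -> : v * (u - z) = 0.
  apply: (@lspan_ind F R (fun v => v * (u - z) = 0) s2) hv; first by rewrite mul0r.
    by move=> c v1 v2 e1 e2; rewrite mulrDl -scalerAl e1 e2 scaler0 addr0.
  by move=> v' /kz.
rewrite addr0; apply/eqP/negPn/negP => n0; apply: hno.
exists (u - z), (a * x - v); split=> //.
- exact: Nw.1.
- by apply: (lsubspaceB subY); [exists x|apply: lsubspace_span hv].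
- move=> m ms; split; last exact: Nw.2.
  by apply: kv; apply: map_f.
Qed.

Lemma orthogonal_family n :
  (forall t', exists r, ~ @lspan F R t' (r * a)) ->
  exists u v : nat -> R, forall i, (i < n)%N ->
    [/\ X (u i), Y (v i), v i * u i != 0 &
        forall j, (j < n)%N -> j != i -> v i * u j = 0].
Proof.
move=> inf; elim: n => [|n [u [v h]]]; first by exists (fun=> 0), (fun=> 0).
have [m|u' [v' [Xu Yv vu huv]]] := @orthogonal_pair [seq (u i, v i) | i <- iota 0 n] inf.
  by move=> /mapP[i]; rewrite mem_iota => /h[? ? _ _] ->.
have hi i : (i < n)%N -> v' * u i = 0 /\ v i * u' = 0.
  by move=> lin; apply: (huv (u i, v i)); apply: (map_f (fun i => (u i, v i))); rewrite mem_iota.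
exists (fun i => if i == n then u' else u i), (fun i => if i == n then v' else v i) => i.
rewrite ltnS leq_eqVlt; case: (eqVneq i n) => [-> _|ni /= lin].
  split=> // j; rewrite ltnS leq_eqVlt; case: eqVneq => //= _ lj _.
  by rewrite (hi _ lj).1.
have [? ? ? hj] := h i lin; split=> // j.
rewrite ltnS leq_eqVlt; case: (eqVneq j n) => //= _; first by rewrite (hi _ lin).2.
exact: hj.
Qed.

(* Staircase argument: otherwise there are orthogonal families u_i in Ra and v_i
   in aR, and substituting suitable u_i r_i v_(i+1) into the multilinear identity
   leaves a single nonzero product. *)
Lemma left_ideal_fin_dim : mlin_id R -> exists t', forall r, @lspan F R t' (r * a).
Proof.
move=> [d [al [al0 hid]]]; apply: contrapT => /forallNP inf0.
have inf t' : exists r, ~ @lspan F R t' (r * a).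
  by apply: contrapT => /forallNP h; apply: (inf0 t') => r; apply: contrapT; apply: h.
have [u [v h]] := orthogonal_family d.+1 inf.
have u0 i : (i < d.+1)%N -> u i != 0.
  by case/h=> _ _ vu _; apply: contra vu => /eqP ->; rewrite mulr0.
have hr m : (m <= d)%N -> exists r : nat -> R,
    (\prod_(i <- iota 0 m) (u i * r i * v i.+1)) * u m != 0.
  elim: m => [_|m IH lmd]; first by exists (fun=> 0); rewrite big_nil mul1r u0.
  have [r pr] := IH (ltnW lmd); set P := \prod_(_ <- _) _ in pr.
  have [rho hrho] : exists rho, P * u m * rho * (v m.+1 * u m.+1) != 0.
    apply: contrapT => /forallNP hn.
    have [_ _ vu _] := h m.+1 lmd.
    have [/eqP|/eqP] : P * u m = 0 \/ v m.+1 * u m.+1 = 0; [|by rewrite (negPf pr)|by rewrite (negPf vu)].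
    by apply: primeR => x; apply/eqP/negPn/negP/hn.
  exists (fun i => if i == m then rho else r i).
  rewrite -addn1 iotaD big_cat big_seq1 add0n eqxx addn1.
  rewrite (eq_big_seq (fun i => u i * r i * v i.+1)).
    by rewrite -/P /=; move: hrho; rewrite !mulrA.
  by move=> i; rewrite mem_iota => /= lim; rewrite ltn_eqF.
have [r pr] := hr d (leqnn d); pose x i := u i * r i * v i.+1.
have x0 i j : (i < d)%N -> (j < d)%N -> j != i.+1 -> x i * x j = 0.
  move=> li lj ji; have [_ _ _ /(_ j (leqW lj) ji) e] := h i.+1 li.
  by rewrite /x !mulrA -(mulrA _ (v i.+1)) e mulr0 !mul0r.
(* A nonzero product allows only steps from [i] to [i + 1], and the only permutation of
   [0, ..., d - 1] made of such steps is the identity. *)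
have perm0 w : all (fun j => j < d)%N w -> w != [::] ->
    \prod_(j <- w) x j = 0 \/ w = iota (head 0%N w) (size w).
  elim: w => //= i [|j w] IH; first by right.
  case/and3P=> li lj aw _; have [] := IH _ isT; first by rewrite /= lj.
    by move=> e; left; rewrite big_cons e mulr0.
  move=> /= e; have [ji|ji] := eqVneq j i.+1; first by right; rewrite {1}e ji.
  by left; rewrite !big_cons mulrA x0 // mul0r.
have := hid x; rewrite /mlin_eval (bigD1_seq (iota 0 d)) ?permutations_uniq ?mem_permutations //=.
rewrite [X in _ + X]big1_seq => [|w /andP[wi]]; last first.
  rewrite mem_permutations => pw.
  have [w0|wn] := eqVneq w [::].
    by case/eqP: wi; rewrite w0 in pw *; apply/esym/nilP; rewrite /nilp -(perm_size pw).
  have sw : size w = d by rewrite (perm_size pw) size_iota.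
  have [|->|e] := perm0 w _ wn; [|by rewrite scaler0|].
    by apply/allP => j; rewrite (perm_mem pw) mem_iota.
  case/eqP: wi; move: e; rewrite sw => e.
  have d0 : (0 < d)%N by rewrite -sw lt0n size_eq0.
  have : 0%N \in w by rewrite (perm_mem pw) mem_iota.
  by rewrite {1}e mem_iota leqn0 => /andP[/eqP h0 _]; rewrite h0 in e.
rewrite addr0 => /eqP; rewrite scaler_eq0 => /orP[/eqP//|/eqP e].
by move: pr; rewrite -/(x _) e mul0r eqxx.
Qed.

End Corner.

(** [R] acts by left multiplication on the finite-dimensional space [Ra], and by primeness this
    action is faithful. *)
Theorem prime_PI_fin_dim : mlin_id R -> fin_dim R.
Proof.
move=> hid; have [a [t [a0 ht]]] := small_corner hid.
have [t' ht'] := left_ideal_fin_dim a0 ht hid.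
pose X (u : R) := exists r, u = r * a.
have [||b [_ Xb Sb]] := @lbasis_max F R X [::] (size t') Logic.I.
- by [].
- by move=> s fs hs; apply: (lfree_exchange fs) => x /hs[r ->].
rewrite cats0 in Xb Sb.
have [|||s [_ hs]] := @finite_codim_ker F R R R b (fun y x => x * y) (fun=> True) t'.
- by split.
- by move=> y _; apply: mulr_linear.
- by move=> y x /Xb[r ->] _; rewrite mulrA.
apply/fin_dimP; exists s => x; have [y [hy ky]] := hs x Logic.I.
suff -> : x = y by [].
apply/eqP; rewrite -subr_eq0; apply/eqP.
have [//|/eqP] : x - y = 0 \/ a = 0; last by rewrite (negPf a0).
apply: primeR => r; rewrite -mulrA.
have := Sb (r * a) (ex_intro _ r erefl).
apply: (@lspan_ind F R (fun w => (x - y) * w = 0)); first by rewrite mulr0.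
  by move=> c w1 w2 e1 e2; rewrite mulrDr -scalerAr e1 e2 scaler0 addr0.
by move=> w /ky.
Qed.

End PrimePI.

(** * Rings of quotients *)

Definition ring_ideal (R : nzRingType) (I : R -> Prop) :=
  [/\ I 0, (forall x y, I x -> I y -> I (x - y)),
      (forall a x, I x -> I (a * x)) & (forall a x, I x -> I (x * a))].

(* The filter of nonzero ideals of a prime ring yields Martindale's ring of
   quotients as the ring of germs below. *)
Record ideal_filter (R : nzRingType) := IdealFilter {
  flt :> (R -> Prop) -> Prop;
  flt_ideal : forall I, flt I -> ring_ideal I;
  fltT : flt (fun=> True);
  flt_mul : forall I J K, flt I -> flt J -> ring_ideal K ->
    (forall x y, I x -> J y -> K (x * y)) -> flt K;
  flt_reg : forall I x, flt I -> (forall y, I y -> x * y = 0) -> x = 0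
}.

Local Open Scope quotient_scope.

Section Germs.
Variables (R : nzRingType) (F : ideal_filter R).

Lemma flt_cap (I J : R -> Prop) : F I -> F J -> F (fun x => I x /\ J x).
Proof.
move=> FI FJ; have [I0 IB Il Ir] := flt_ideal FI; have [J0 JB Jl Jr] := flt_ideal FJ.
apply: (flt_mul FI FJ); last by move=> x y Ix Jy; split; [apply: Ir|apply: Jl].
split=> // [x y [? ?] [? ?]|a x [? ?]|a x [? ?]].
- by split; [apply: IB|apply: JB].
- by split; [apply: Il|apply: Jl].
- by split; [apply: Ir|apply: Jr].
Qed.

Definition right_map_on (I : R -> Prop) (f : R -> R) :=
  (forall x y, I x -> I y -> f (x - y) = f x - f y) /\
  (forall x a, I x -> f (x * a) = f x * a).

(** A total function that is a right module map on some member of the filter only; its other values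
    are arbitrary and are forgotten by [same_germ]. *)
Record partial_map := PartialMap {
  pm_fun :> R -> R;
  pm_dom : exists I, F I /\ right_map_on I pm_fun
}.

HB.instance Definition _ := gen_eqMixin partial_map.
HB.instance Definition _ := gen_choiceMixin partial_map.

Definition same_germ (f g : partial_map) : bool :=
  `[< exists I, F I /\ forall x, I x -> f x = g x >].

Lemma same_germ_refl : reflexive same_germ.
Proof. by move=> f; apply/asboolP; exists (fun=> True); split=> //; apply: fltT. Qed.

Lemma same_germ_sym : ssrbool.symmetric same_germ.
Proof.
move=> f g; apply/asboolP/asboolP => -[I [FI h]]; exists I; split=> // x Ix.
  by rewrite h.
by rewrite h.
Qed.

Lemma same_germ_trans : transitive same_germ.
Proof.
move=> g f h /asboolP[I [FI hI]] /asboolP[J [FJ hJ]]; apply/asboolP.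
exists (fun x => I x /\ J x); split; first exact: flt_cap.
by move=> x [Ix Jx]; rewrite hI // hJ.
Qed.

Canonical germ_equiv := EquivRel same_germ same_germ_refl same_germ_sym same_germ_trans.
Definition germ := {eq_quot germ_equiv}%qT.
HB.instance Definition _ := Choice.on germ.
HB.instance Definition _ := EqQuotient.on germ.

Lemma germ_eqP (f g : partial_map) :
  (\pi_germ f = \pi_germ g) <-> exists I, F I /\ forall x, I x -> f x = g x.
Proof.
split=> [/eqmodP/asboolP//|h]; by apply/eqmodP/asboolP.
Qed.

Lemma pm_add_subproof (f g : partial_map) :
  exists I, F I /\ right_map_on I (fun x => f x + g x).
Proof.
have [I [FI rf]] := pm_dom f; have [J [FJ rg]] := pm_dom g.
exists (fun x => I x /\ J x); split; first exact: flt_cap.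
split=> [x y [Ix Jx] [Iy Jy]|x a [Ix Jx]].
  by rewrite rf.1 // rg.1 // opprD addrACA.
by rewrite rf.2 // rg.2 // mulrDl.
Qed.

Lemma pm_opp_subproof (f : partial_map) : exists I, F I /\ right_map_on I (fun x => - f x).
Proof.
have [I [FI rf]] := pm_dom f; exists I; split=> //; split=> [x y Ix Iy|x a Ix].
  by rewrite rf.1 // opprD.
by rewrite rf.2 // mulNr.
Qed.

Lemma right_map0 (I : R -> Prop) f : right_map_on I f -> I 0 -> f 0 = 0.
Proof. by move=> [_ h] I0; rewrite -[X in f X](mulr0 0) h // mulr0. Qed.

(* The preimage of I under g need not be two-sided; its largest two-sided part is used. *)
Lemma preimage_flt (I J : R -> Prop) (g : R -> R) : F I -> F J -> right_map_on J g ->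
  F (fun x => J x /\ forall a, I (g (a * x))).
Proof.
move=> FI FJ rg; have [I0 IB Il Ir] := flt_ideal FI; have [J0 JB Jl Jr] := flt_ideal FJ.
apply: (flt_mul FJ FI).
  split=> [|x y [Jx hx] [Jy hy]|b x [Jx hx]|b x [Jx hx]].
  - by split=> // a; rewrite mulr0 (right_map0 rg).
  - by split=> [|a]; [apply: JB|rewrite mulrBr rg.1; [apply: IB|apply: Jl|apply: Jl]].
  - by split=> [|a]; [apply: Jl|rewrite mulrA].
  - by split=> [|a]; [apply: Jr|rewrite mulrA rg.2; [apply: Ir|apply: Jl]].
move=> x y Jx Iy; split=> [|a]; first exact: Jr.
by rewrite mulrA rg.2; [apply: Il|apply: Jl].
Qed.

Lemma pm_mul_subproof (f g : partial_map) :
  exists I, F I /\ right_map_on I (fun x => f (g x)).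
Proof.
have [I [FI rf]] := pm_dom f; have [J [FJ rg]] := pm_dom g.
exists (fun x => J x /\ forall a, I (g (a * x))); split; first exact: preimage_flt.
have h1 x : (forall a, I (g (a * x))) -> I (g x) by move/(_ 1); rewrite mul1r.
split=> [x y [Jx /h1 hx] [Jy /h1 hy]|x a [Jx /h1 hx]]; first by rewrite rg.1 // rf.1.
by rewrite rg.2 // rf.2.
Qed.

Lemma pm_lmul_subproof (a : R) : exists I, F I /\ right_map_on I (fun x => a * x).
Proof.
exists (fun=> True); split; first exact: fltT.
by split=> [x y _ _|x b _]; rewrite ?mulrBr ?mulrA.
Qed.

Definition pm_add f g := PartialMap (pm_add_subproof f g).
Definition pm_opp f := PartialMap (pm_opp_subproof f).
Definition pm_mul f g := PartialMap (pm_mul_subproof f g).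
Definition pm_lmul a := PartialMap (pm_lmul_subproof a).

Definition germ_add (p q : germ) : germ := \pi_germ (pm_add (repr p) (repr q)).
Definition germ_opp (p : germ) : germ := \pi_germ (pm_opp (repr p)).
Definition germ_mul (p q : germ) : germ := \pi_germ (pm_mul (repr p) (repr q)).
Definition germ_emb (a : R) : germ := \pi_germ (pm_lmul a).

Lemma repr_pi f : exists I, F I /\ forall x, I x -> repr (\pi_germ f) x = f x.
Proof. by apply/germ_eqP; rewrite reprK. Qed.

Lemma germ_addE f g : germ_add (\pi_germ f) (\pi_germ g) = \pi_germ (pm_add f g).
Proof.
apply/germ_eqP; have [I [FI hI]] := repr_pi f; have [J [FJ hJ]] := repr_pi g.
exists (fun x => I x /\ J x); split; first exact: flt_cap.
by move=> x [Ix Jx] /=; rewrite hI // hJ.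
Qed.

Lemma germ_oppE f : germ_opp (\pi_germ f) = \pi_germ (pm_opp f).
Proof.
apply/germ_eqP; have [I [FI hI]] := repr_pi f.
by exists I; split=> // x Ix /=; rewrite hI.
Qed.

Lemma germ_mulE f g : germ_mul (\pi_germ f) (\pi_germ g) = \pi_germ (pm_mul f g).
Proof.
apply/germ_eqP; have [I [FI hI]] := repr_pi f; have [J [FJ hJ]] := repr_pi g.
have [J' [FJ' rg]] := pm_dom g.
exists (fun x => J x /\ (J' x /\ forall a, I (g (a * x)))); split.
  by apply: flt_cap => //; apply: preimage_flt.
by move=> x [Jx [J'x /(_ 1)]]; rewrite mul1r => Ig /=; rewrite hJ // hI.
Qed.

Lemma germ_ind (P : germ -> Prop) : (forall f, P (\pi_germ f)) -> forall q, P q.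
Proof. by move=> h q; rewrite -[q]reprK. Qed.

Lemma germ_eq_fun (f g : partial_map) : (forall x, f x = g x) -> \pi_germ f = \pi_germ g.
Proof. by move=> h; apply/germ_eqP; exists (fun=> True); split=> //; apply: fltT. Qed.

Fact germ_addA : associative germ_add.
Proof.
by elim/germ_ind => f; elim/germ_ind => g; elim/germ_ind => h; rewrite !germ_addE;
  apply: germ_eq_fun => x /=; rewrite addrA.
Qed.

Fact germ_addC : commutative germ_add.
Proof.
by elim/germ_ind => f; elim/germ_ind => g; rewrite !germ_addE; apply: germ_eq_fun => x /=;
  rewrite addrC.
Qed.

Fact germ_add0 : left_id (germ_emb 0) germ_add.
Proof. by elim/germ_ind => f; rewrite !germ_addE; apply: germ_eq_fun => x /=; rewrite mul0r add0r. Qed.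

Fact germ_addN : left_inverse (germ_emb 0) germ_opp germ_add.
Proof.
by elim/germ_ind => f; rewrite germ_oppE !germ_addE; apply: germ_eq_fun => x /=; rewrite mul0r addNr.
Qed.

Fact germ_mulA : associative germ_mul.
Proof.
by elim/germ_ind => f; elim/germ_ind => g; elim/germ_ind => h; rewrite !germ_mulE;
  apply: germ_eq_fun.
Qed.

Fact germ_mul1l : left_id (germ_emb 1) germ_mul.
Proof. by elim/germ_ind => f; rewrite !germ_mulE; apply: germ_eq_fun => x /=; rewrite mul1r. Qed.

Fact germ_mul1r : right_id (germ_emb 1) germ_mul.
Proof. by elim/germ_ind => f; rewrite !germ_mulE; apply: germ_eq_fun => x /=; rewrite mul1r. Qed.

Fact germ_mulDl : left_distributive germ_mul germ_add.
Proof.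
by elim/germ_ind => f; elim/germ_ind => g; elim/germ_ind => h;
  rewrite !(germ_mulE, germ_addE); apply: germ_eq_fun.
Qed.

Fact germ_mulDr : right_distributive germ_mul germ_add.
Proof.
elim/germ_ind => f; elim/germ_ind => g; elim/germ_ind => h.
rewrite !(germ_mulE, germ_addE); apply/germ_eqP.
have [I [FI rf]] := pm_dom f; have [J [FJ rg]] := pm_dom g; have [K [FK rh]] := pm_dom h.
exists (fun x => (J x /\ forall a, I (g (a * x))) /\ (K x /\ forall a, I (h (a * x)))).
split; first by apply: flt_cap; apply: preimage_flt.
move=> x [[_ /(_ 1)]]; rewrite mul1r => Ig [_ /(_ 1)]; rewrite mul1r => Ih /=.
have [I0 IB _ _] := flt_ideal FI.
have fN z : I z -> f (- z) = - f z.
  by move=> Iz; rewrite -sub0r rf.1 // (right_map0 rf) // sub0r.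
have : f (g x - (- h x)) = f (g x) - f (- h x).
  by rewrite rf.1 // -sub0r; apply: IB.
by rewrite fN // !opprK.
Qed.

Fact germ_1neq0 : germ_emb 1 != germ_emb 0.
Proof.
apply/eqP => /germ_eqP[I [FI h]]; have /eqP := oner_neq0 R; apply.
by apply: (flt_reg FI) => y /h /=; rewrite mul0r.
Qed.

HB.instance Definition _ := GRing.isNzRing.Build germ germ_addA germ_addC germ_add0
  germ_addN germ_mulA germ_mul1l germ_mul1r germ_mulDl germ_mulDr germ_1neq0.

Fact germ_emb_zmod : zmod_morphism germ_emb.
Proof.
move=> a b; rewrite /GRing.add /= /GRing.opp /= germ_oppE germ_addE.
by apply: germ_eq_fun => x /=; rewrite mulrBl.
Qed.

Fact germ_emb_monoid : monoid_morphism germ_emb.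
Proof.
split=> // a b; rewrite /GRing.mul /= germ_mulE.
by apply: germ_eq_fun => x /=; rewrite mulrA.
Qed.

HB.instance Definition _ := GRing.isZmodMorphism.Build R germ germ_emb germ_emb_zmod.
HB.instance Definition _ := GRing.isMonoidMorphism.Build R germ germ_emb germ_emb_monoid.

Lemma germ_emb0 : germ_emb 0 = 0.
Proof. exact: (rmorph0 germ_emb). Qed.

Lemma germ_emb1 : germ_emb 1 = 1.
Proof. exact: (rmorph1 germ_emb). Qed.

Lemma germ_embB a b : germ_emb (a - b) = germ_emb a - germ_emb b.
Proof. exact: (rmorphB germ_emb). Qed.

Lemma germ_embD a b : germ_emb (a + b) = germ_emb a + germ_emb b.
Proof. exact: (rmorphD germ_emb). Qed.

Lemma germ_embM a b : germ_emb (a * b) = germ_emb a * germ_emb b.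
Proof. exact: (rmorphM germ_emb). Qed.

Lemma germ_emb_inj : injective germ_emb.
Proof.
move=> a b /germ_eqP[I [FI h]]; apply/eqP; rewrite -subr_eq0; apply/eqP.
by apply: (flt_reg FI) => y /h /= e; rewrite mulrBl e subrr.
Qed.

Lemma germ_of_map (I : R -> Prop) f : F I -> right_map_on I f ->
  exists q : germ, forall x, I x -> q * germ_emb x = germ_emb (f x).
Proof.
move=> FI rf; exists (\pi_germ (PartialMap (ex_intro _ I (conj FI rf)))) => x Ix.
rewrite /GRing.mul /= germ_mulE; apply: germ_eq_fun => y /=; exact: rf.2.
Qed.

Lemma germ_dom (q : germ) : exists I, F I /\ forall x, I x -> exists y, q * germ_emb x = germ_emb y.
Proof.
elim/germ_ind: q => f; have [I [FI rf]] := pm_dom f; exists I; split=> // x Ix.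
exists (f x); rewrite /GRing.mul /= germ_mulE; apply: germ_eq_fun => y /=; exact: rf.2.
Qed.

Lemma germ_reg (q : germ) I : F I -> (forall x, I x -> q * germ_emb x = 0) -> q = 0.
Proof.
elim/germ_ind: q => f FI h; apply/germ_eqP.
have [J [FJ rf]] := pm_dom f; exists (fun x => I x /\ J x); split; first exact: flt_cap.
move=> x [Ix Jx] /=; rewrite mul0r; apply: germ_emb_inj; rewrite rmorph0 -(h _ Ix).
rewrite [RHS]/GRing.mul /= germ_mulE; apply: germ_eq_fun => y /=; exact/esym/rf.2.
Qed.

(** For [i] in the domain of [q] the product [q i] is an element of [R], so [c] commutes both with
    it and with [i], and [c q] agrees with [q c] on the domain. *)
Lemma germ_central (c : germ) : (forall a, c * germ_emb a = germ_emb a * c) ->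
  forall q, c * q = q * c.
Proof.
move=> hc q; have [I [FI hI]] := germ_dom q.
apply/eqP; rewrite -subr_eq0; apply/eqP; apply: (germ_reg FI) => i /hI[b qb].
by rewrite mulrBl -!mulrA qb !hc mulrA qb subrr.
Qed.

End Germs.

(** * Central subfields and the algebras over them *)

Record central_subfield (Q : nzRingType) := CentralSubfield {
  csf_mem :> Q -> Prop;
  csf_mem1 : csf_mem 1;
  csf_memB : forall x y, csf_mem x -> csf_mem y -> csf_mem (x - y);
  csf_memM : forall x y, csf_mem x -> csf_mem y -> csf_mem (x * y);
  csf_central : forall x, csf_mem x -> forall y, x * y = y * x;
  csf_memV : forall x, csf_mem x -> x != 0 -> exists y, csf_mem y /\ x * y = 1
}.

(** A copy of [Q] whose type remembers [S], to carry the structure of an algebra over the field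
    [csf S]. With subfields as predicates, several of them can coexist in one ring. *)
Definition csf_ext (Q : nzRingType) (S : central_subfield Q) : Type := Q.

Section CentralSubfield.
Variables (Q : nzRingType) (S : central_subfield Q).

Definition csf_pred : {pred Q} := fun x => `[< S x >].

Lemma csf_predP x : reflect (S x) (x \in csf_pred).
Proof. exact: asboolP. Qed.

Fact csf_subring : subring_closed csf_pred.
Proof.
split; first by apply/csf_predP/csf_mem1.
  by move=> x y /csf_predP hx /csf_predP hy; apply/csf_predP/csf_memB.
by move=> x y /csf_predP hx /csf_predP hy; apply/csf_predP/csf_memM.
Qed.
HB.instance Definition _ := GRing.isSubringClosed.Build Q csf_pred csf_subring.

Record csf := Csf { csf_val :> Q; csf_valP : csf_val \in csf_pred }.
HB.instance Definition _ := [isSub for csf_val].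
HB.instance Definition _ := [Choice of csf by <:].
HB.instance Definition _ := [SubChoice_isSubNzRing of csf by <:].

Fact csf_val_zmod : zmod_morphism csf_val.
Proof. exact: (rmorphB (val : csf -> Q)). Qed.
Fact csf_val_monoid : monoid_morphism csf_val.
Proof. by split; [exact: (rmorph1 (val : csf -> Q))|exact: (rmorphM (val : csf -> Q))]. Qed.
HB.instance Definition _ := GRing.isZmodMorphism.Build csf Q csf_val csf_val_zmod.
HB.instance Definition _ := GRing.isMonoidMorphism.Build csf Q csf_val csf_val_monoid.

Lemma csfP (c : csf) : S (csf_val c).
Proof. exact/csf_predP/csf_valP. Qed.

Lemma csf_lift x : S x -> exists c : csf, csf_val c = x.
Proof. by move=> /csf_predP Sx; exists (Csf Sx). Qed.

Fact csf_mulC : commutative (@GRing.mul csf).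
Proof. by move=> x y; apply: val_inj; rewrite /= (csf_central (csfP x)). Qed.
HB.instance Definition _ := GRing.PzRing_hasCommutativeMul.Build csf csf_mulC.

Fact csf_invE (x : csf) : exists y : csf, (x != 0 -> y * x = 1) /\ (x = 0 -> y = 0).
Proof.
have [->|x0] := eqVneq x 0; first by exists 0.
have [|y [Sy xy]] := @csf_memV _ S (csf_val x) (csfP x).
  by apply: contra x0 => /eqP e; apply/eqP/val_inj; rewrite /= e.
have [c hc] := csf_lift Sy; exists c; split=> [_|e]; last by rewrite e eqxx in x0.
by rewrite csf_mulC; apply: val_inj; rewrite /= hc xy.
Qed.

Definition csf_inv (x : csf) : csf := sval (cid (csf_invE x)).

Fact csf_mulVf x : x != 0 -> csf_inv x * x = 1.
Proof. by rewrite /csf_inv; case: cid => y /= [h _] /h. Qed.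

Fact csf_inv0 : csf_inv 0 = 0.
Proof. by rewrite /csf_inv; case: cid => y /= [_]; apply. Qed.
HB.instance Definition _ := GRing.ComNzRing_isField.Build csf csf_mulVf csf_inv0.

Local Notation ext := (csf_ext S).
HB.instance Definition _ := GRing.NzRing.copy ext Q.

Definition csf_scale (c : csf) (x : ext) : ext := csf_val c * x.

Fact csf_scaleA a b x : csf_scale a (csf_scale b x) = csf_scale (a * b) x.
Proof. by rewrite /csf_scale /= mulrA. Qed.
Fact csf_scale1 : left_id 1 csf_scale.
Proof. by move=> x; rewrite /csf_scale /= mul1r. Qed.
Fact csf_scaleDr : right_distributive csf_scale +%R.
Proof. by move=> c x y; rewrite /csf_scale mulrDr. Qed.
Fact csf_scaleDl x : {morph csf_scale^~ x : a b / a + b}.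
Proof. by move=> a b; rewrite /csf_scale /= mulrDl. Qed.
HB.instance Definition _ := GRing.Zmodule_isLmodule.Build csf ext
  csf_scaleA csf_scale1 csf_scaleDr csf_scaleDl.

Fact csf_scaleAl (a : csf) (x y : ext) : a *: (x * y) = a *: x * y.
Proof. by rewrite /GRing.scale /= /csf_scale mulrA. Qed.
HB.instance Definition _ := GRing.Lmodule_isLalgebra.Build csf ext csf_scaleAl.

Fact csf_scaleAr (a : csf) (x y : ext) : a *: (x * y) = x * (a *: y).
Proof. by rewrite /GRing.scale /= /csf_scale !mulrA (csf_central (csfP a)). Qed.
HB.instance Definition _ := GRing.Lalgebra_isAlgebra.Build csf ext csf_scaleAr.

Lemma csf_scaleE (c : csf) (x : ext) : c *: x = (csf_val c : ext) * x.
Proof. by []. Qed.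

Lemma csf_sumE n (c : nat -> csf) (x : nat -> ext) :
  \sum_(i < n) c i *: x i = (\sum_(i < n) csf_val (c i) * (x i : Q) : Q).
Proof. by []. Qed.

End CentralSubfield.

(* In finite dimension, centrally closed primeness makes R (x) R^op -> End(R)
   injective, hence bijective; the preimage of a map with values in F is a
   generalized polynomial with central values. *)
Lemma central_gpi (F : fieldType) (R : algType F) :
  prime_ring R -> centrally_closed R -> fin_dim R ->
  exists s : seq (R * R), [/\ lfree (map fst s), exists2 m, m \in s & m.2 != 0
    & forall x, exists c : F, \sum_(m <- s) m.1 * x * m.2 = c%:A].
Proof.
move=> pR cR /fin_dimP[t ht].
have [e [fe _ he]] := lbasis_extract t.
have spe v : lspan e v by apply: lspan_trans (ht v).
pose n := size e; pose b i := tnth (in_tuple e) i.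
have eE : e = map b (enum 'I_n) by rewrite map_tnth_enum.
have ue : uniq (enum 'I_n) by apply: enum_uniq.
have fb : lfree (map b (enum 'I_n)) by rewrite -eE.
have /choice[co hco] : forall v : R, exists c : 'I_n -> F, v = \sum_i c i *: b i.
  move=> v; have := spe v; rewrite eE => /(lspan_coef ue)[c ->].
  by exists c; rewrite big_enum.
have fb0 (c : 'I_n -> F) : \sum_i c i *: b i = 0 -> forall i, c i = 0.
  move=> h i; apply: (lfree_coef fb); last by rewrite mem_enum.
  by rewrite big_enum.
pose I2 : finType := ('I_n * 'I_n)%type.
pose op (p : I2) (x : R) : R := b p.1 * x * b p.2.
pose M (p : I2) : 'M[F]_n := \matrix_(i, j) co (op p (b i)) j.
have opsum (c : I2 -> F) x : \sum_p c p *: op p x =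
    \sum_i co x i *: \sum_j (\sum_p c p *: M p) i j *: b j.
  rewrite {1}(hco x); under eq_bigr do rewrite /op mulr_sumr mulr_suml scaler_sumr.
  rewrite exchange_big /=; apply: eq_bigr => i _.
  under eq_bigr do rewrite -scalerAr -scalerAl scalerA mulrC -scalerA.
  rewrite -scaler_sumr; congr (_ *: _).
  under [LHS]eq_bigr => p _ do rewrite -/(op p (b i)) (hco (op p (b i))) scaler_sumr.
  rewrite exchange_big /=; apply: eq_bigr => j _.
  rewrite summxE scaler_suml; apply: eq_bigr => p _.
  by rewrite scalerA !mxE.
have opE (c : I2 -> F) x : \sum_p c p *: op p x =
    \sum_(m <- [seq (b i, \sum_j c (i, j) *: b j) | i <- enum 'I_n]) m.1 * x * m.2.
  transitivity (\sum_i \sum_j c (i, j) *: op (i, j) x).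
    by rewrite pair_bigA /=; apply: eq_bigr => -[].
  rewrite big_map big_enum /=; apply: eq_bigr => i _; rewrite mulr_sumr; apply: eq_bigr => j _.
  by rewrite -scalerAr.
have ffst (c : I2 -> F) : lfree (map fst [seq (b i, \sum_j c (i, j) *: b j) | i <- enum 'I_n]).
  by rewrite -map_comp.
have uI : uniq (enum I2) by apply: enum_uniq.
have fM : lfree (map M (enum I2)).
  apply: lfree_map => // c; rewrite big_enum => h [i j] _.
  have := gpi_trivial pR cR (ffst c) _ (m := (b i, \sum_j c (i, j) *: b j)).
  move=> /(_ _ _)/= hh; have : \sum_j c (i, j) *: b j = 0.
    apply: hh; last by apply: (map_f (fun i => (b i, _))); rewrite mem_enum.
    move=> x; rewrite -opE opsum big1 // => l _; rewrite big1 ?scaler0 // => l' _.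
    by rewrite h mxE scale0r.
  by move/fb0.
(* All rows of [T] are the coordinates of 1, so [T] describes the map that multiplies 1 by the sum
   of the coordinates. It is a combination of the [M p], which are [n ^ 2] independent matrices of
   size [n]. *)
pose T : 'M[F]_n := \matrix_(i, j) co 1 j.
have /(lspan_coef uI)[c] : lspan (map M (enum I2)) T.
  apply: (lfree_full fM (t := map (fun p : I2 => delta_mx p.1 p.2) (enum I2))).
  - move=> x _; rewrite (matrix_sum_delta x); apply: lspan_sum => i _; apply: lspan_sum => j _.
    apply/lspanZ/lspan_mem; apply: (map_f (fun p : I2 => delta_mx p.1 p.2) (x := (i, j))).
    by rewrite mem_enum.
  - by rewrite !size_map.
  rewrite (matrix_sum_delta T); apply: lspan_sum => i _; apply: lspan_sum => j _.
  apply/lspanZ/lspan_mem; apply: (map_f (fun p : I2 => delta_mx p.1 p.2) (x := (i, j))).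
  by rewrite mem_enum.
rewrite big_enum /= => hT.
exists [seq (b i, \sum_j c (i, j) *: b j) | i <- enum 'I_n]; split=> //; last first.
  move=> x; exists (\sum_i co x i); rewrite -opE opsum -hT scaler_suml.
  apply: eq_bigr => i _; congr (_ *: _); rewrite [RHS](hco 1).
  by apply: eq_bigr => j _; rewrite mxE.
apply: contrapT => hno.
have c0 i : \sum_j c (i, j) *: b j = 0.
  apply/eqP/negPn/negP => h; apply: hno; exists (b i, \sum_j c (i, j) *: b j) => //.
  by apply: (map_f (fun i => (b i, _))); rewrite mem_enum.
have cp0 p : c p = 0 by case: p => i j; apply: fb0 (c0 i) j.
have := oner_eq0 R; rewrite (hco 1) big1 ?eqxx // => i _.
have : T i i = 0.
  by rewrite hT summxE big1 // => p _; rewrite cp0 scale0r mxE.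
by rewrite mxE => ->; rewrite scale0r.
Qed.

(** * The central closure *)

Section Martindale.
Variable A : nzRingType.
Hypothesis primeA : prime_ring A.

Let nz_ideal (I : A -> Prop) := ring_ideal I /\ exists x, I x /\ x <> 0.

Lemma prime_ring_neq0 (p q : A) : p <> 0 -> q <> 0 -> exists x, p * x * q <> 0.
Proof.
move=> p0 q0; apply: contrapT => h; have [|//|//] := @primeA p q.
by move=> x; apply: contrapT => n; apply: h; exists x.
Qed.

Fact nz_idealT : nz_ideal (fun=> True).
Proof. by split=> //; exists 1; split=> //; apply/eqP; rewrite oner_eq0. Qed.

Fact nz_ideal_mul I J K : nz_ideal I -> nz_ideal J -> ring_ideal K ->
  (forall x y, I x -> J y -> K (x * y)) -> nz_ideal K.
Proof.
move=> [[_ _ _ Ir] [x [Ix x0]]] [_ [y [Jy y0]]] iK h; split=> //.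
have [r hr] := prime_ring_neq0 x0 y0; exists (x * r * y); split=> //.
by apply: h => //; apply: Ir.
Qed.

Fact nz_ideal_reg I x : nz_ideal I -> (forall y, I y -> x * y = 0) -> x = 0.
Proof.
move=> [[_ _ Il _] [y [Iy y0]]] h; apply: contrapT => x0.
have [r] := prime_ring_neq0 x0 y0; apply.
by rewrite -mulrA; apply/h/Il.
Qed.

Definition martindale_filter : ideal_filter A :=
  @IdealFilter A nz_ideal (fun I h => h.1) nz_idealT nz_ideal_mul nz_ideal_reg.

Local Notation Q := (germ martindale_filter).
Local Notation iota := (germ_emb martindale_filter).

(** If [q] is nonzero, some product [q i = b] is a nonzero element of [A]. The elements [y] with
    [p A y = 0] form an ideal containing [b], so [p] vanishes on a member of the filter. *)
Lemma martindale_prime (p q : Q) : (forall x, p * iota x * q = 0) -> p = 0 \/ q = 0.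
Proof.
move=> h; have [->|/eqP q0] := eqVneq q 0; [by right|left].
have [I [FI hI]] := germ_dom q.
have [i [Ii qi]] : exists i, I i /\ q * iota i <> 0.
  apply: contrapT => hn; apply: q0; apply: (germ_reg FI) => i Ii.
  by apply: contrapT => n; apply: hn; exists i.
have [b qb] := hI i Ii.
pose K y := forall x, p * iota (x * y) = 0.
have FK : martindale_filter K.
  split; last first.
    exists b; split=> [x|b0]; last by apply: qi; rewrite qb b0 germ_emb0.
    by rewrite germ_embM mulrA -qb !mulrA h mul0r.
  split=> [x|y z hy hz x|a y hy x|a y hy x].
  - by rewrite mulr0 germ_emb0 mulr0.
  - by rewrite mulrBr germ_embB mulrBr hy hz subrr.
  - by rewrite mulrA hy.
  - by rewrite mulrA germ_embM mulrA hy mul0r.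
by apply: (germ_reg FK) => y /(_ 1); rewrite mul1r.
Qed.

(** The element [c] is the germ of the map sending [y] to the [y'] with [y' x p = y x q] for all
    [x], unique by primeness. By hypothesis it sends [p i] to [q i], so its domain is a nonzero
    ideal; as it respects multiplication on both sides, [c] is central. *)
Lemma martindale_closed (p q : Q) : p != 0 ->
  (forall x, p * iota x * q = q * iota x * p) ->
  exists c, (forall y, c * y = y * c) /\ q = c * p.
Proof.
move=> p0 hpq.
pose im y y' := forall x, iota y' * iota x * p = iota y * iota x * q.
have im_uniq y y1 y2 : im y y1 -> im y y2 -> y1 = y2.
  move=> h1 h2; apply: (@germ_emb_inj _ martindale_filter); apply/eqP; rewrite -subr_eq0; apply/eqP.
  have [//|/eqP] : iota y1 - iota y2 = 0 \/ p = 0; last by rewrite (negPf p0).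
  by apply: martindale_prime => x; rewrite !mulrBl h1 h2 subrr.
have imB y y' z z' : im y y' -> im z z' -> im (y - z) (y' - z').
  by move=> hy hz x; rewrite !germ_embB !mulrBl hy hz.
have imr y y' a : im y y' -> im (y * a) (y' * a).
  by move=> hy x; rewrite !germ_embM -!(mulrA _ (iota a)) -germ_embM hy.
have iml y y' a : im y y' -> im (a * y) (a * y').
  by move=> hy x; rewrite !germ_embM -!mulrA; congr (_ * _); rewrite !mulrA hy.
have [I [FI hI]] := germ_dom p; have [J [FJ hJ]] := germ_dom q.
have FIJ := flt_cap FI FJ.
have imi i y y' : p * iota i = iota y -> q * iota i = iota y' -> im y y'.
  by move=> hy hy' x; rewrite -hy -hy' -!(mulrA _ (iota i)) -germ_embM hpq.
pose D y := exists y', im y y'.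
have FD : martindale_filter D.
  split.
    split=> [|y z [y' hy] [z' hz]|a y [y' hy]|a y [y' hy]].
    - by exists 0 => x; rewrite germ_emb0 !mul0r.
    - by exists (y' - z'); apply: imB.
    - by exists (a * y'); apply: iml.
    - by exists (y' * a); apply: imr.
  have [i [[Ii Ji] pi0]] : exists i, (I i /\ J i) /\ p * iota i <> 0.
    apply: contrapT => hn; move/eqP: p0; apply; apply: (germ_reg FIJ) => i Ii.
    by apply: contrapT => n; apply: hn; exists i.
  have [y hy] := hI i Ii; have [y' hy'] := hJ i Ji.
  exists y; split; first by exists y'; apply: imi hy hy'.
  by move=> y0; apply: pi0; rewrite hy y0 germ_emb0.
have /choice[f hf] : forall y, exists y', D y -> im y y'.
  by move=> y; have [[y' h]|n] := pselect (D y); [exists y'|exists 0].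
have rf : right_map_on D f.
  split=> [y z Dy Dz|y a Dy]; apply: im_uniq.
  - by apply: (hf); exists (f y - f z); apply: imB; apply: hf.
  - by apply: imB; apply: hf.
  - by apply: (hf); exists (f y * a); apply: imr; apply: hf.
  - by apply: imr; apply: hf.
have [c hc] := germ_of_map FD rf; exists c; split.
  apply: germ_central => a; apply/eqP; rewrite -subr_eq0; apply/eqP.
  apply: (germ_reg FD) => y Dy.
  have Day : D (a * y) by exists (a * f y); apply/iml/hf.
  rewrite mulrBl -!mulrA -germ_embM !hc // -germ_embM.
  rewrite (im_uniq _ _ _ (hf _ Day) (iml _ _ a (hf _ Dy))) subrr //.
apply/eqP; rewrite -subr_eq0; apply/eqP; apply: (germ_reg FIJ) => i [Ii Ji].
have [y hy] := hI i Ii; have [y' hy'] := hJ i Ji; have hi := imi _ _ _ hy hy'.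
rewrite mulrBl -mulrA hy hy' hc; last by exists y'.
by rewrite (im_uniq _ _ _ (hf y (ex_intro _ y' hi)) hi) subrr.
Qed.

Definition xcentroid_mem (c : Q) := forall y, c * y = y * c.

Fact xcentroidV (c : Q) : xcentroid_mem c -> c != 0 ->
  exists d, xcentroid_mem d /\ c * d = 1.
Proof.
move=> hc c0; have [x|d [hd e]] := @martindale_closed c 1 c0.
  by rewrite mulr1 mul1r hc.
by exists d; rewrite hc -e.
Qed.

Fact xcentroidB (c d : Q) : xcentroid_mem c -> xcentroid_mem d -> xcentroid_mem (c - d).
Proof. by move=> hc hd y; rewrite mulrBl mulrBr hc hd. Qed.

Fact xcentroidM (c d : Q) : xcentroid_mem c -> xcentroid_mem d -> xcentroid_mem (c * d).
Proof. by move=> hc hd y; rewrite -mulrA hd mulrA hc mulrA. Qed.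

Fact xcentroid1 : xcentroid_mem 1.
Proof. by move=> y; rewrite mul1r mulr1. Qed.

Definition xcentroid :=
  CentralSubfield xcentroid1 xcentroidB xcentroidM (fun x h => h) xcentroidV.

Lemma xcentroid_emb (z : A) : (forall a, z * a = a * z) -> xcentroid (iota z).
Proof. by move=> hz; apply: germ_central => a; rewrite -!germ_embM hz. Qed.

Local Notation C := (csf xcentroid).
Local Notation QC := (csf_ext xcentroid).

Definition cc_emb (a : A) : QC := iota a.

Definition in_cclosure (q : QC) := exists s : seq A, lspan (map cc_emb s) q.

Definition cclosure_pred : {pred QC} := fun q => `[< in_cclosure q >].

Fact cclosure_subalg : subalg_closed cclosure_pred.
Proof.
split.
- by apply/asboolP; exists [:: 1]; apply: lspan_mem; rewrite inE /cc_emb germ_emb1.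
- move=> c u v /asboolP[s hs] /asboolP[t ht]; apply/asboolP; exists (s ++ t).
  by rewrite map_cat; apply/lspan_cat; exists (c *: u), v; split=> //; apply: lspanZ.
move=> u v /asboolP[s hs] /asboolP[t ht]; apply/asboolP.
exists [seq x * y | x <- s, y <- t].
move: hs; apply: (lspan_ind (P := fun u => @lspan C QC _ (u * v))).
- by rewrite mul0r; apply: lspan0.
- by move=> c u1 u2 h1 h2; rewrite mulrDl -scalerAl; apply: lspanD => //; apply: lspanZ.
move=> _ /mapP[x xs ->]; move: ht; apply: (lspan_ind (P := fun v => @lspan C QC _ (_ * v))).
- by rewrite mulr0; apply: lspan0.
- by move=> c u1 u2 h1 h2; rewrite mulrDr -scalerAr; apply: lspanD => //; apply: lspanZ.
move=> _ /mapP[y yt ->]; apply: lspan_mem.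
rewrite /cc_emb -germ_embM; apply: map_f; apply/allpairsP.
by exists (x, y).
Qed.
HB.instance Definition _ := GRing.isSubalgClosed.Build C QC cclosure_pred cclosure_subalg.

Record cclosure := CClosure { cc_val :> QC; cc_valP : cc_val \in cclosure_pred }.
HB.instance Definition _ := [isSub for cc_val].
HB.instance Definition _ := [Choice of cclosure by <:].
HB.instance Definition _ := [SubChoice_isSubAlgebra of cclosure by <:].

Lemma cclosureP (r : cclosure) : in_cclosure (cc_val r).
Proof. exact/asboolP/cc_valP. Qed.

Lemma cclosure_lift q : in_cclosure q -> exists r : cclosure, cc_val r = q.
Proof. by move=> /asboolP h; exists (CClosure h). Qed.

Lemma in_cclosure_emb a : in_cclosure (cc_emb a).
Proof. by exists [:: a]; apply: lspan_mem; rewrite inE. Qed.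

End Martindale.

(** * Posner's theorem *)

Section Posner.
Variables (k : fieldType) (A : algType k).
Hypothesis primeA : prime_ring A.
Hypothesis infk : infinite_field k.

Local Notation Q := (germ (martindale_filter primeA)).
Local Notation iota := (germ_emb (martindale_filter primeA)).
Local Notation C := (csf (xcentroid primeA)).
Local Notation QC := (csf_ext (xcentroid primeA)).
Local Notation R := (cclosure primeA).
Local Notation emb := (cc_emb primeA).

Lemma cclosure_emb a : exists r : R, cc_val r = emb a.
Proof. exact: cclosure_lift (in_cclosure_emb primeA a). Qed.

Lemma cclosure_prime : prime_ring R.
Proof.
move=> p q h; have [|e|e] := @martindale_prime _ primeA (cc_val p) (cc_val q); last 2 first.
- by left; apply: val_inj.
- by right; apply: val_inj.
by move=> a; have [x hx] := cclosure_emb a; have := congr1 val (h x); rewrite /= hx.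
Qed.

Lemma cclosure_closed : centrally_closed R.
Proof.
move=> p q p0 h.
have [||c [hc e]] := @martindale_closed _ primeA (cc_val p) (cc_val q).
- by apply: contra p0 => /eqP e; apply/eqP/val_inj.
- by move=> a; have [x hx] := cclosure_emb a; have := congr1 val (h x); rewrite /= hx.
have [d hd] := @csf_lift _ (xcentroid primeA) c hc.
by exists d; apply: val_inj; rewrite /= csf_scaleE hd -e.
Qed.

Lemma base_to_xcentroid (a : k) : exists c : C, csf_val c = iota a%:A.
Proof.
apply: csf_lift; apply: xcentroid_emb => x.
by rewrite -scalerAl -scalerAr mul1r mulr1.
Qed.

Definition xc_emb (a : k) : C := sval (cid (base_to_xcentroid a)).

Lemma xc_embE a : csf_val (xc_emb a) = iota a%:A.
Proof. by rewrite /xc_emb; case: cid. Qed.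

Lemma xc_emb_inj : injective xc_emb.
Proof.
move=> a b /(congr1 (@csf_val _ _)); rewrite !xc_embE => /germ_emb_inj /eqP.
rewrite -subr_eq0 -scalerBl scaler_eq0 oner_eq0 orbF subr_eq0; exact/eqP.
Qed.

Lemma infinite_xcentroid : infinite_field C.
Proof.
move=> s; have /choice[g hg] : forall c : C, exists a : k, forall b, c = xc_emb b -> a = b.
  move=> c; have [[b hb]|n] := pselect (exists b, c = xc_emb b).
    by exists b => b'; rewrite hb => /xc_emb_inj.
  by exists 0 => b hb; case: n; exists b.
have [x xs] := infk (map g s); exists (xc_emb x); apply: contra xs => h.
by rewrite -(hg _ x erefl); apply: map_f.
Qed.

(** A multilinear identity is linear over the extended centroid in each variable, so it passes from
    [A] to its span. The induction in [ev0] is on the number of variables released from [A] to the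
    closure. *)
Lemma cclosure_mlin_id : mlin_id A -> mlin_id R.
Proof.
move=> [d [al [al0 hid]]]; exists d, (fun w => xc_emb (al w)); split.
  move=> e; apply: al0; apply: xc_emb_inj; rewrite e; apply: val_inj.
  by rewrite /= xc_embE scale0r germ_emb0.
pose ev (y : nat -> QC) : QC := \sum_(w <- permutations (seq.iota 0 d)) xc_emb (al w) *: \prod_(j <- w) y j.
have evA (y : nat -> A) : ev (fun j => emb (y j)) = 0.
  transitivity (emb (mlin_eval d al y)); last by rewrite hid; exact: germ_emb0.
  rewrite /ev /mlin_eval /cc_emb (raddf_sum iota); apply: eq_bigr => w _.
  rewrite csf_scaleE xc_embE -[in RHS]mulr_algl /= germ_embM; congr (_ * _).
  by rewrite (rmorph_prod iota).
have ev_ext (y z : nat -> QC) : (forall j, (j < d)%N -> y j = z j) -> ev y = ev z.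
  move=> h; apply: eq_big_seq => w; rewrite mem_permutations => pw; congr (_ *: _).
  by apply: eq_big_seq => j; rewrite (perm_mem pw) mem_iota => /h.
have ev0 m : (m <= d)%N -> forall y : nat -> QC, (forall j, (j < m)%N -> in_cclosure (y j)) ->
    (forall j, (m <= j)%N -> exists a, y j = emb a) -> ev y = 0.
  elim: m => [_ y _ hy|m IH lmd y hy1 hy2].
    have /choice[z hz] : forall j, exists a, y j = emb a by move=> j; apply: (hy).
    by rewrite -[RHS](evA z); apply: ev_ext => j _.
  pose yq (q : QC) j := if j == m then q else y j.
  have evD (c : C) (u v : QC) : ev (yq (c *: u + v)) = c *: ev (yq u) + ev (yq v).
    rewrite /ev scaler_sumr -big_split; apply: eq_big_seq => w.
    rewrite mem_permutations => pw /=.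
    have mw : m \in w by rewrite (perm_mem pw) mem_iota.
    have uw : uniq w by rewrite (perm_uniq pw) iota_uniq.
    case/splitPr: mw uw => w1 w2; rewrite cat_uniq /= negb_or.
    case/and3P=> _ /andP[m1 _] /andP[m2 _].
    have out (q : QC) (l : seq nat) : m \notin l -> \prod_(j <- l) yq q j = \prod_(j <- l) y j.
      move=> ml; apply: eq_big_seq => j jl; rewrite /yq.
      by case: eqP => // jm; rewrite -jm jl in ml.
    rewrite !big_cat !big_cons /= !out // /yq !eqxx.
    rewrite scalerA mulrC -scalerA -scalerDr.
    by rewrite mulrDl mulrDr -(@scalerAl C QC) -(@scalerAr C QC).
  have -> : ev y = ev (yq (y m)) by apply: ev_ext => j _; rewrite /yq; case: eqP => [->|].
  have [s] := hy1 m (ltnSn m); apply: (@lspan_ind C QC (fun q => ev (yq q) = 0)).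
  - apply: IH => [|j lj|j lj]; first exact: ltnW.
      by rewrite /yq ltn_eqF //; apply/hy1/ltnW.
    rewrite /yq; case: eqP => [_|/eqP jm]; first by exists 0; rewrite /cc_emb germ_emb0.
    by apply: hy2; rewrite ltn_neqAle eq_sym jm.
  - by move=> c u v hu hv; rewrite evD hu hv scaler0 addr0.
  move=> _ /mapP[a _ ->]; apply: IH => [|j lj|j lj]; first exact: ltnW.
    by rewrite /yq ltn_eqF //; apply/hy1/ltnW.
  rewrite /yq; case: eqP => [_|/eqP jm]; first by exists a.
  by apply: hy2; rewrite ltn_neqAle eq_sym jm.
move=> y; apply: val_inj; rewrite /mlin_eval (raddf_sum val) [RHS](raddf0 val).
pose z j : QC := if (j < d)%N then cc_val (y j) else 0.
apply: (@etrans _ _ (ev z)).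
  rewrite (ev_ext z (fun j => cc_val (y j))) => [|j lj]; last by rewrite /z lj.
  apply: eq_bigr => w _; transitivity (xc_emb (al w) *: (cc_val (\prod_(j <- w) y j) : QC)) => //.
  by rewrite (big_morph (@cc_val A primeA) (id1 := 1) (op1 := *%R)).
apply: (ev0 d) => // j lj; first by rewrite /z lj; apply: cclosureP.
by exists 0; rewrite /z ltnNge lj /cc_emb germ_emb0.
Qed.

Hypothesis hid : mlin_id A.

Lemma cclosure_fin_dim : fin_dim R.
Proof.
exact: (prime_PI_fin_dim infinite_xcentroid cclosure_prime cclosure_closed (cclosure_mlin_id hid)).
Qed.

Local Notation MF := (martindale_filter primeA).

Let emb_eq0 a : iota a = 0 -> a = 0.
Proof. by move=> h; apply: (@germ_emb_inj _ MF); rewrite h germ_emb0. Qed.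

Let central_of_xcentroid (z : A) (c : Q) : xcentroid primeA c -> iota z = c ->
  forall a, z * a = a * z.
Proof. by move=> hc e a; apply: (@germ_emb_inj _ MF); rewrite !germ_embM e hc. Qed.

Lemma flt_bigcap (T : eqType) (s : seq T) (H : T -> A -> Prop) :
  (forall m, m \in s -> MF (H m)) ->
  exists W, MF W /\ forall y, W y -> forall m, m \in s -> H m y.
Proof.
elim: s => [_|m s IH h]; first by exists (fun=> True); split=> //; apply: fltT.
have [|W [FW hW]] := IH; first by move=> l ls; apply: h; rewrite inE ls orbT.
exists (fun y => H m y /\ W y); split; first by apply: flt_cap => //; apply: h; rewrite mem_head.
by move=> y [Hy Wy] l; rewrite inE => /orP[/eqP ->//|]; apply: hW.
Qed.

(** The outer factors [x] and [z] make the denominators of [q] a two-sided ideal, as membership in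
    the filter demands. *)
Let denom (q : QC) (y : A) := forall x z,
  (exists a, q * iota (x * y * z) = iota a) /\ (exists a, iota (x * y * z) * q = iota a).

Lemma denom_flt (q : QC) : in_cclosure q -> MF (denom q).
Proof.
have idl u : ring_ideal (denom u).
  split=> [x z|y1 y2 h1 h2 x z|b y h x z|b y h x z].
  - by rewrite mulr0 mul0r germ_emb0 mulr0 mul0r; split; exists 0; rewrite germ_emb0.
  - rewrite mulrBr mulrBl germ_embB mulrBr mulrBl.
    have [[a1 e1] [a2 e2]] := h1 x z; have [[b1 d1] [b2 d2]] := h2 x z.
    rewrite e1 e2 d1 d2; split; [exists (a1 - b1)|exists (a2 - b2)]; by rewrite germ_embB.
  - by rewrite mulrA; apply: h.
  - by have := h x (b * z); rewrite !mulrA.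
case=> t; apply: (@lspan_ind C QC (fun q => MF (denom q))).
- apply: (flt_mul (fltT MF) (fltT MF)) => // x y _ _ u v.
  by rewrite mulr0 mul0r; split; exists 0; rewrite germ_emb0.
- move=> c u v Fu Fv; have [I [FI hI]] := germ_dom (csf_val c).
  have [_ _ Il _] := flt_ideal FI.
  (* In the product [i * y] the factor [i] absorbs the scalar [c] and clears [v], while [y] clears
     [u]. *)
  apply: (flt_mul (flt_cap FI Fv) Fu) => // i y [Ii vi] uy x z.
  have [b hb] := hI _ (Il x _ Ii).
  have cc (p p' : Q) : p * (csf_val c * p') = csf_val c * p * p' by rewrite mulrA -(csfP c).
  have eX : x * (i * y) * z = x * i * (y * z) by rewrite !mulrA.
  have [[a1 e1] [a2 e2]] := uy b z; have [[b1 d1] [b2 d2]] := vi x (y * z).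
  have eb : iota (b * y * z) = csf_val c * iota (x * i * (y * z)).
    by rewrite -[b * y * z]mulrA germ_embM -hb -mulrA -germ_embM.
  rewrite csf_scaleE eX; split.
    exists (a1 + b1); rewrite germ_embD -e1 -d1 mulrDl; congr (_ + _).
    by rewrite eb; apply/esym/cc.
  exists (a2 + b2); rewrite germ_embD -e2 -d2 mulrDr; congr (_ + _).
  by rewrite eb; apply: cc.
- move=> _ /mapP[a _ ->]; apply: (flt_mul (fltT MF) (fltT MF)) => // x y _ _ u v.
  by rewrite /cc_emb -!germ_embM; split; eexists.
Qed.

(** Let [g] be the central-valued generalized polynomial of the closure. At [y1 i y2], with [i] in
    [I] and denominators [y1], [y2] of its coefficients, its value lies in [I] and is central. If
    all these values vanished, so would [g] on a nonzero ideal [J] of [A], and [gpi_trivial] would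
    make [J] annihilate a nonzero coefficient of [g]. *)
Theorem ideal_meets_center (I : A -> Prop) : ring_ideal I -> (exists x, I x /\ x <> 0) ->
  exists z, [/\ I z, z <> 0 & forall a, z * a = a * z].
Proof.
move=> iI nI; apply: contrapT => hno; have FI : MF I by split.
have [I0 IB Il Ir] := iI.
have [s [fs [m0 m0s m0n] hs]] := central_gpi cclosure_prime cclosure_closed cclosure_fin_dim.
have [|W [FW hW]] := @flt_bigcap _ s (fun m y => denom (cc_val m.1) y /\ denom (cc_val m.2) y).
  by move=> m ms; apply: flt_cap; apply: denom_flt; apply: cclosureP.
have [W0 WB Wl Wr] := flt_ideal FW.
pose g (q : QC) : QC := \sum_(m <- s) cc_val m.1 * q * cc_val m.2.
have valg (r : R) : cc_val (\sum_(m <- s) m.1 * r * m.2) = g (cc_val r).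
  by rewrite (big_morph (@cc_val A primeA) (id1 := 0) (op1 := +%R)).
have gD (c : C) (u v : QC) : g (c *: u + v) = c *: g u + g v.
  rewrite /g scaler_sumr -big_split; apply: eq_bigr => m _ /=.
  by rewrite mulrDr mulrDl -(@scalerAr C QC) -(@scalerAl C QC).
have g0 y1 i y2 : W y1 -> I i -> W y2 -> g (emb (y1 * i * y2)) = 0.
  move=> W1 Ii W2.
  have /choice[a ha] : forall m, exists a, m \in s -> cc_val m.1 * iota y1 = iota a.
    move=> m; have [ms|] := boolP (m \in s); last by exists 0.
    by have [/(_ 1 1)[[a e] _] _] := hW _ W1 _ ms; exists a => _; rewrite -e mul1r mulr1.
  have /choice[b hb] : forall m, exists b, m \in s -> iota y2 * cc_val m.2 = iota b.
    move=> m; have [ms|] := boolP (m \in s); last by exists 0.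
    by have [_ /(_ 1 1)[_ [b e]]] := hW _ W2 _ ms; exists b => _; rewrite -e mul1r mulr1.
  have gE : g (emb (y1 * i * y2)) = iota (\sum_(m <- s) a m * i * b m).
    rewrite /g (raddf_sum iota); apply: eq_big_seq => m ms.
    by rewrite /cc_emb /= !germ_embM -ha // -hb // !mulrA.
  have [r hr] := cclosure_emb (y1 * i * y2); have [c hc] := hs r.
  have ec : g (emb (y1 * i * y2)) = csf_val c.
    by rewrite -hr -valg hc /= csf_scaleE mulr1.
  rewrite gE; have [->|/eqP z0] := eqVneq (\sum_(m <- s) a m * i * b m) 0; first exact: germ_emb0.
  case: hno; exists (\sum_(m <- s) a m * i * b m); split=> //.
    apply: (big_ind I) => //.
      by move=> x y Ix Iy; rewrite -[y]opprK; apply: (IB) => //; rewrite -sub0r; apply: IB.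
    by move=> m _; apply/Ir/Il.
  by apply: (central_of_xcentroid (csfP c)); rewrite -gE.
(* The denominators are absorbed into the ideal one side at a time: [I W] lies in [J1], and [W J1]
   lies in [J]. *)
pose J1 x := forall y1 a b, W y1 -> g (emb (y1 * (a * x * b))) = 0.
pose J x := forall a b, g (emb (a * x * b)) = 0.
have gz : g (emb 0) = 0.
  rewrite /cc_emb germ_emb0 /g big1 // => m _.
  by rewrite mulr0 mul0r.
have gBq (u v : QC) : g (u - v) = g u - g v.
  by rewrite addrC -scaleN1r gD scaleN1r addrC.
have gB u v : g (emb (u - v)) = g (emb u) - g (emb v).
  by rewrite {1}/cc_emb germ_embB; apply: gBq.
have FJ1 : MF J1.
  apply: (flt_mul FI FW).
    split=> [y a b W1|x y hx hy y1 a b W1|c x hx y1 a b W1|c x hx y1 a b W1].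
    - by rewrite mulr0 mul0r mulr0 gz.
    - by rewrite mulrBr mulrBl mulrBr gB hx // hy // subrr.
    - by rewrite (mulrA a); apply: hx.
    - by rewrite (mulrA a) -(mulrA _ c); apply: hx.
  move=> i y2 Ii W2 y1 a b W1.
  have -> : y1 * (a * (i * y2) * b) = y1 * (a * i) * (y2 * b) by rewrite !mulrA.
  by apply: g0 => //; [apply: Il|apply: Wr].
have FJ : MF J.
  apply: (flt_mul FW FJ1).
    split=> [a b|x y hx hy a b|c x hx a b|c x hx a b].
    - by rewrite mulr0 mul0r gz.
    - by rewrite mulrBr mulrBl gB hx // hy // subrr.
    - by rewrite (mulrA a); apply: hx.
    - by rewrite (mulrA a) -(mulrA _ c); apply: hx.
  move=> y1 x W1 hx a b.
  have -> : a * (y1 * x) * b = (a * y1) * (1 * x * b) by rewrite mul1r !mulrA.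
  by apply: hx; apply: Wl.
have Jm2 j : J j -> iota j * cc_val m0.2 = 0.
  move=> Jj; have [r hr] := cclosure_emb j.
  (* For fixed [j] in [J] the map [x -> g (x j)] is a generalized polynomial with right coefficients
     [j m.2]. It vanishes on [A], hence on the closure. *)
  pose s' := [seq (m.1, r * m.2) | m <- s].
  have fs' : lfree (map fst s') by rewrite -map_comp (eq_map (g := fst)).
  have hs' x : \sum_(m <- s') m.1 * x * m.2 = 0.
    rewrite /s' big_map; apply: val_inj.
    have -> : \sum_(m <- s) m.1 * x * (r * m.2) = \sum_(m <- s) m.1 * (x * r) * m.2.
      by apply: eq_bigr => m _; rewrite !mulrA.
    rewrite [LHS]valg /= hr; have [t] := cclosureP x.
    apply: (@lspan_ind C QC (fun q => g (q * emb j) = 0)).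
    - by rewrite mul0r; move: gz; rewrite {1}/cc_emb germ_emb0.
    - by move=> c u v hu hv; rewrite mulrDl -(@scalerAl C QC) gD hu hv scaler0 addr0.
    by move=> _ /mapP[a _ ->]; have := Jj a 1; rewrite mulr1 {1}/cc_emb germ_embM.
  have := gpi_trivial cclosure_prime cclosure_closed fs' hs' (m := (m0.1, r * m0.2)).
  move=> /(_ (map_f (fun m => (m.1, r * m.2)) m0s)) /= /(congr1 val) /=.
  by rewrite hr.
have [[_ _ _ Jr] [j [Jj j0]]] := FJ.
have [x|/emb_eq0//|e] := @martindale_prime _ primeA (iota j) (cc_val m0.2).
  by rewrite -germ_embM; apply/Jm2/Jr.
by case/eqP: m0n; apply: val_inj.
Qed.

(** The closure is spanned by elements of [A] over the extended centroid. The common denominators of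
    the coefficients of [a] contain a nonzero ideal of [A], which contains a nonzero central [w]. *)
Theorem finite_rank_over_center : exists s : seq A, forall a, exists w (c : nat -> A),
  [/\ w <> 0, forall x, w * x = x * w, forall i x, c i * x = x * c i
    & w * a = \sum_(i < size s) c i * s`_i].
Proof.
have /fin_dimP[t ht] := cclosure_fin_dim.
have [s hs] : exists s : seq A, forall r, r \in t -> @lspan C QC (map emb s) (cc_val r).
  elim: (t) => [|r t' [s hs]]; first by exists [::].
  have [s1 hs1] := cclosureP r; exists (s1 ++ s) => r'; rewrite inE map_cat.
  by case/orP=> [/eqP ->|/hs h]; [apply: lspan_sub hs1|apply: lspan_sub h] => x xs;
    rewrite mem_cat xs ?orbT.
exists s => a; have [r hr] := cclosure_emb a.
have : @lspan C QC (map emb s) (emb a).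
  rewrite -hr; apply: (@lspan_trans C QC (map (@cc_val A primeA) t)).
    by move=> _ /mapP[r' /hs h ->].
  by apply: lspan_map (ht r).
case/lspan_nth=> c; rewrite size_map => hc.
have [|W [FW hW]] := @flt_bigcap _ (seq.iota 0 (size s))
    (fun i y => forall x, exists b, csf_val (c i) * iota (y * x) = iota b).
  move=> i _; have [I [FI hI]] := germ_dom (csf_val (c i)); have [I0 IB Il Ir] := flt_ideal FI.
  apply: (flt_mul FI FI); last first.
    by move=> x y Ix Iy z; apply: hI; apply/Ir/Ir.
  split=> [x|x y hx hy z|b x hx y|b x hx y].
  - by exists 0; rewrite mul0r germ_emb0 mulr0.
  - have [b1 e1] := hx z; have [b2 e2] := hy z; exists (b1 - b2).
    by rewrite mulrBl !germ_embB mulrBr e1 e2.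
  - have [d e] := hx y; exists (b * d).
    have -> : csf_val (c i) * iota (b * x * y) = iota b * (csf_val (c i) * iota (x * y)).
      by rewrite -(mulrA b) [in LHS]germ_embM !mulrA (csfP (c i)).
    by rewrite e -germ_embM.
  - by rewrite -mulrA; apply: hx.
have [[iW nW] _] : MF W /\ True by [].
have [w [Ww w0 cw]] := ideal_meets_center iW nW.
have /choice[z hz] : forall i, exists b, (i < size s)%N -> csf_val (c i) * iota w = iota b.
  move=> i; have [li|] := boolP (i < size s)%N; last by exists 0.
  have [|b e] := hW _ Ww i _ 1; first by rewrite mem_iota.
  by exists b => _; rewrite -e mulr1.
exists w, (fun i => if (i < size s)%N then z i else 0); split=> //.
  move=> i; case: ifP => li x; last by rewrite mul0r mulr0.
  apply: (central_of_xcentroid _ (esym (hz i li))).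
  by apply: xcentroidM; [exact: (csfP (c i))|exact: (@xcentroid_emb A primeA w cw)].
apply: (@germ_emb_inj _ MF); rewrite germ_embM -/(emb a) hc (raddf_sum iota) mulr_sumr.
apply: eq_bigr => i _; rewrite ltn_ord /= germ_embM -hz // (nth_map 0) // csf_scaleE.
by rewrite -[RHS]mulrA [RHS]mulrA mulrA (csfP (c i)).
Qed.

End Posner.

(** * Field extensions of transcendence degree one *)

Section FunctionFields.
Variables (k L : fieldType) (e : {rmorphism k -> L}).

Definition reval (u : L) : {poly k} -> L := horner_eval u \o map_poly e.
HB.instance Definition _ u := GRing.RMorphism.copy (reval u) (horner_eval u \o map_poly e).

Lemma revalX u : reval u 'X = u.
Proof. by rewrite /reval /= map_polyX horner_evalE hornerX. Qed.

Lemma revalC u c : reval u c%:P = e c.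
Proof. by rewrite /reval /= map_polyC horner_evalE hornerC. Qed.

Definition transc (u : L) := forall p, reval u p = 0 -> p = 0.

Definition simple_mem (u x : L) := exists p q, reval u q != 0 /\ x = reval u p / reval u q.

Section SimpleExt.
Variable u : L.

Fact simple_mem1 : simple_mem u 1.
Proof. by exists 1, 1; rewrite rmorph1 oner_neq0 divr1. Qed.

Fact simple_memB x y : simple_mem u x -> simple_mem u y -> simple_mem u (x - y).
Proof.
move=> [p [q [q0 ->]]] [p' [q' [q'0 ->]]]; exists (p * q' - p' * q), (q * q').
rewrite rmorphM mulf_neq0 // -(mulNr (reval u p')) addf_div // mulNr.
by rewrite rmorphB !rmorphM.
Qed.

Fact simple_memM x y : simple_mem u x -> simple_mem u y -> simple_mem u (x * y).
Proof.
move=> [p [q [q0 ->]]] [p' [q' [q'0 ->]]]; exists (p * p'), (q * q').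
by rewrite !rmorphM mulf_neq0 // mulf_div.
Qed.

Fact simple_memV x : simple_mem u x -> x != 0 -> exists y, simple_mem u y /\ x * y = 1.
Proof.
move=> [p [q [q0 ->]]] x0; exists (reval u q / reval u p).
have p0 : reval u p != 0 by apply: contra x0 => /eqP ->; rewrite mul0r.
by split; [exists q, p|rewrite mulrA divfK // divff].
Qed.

Definition simple_ext : central_subfield L :=
  CentralSubfield simple_mem1 simple_memB simple_memM (fun x _ y => mulrC x y) simple_memV.

Lemma simple_ext_reval p : simple_ext (reval u p).
Proof. by exists p, 1; rewrite rmorph1 oner_neq0 divr1. Qed.

Lemma common_denominator n (c : nat -> L) : (forall j, (j < n)%N -> simple_ext (c j)) ->
  exists (D : {poly k}) (N : nat -> {poly k}),
    reval u D != 0 /\ forall j, (j < n)%N -> reval u D * c j = reval u (N j).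
Proof.
elim: n => [|n IH] h; first by exists 1, (fun=> 0); rewrite rmorph1 oner_neq0.
have [|D [N [D0 hN]]] := IH; first by move=> j jn; apply/h/leqW.
have [p [q [q0 cE]]] := h n (ltnSn n).
exists (D * q), (fun j => if j == n then D * p else N j * q); split.
  by rewrite rmorphM mulf_neq0.
move=> j; rewrite ltnS leq_eqVlt; case: (eqVneq j n) => [-> _|_ /= jn].
  by rewrite cE !rmorphM -mulrA; congr (_ * _); rewrite mulrC divfK.
by rewrite !rmorphM mulrAC hN.
Qed.

End SimpleExt.

Definition algebraic_over (E : central_subfield L) (y : L) :=
  exists p : {poly L}, [/\ p != 0, forall i, E p`_i & p.[y] = 0].

(** Algebraic dependence as a bivariate relation over [k], with [u] in the coefficients and [v] as
    main variable. Unlike [algebraic_over] it is symmetric, which supplies the exchange of [u] and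
    [v]. *)
Definition alg_rel (u v : L) := exists P : {poly {poly k}},
  P != 0 /\ (map_poly (reval u) P).[v] = 0.

Lemma reval_swap u v (P : {poly {poly k}}) :
  (map_poly (reval v) (swapXY P)).[u] = (map_poly (reval u) P).[v].
Proof.
elim/poly_ind: P => [|P c IH]; first by rewrite rmorph0 !map_poly0 !horner0.
rewrite !rmorphD !rmorphM /= !hornerD !hornerM IH swapXY_X map_polyX hornerX.
rewrite map_polyC hornerC /= revalX; congr (_ + _).
rewrite swapXY_polyC map_polyC hornerC /= -map_poly_comp.
by rewrite (eq_map_poly (g := e)) // => a /=; rewrite revalC.
Qed.

Lemma alg_rel_sym u v : alg_rel u v -> alg_rel v u.
Proof.
by move=> [P [P0 h]]; exists (swapXY P); rewrite swapXY_eq0 P0 reval_swap.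
Qed.

Lemma alg_rel_algebraic u v : transc u -> alg_rel u v -> algebraic_over (simple_ext u) v.
Proof.
move=> tu [P [P0 h]]; exists (map_poly (reval u) P); split=> //.
  apply: contra P0 => /eqP e0; apply/eqP/polyP => i; rewrite coef0; apply: tu.
  by rewrite -coef_map e0 coef0.
by move=> i; rewrite coef_map; apply: simple_ext_reval.
Qed.

Lemma algebraic_alg_rel u v : algebraic_over (simple_ext u) v -> alg_rel u v.
Proof.
move=> [p [p0 hp pv]].
have [|D [N [D0 hN]]] := @common_denominator u (size p) (fun j => p`_j).
  by move=> j _; apply: hp.
have e1 : map_poly (reval u) (\poly_(j < size p) N j) = reval u D *: p.
  apply/polyP => i; rewrite coef_map coefZ coef_poly; case: ltnP => [/hN ->//|le].
  rewrite nth_default // mulr0; exact: (rmorph0 (reval u)).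
exists (\poly_(j < size p) N j); split; last by rewrite e1 hornerZ pv mulr0.
apply/eqP => q0; move: e1; rewrite q0 map_poly0 => /esym/eqP.
by rewrite scaler_eq0 (negPf D0) (negPf p0).
Qed.

Lemma not_lfree_coef (F : fieldType) (V : lmodType F) (T : eqType) (f : T -> V) (r : seq T) :
  uniq r -> ~ lfree (map f r) ->
  exists c : T -> F, \sum_(i <- r) c i *: f i = 0 /\ exists2 i, i \in r & c i != 0.
Proof.
move=> ur nf; apply: contrapT => h; apply: nf; apply: lfree_map => // c hc i ir.
by apply/eqP/negPn/negP => ci; apply: h; exists c; split=> //; exists i.
Qed.

Definition finite_over (F : central_subfield L) (P : L -> Prop) :=
  exists s : seq (csf_ext F), forall x, P x -> @lspan (csf F) (csf_ext F) s x.

Lemma finite_over_algebraic (F : central_subfield L) (P : L -> Prop) y :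
  finite_over F P -> (forall i, P (y ^+ i)) -> algebraic_over F y.
Proof.
move=> [s hs] Py.
have ui : uniq (iota 0 (size s).+1) by apply: iota_uniq.
have [|c [hc [i ir ci]]] := @not_lfree_coef (csf F) (csf_ext F) nat (fun i => y ^+ i) _ ui.
  move=> fr; have := @lfree_exchange (csf F) (csf_ext F) _ s fr.
  rewrite size_map size_iota => /(_ _); rewrite ltnn => h.
  by suff: false by []; apply: h => _ /mapP[j _ ->]; apply: hs.
exists (\poly_(j < (size s).+1) csf_val (c j)); split.
- apply/eqP => /polyP/(_ i); rewrite coef_poly coef0.
  move: ir; rewrite mem_iota => /= -> e0; case/eqP: ci.
  exact: val_inj.
- move=> j; rewrite coef_poly; case: ifP => _; first exact: csfP.
  by rewrite -(subrr 1); apply: csf_memB; apply: csf_mem1.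
rewrite horner_poly -[RHS]hc -(big_mkord xpredT (fun j => csf_val (c j) * y ^+ j)) /index_iota subn0.
by apply: eq_bigr.
Qed.

Lemma csf_mem0 (F : central_subfield L) : F 0.
Proof. by rewrite -(subrr 1); apply: csf_memB; apply: csf_mem1. Qed.

Lemma csf_memN (F : central_subfield L) x : F x -> F (- x).
Proof. by move=> Fx; rewrite -sub0r; apply: csf_memB => //; apply: csf_mem0. Qed.

Lemma csf_memD (F : central_subfield L) x y : F x -> F y -> F (x + y).
Proof. by move=> Fx Fy; rewrite -[y]opprK; apply: csf_memB => //; apply: csf_memN. Qed.

Lemma csf_mem_inv (F : central_subfield L) x : F x -> F x^-1.
Proof.
move=> Fx; have [->|x0] := eqVneq x 0; first by rewrite invr0; apply: csf_mem0.
have [y [Fy xy]] := csf_memV Fx x0.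
by rewrite -[x^-1]mulr1 -xy mulKf.
Qed.

Lemma subring_horner (P : L -> Prop) (p : {poly L}) x :
  P 0 -> (forall a b, P a -> P b -> P (a + b)) -> (forall a b, P a -> P b -> P (a * b)) ->
  (forall i, P p`_i) -> P x -> P p.[x].
Proof.
move=> P0 PD PM; elim/poly_ind: p => [|p c IH] hp Px; first by rewrite horner0.
rewrite hornerD hornerM hornerX hornerC; apply: (PD).
  apply: (PM) => //; apply: IH => // i.
  by have := hp i.+1; rewrite coefD coefMX coefC addr0.
by have := hp 0%N; rewrite coefD coefMX coefC add0r.
Qed.

(** After removing powers of [x], the equation has a nonzero constant term [c] and reads
    [p(x) x = - c]; thus [x] is invertible in any ring containing [F] and [x]. *)
Lemma algebraic_inverse (F : central_subfield L) (P : L -> Prop) x :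
  (forall a, F a -> P a) -> (forall a b, P a -> P b -> P (a + b)) ->
  (forall a b, P a -> P b -> P (a * b)) ->
  P x -> x != 0 -> algebraic_over F x -> exists y, P y /\ x * y = 1.
Proof.
move=> PF PD PM Px x0 [p [+ + +]]; elim/poly_ind: p => [|p c IH]; first by rewrite eqxx.
move=> p0 hp; have hp' i : F p`_i.
  by have := hp i.+1; rewrite coefD coefMX coefC addr0.
have Fc : F c by have := hp 0%N; rewrite coefD coefMX coefC add0r.
rewrite hornerD hornerM hornerX hornerC.
have [c0|cn] := eqVneq c 0.
  rewrite c0 addr0 => /eqP; rewrite mulf_eq0 (negPf x0) orbF => /eqP; apply: IH => //.
  by apply: contra p0 => /eqP ->; rewrite c0 mul0r addr0.
move=> /eqP; rewrite addr_eq0 => /eqP h; exists (p.[x] * - c^-1); split.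
  apply: (PM); last by apply/PF/csf_memN/csf_mem_inv.
  by apply: subring_horner => //; [apply/PF/csf_mem0|move=> i; apply: PF].
by rewrite mulrA [x * _]mulrC h mulrNN mulfV.
Qed.

(* E[y] is spanned over F by the products of a spanning list of E with 1, ..., y^(n-1). *)
Lemma adjoin_algebraic (F E : central_subfield L) y :
  (forall x, F x -> E x) -> finite_over F E -> algebraic_over E y ->
  exists E' : central_subfield L,
    [/\ forall x, E x -> E' x, E' y & finite_over F E'].
Proof.
move=> FE [s hs] [m [m0 hm my]].
pose n := (size m).-1.
have mn : m`_n != 0 by rewrite -/(lead_coef m) lead_coef_eq0.
pose P x := exists p : {poly L}, (forall i, E p`_i) /\ x = p.[y].
pose T := [seq (a : L) * y ^+ i | a <- s, i <- iota 0 n] : seq (csf_ext F).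
have yn : y ^+ n = \sum_(i < n) (- (m`_i / m`_n)) * y ^+ i.
  have sm : size m = n.+1 by rewrite /n prednK // lt0n size_poly_eq0.
  have e1 : \sum_(i < n) m`_i * y ^+ i = - (m`_n * y ^+ n).
    by apply/eqP; rewrite -addr_eq0 -[X in _ == X]my horner_coef sm big_ord_recr.
  apply: (mulfI mn); rewrite -[LHS]opprK -e1 mulr_sumr -sumrN.
  by apply: eq_bigr => i _; rewrite mulNr mulrN mulrA [m`_n * _]mulrC divfK.
have hT j a : E a -> @lspan (csf F) (csf_ext F) T (a * y ^+ j).
  elim/ltn_ind: j a => j IH a Ea; have [jn|nj] := ltnP j n.
    have := @lspan_map (csf F) (csf_ext F) (csf_ext F) (fun x : L => x * y ^+ j) s a _ (hs _ Ea).
    move/(_ (@mulr_linear (csf F) (csf_ext F) (y ^+ j))).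
    apply: lspan_sub => _ /mapP[b bs ->]; apply/allpairsP.
    by exists (b, j); rewrite mem_iota.
  rewrite -(subnK nj) exprD yn mulr_sumr mulr_sumr; apply: lspan_sum => i _.
  have -> : a * (y ^+ (j - n) * (- (m`_i / m`_n) * y ^+ i)) =
      (a * - (m`_i / m`_n)) * y ^+ (j - n + i).
    by rewrite exprD [y ^+ (j - n) * _]mulrCA !mulrA.
  apply: IH; first by rewrite -ltn_subRL subKn // ltn_ord.
  by apply: csf_memM => //; apply/csf_memN/csf_memM => //; apply/csf_mem_inv.
have PT x : P x -> @lspan (csf F) (csf_ext F) T x.
  move=> [p [hp ->]]; rewrite horner_coef; apply: lspan_sum => i _; exact: hT.
have EP x : E x -> P x.
  move=> Ex; exists x%:P; rewrite hornerC; split=> // i; rewrite coefC.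
  by case: ifP => // _; apply: csf_mem0.
have PB x z : P x -> P z -> P (x - z).
  move=> [p [hp ->]] [q [hq ->]]; exists (p - q); rewrite hornerD hornerN; split=> // i.
  by rewrite coefB; apply: csf_memB.
have PM x z : P x -> P z -> P (x * z).
  move=> [p [hp ->]] [q [hq ->]]; exists (p * q); rewrite hornerM; split=> // i.
  rewrite coefM; apply: (big_ind E); [exact: csf_mem0|exact: csf_memD|].
  by move=> l _; apply: csf_memM.
have PD x z : P x -> P z -> P (x + z).
  move=> Px Pz; rewrite -[z]opprK; apply: (PB) => //; rewrite -sub0r; apply: PB => //.
  by apply/EP/csf_mem0.
have fP : finite_over F P by exists T.
(* The powers of [x] stay in [P], which is finite over [F], so [x] is algebraic over [F]. *)
have PV x : P x -> x != 0 -> exists z, P z /\ x * z = 1.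
  move=> Px x0; apply: (@algebraic_inverse F) => //; first by move=> a /FE/EP.
  apply: (finite_over_algebraic fP); elim=> [|i IH]; first exact/EP/csf_mem1.
  by rewrite exprS; apply: PM.
exists (CentralSubfield (EP _ (csf_mem1 E)) PB PM (fun x _ z => mulrC x z) PV); split=> //.
exists 'X; rewrite hornerX; split=> // i; rewrite coefX.
by case: eqP => _; [apply: csf_mem1|apply: csf_mem0].
Qed.

Lemma finite_over_self (F : central_subfield L) : finite_over F F.
Proof.
exists [:: 1 : csf_ext F] => x Fx; have [c hc] := csf_lift Fx.
by exists c; rewrite csf_scaleE hc mulr1 subrr.
Qed.

Lemma algebraic_overW (F E : central_subfield L) y :
  (forall x, F x -> E x) -> algebraic_over F y -> algebraic_over E y.
Proof. by move=> FE [p [p0 hp py]]; exists p; split=> // i; apply: FE. Qed.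

Lemma simple_ext_sub (E : central_subfield L) u :
  (forall c, E (e c)) -> E u -> forall x, simple_ext u x -> E x.
Proof.
move=> Ee Eu x [p [q [_ ->]]].
have h p' : E (reval u p').
  apply: subring_horner => //; [exact: csf_mem0|exact: csf_memD|exact: csf_memM|].
  by move=> i; rewrite coef_map; apply: Ee.
by apply: csf_memM; [apply: h|apply/csf_mem_inv/h].
Qed.

Lemma simple_ext_base u c : simple_ext u (e c).
Proof. by rewrite -(revalC u); apply: simple_ext_reval. Qed.

Lemma not_alg_indep_rel u v : ~ alg_indep e [:: u; v] -> alg_rel u v.
Proof.
move=> h; have [p [hp p0]] : exists p : {mpoly k[2]}, mmap e (fun i => [:: u; v]`_i) p = 0 /\ p <> 0.
  by apply: contrapT => n; apply: h => p hp; apply: contrapT => p0; apply: n; exists p.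
pose i0 : 'I_2 := ord0; pose i1 : 'I_2 := lift ord0 ord0.
exists (\sum_(m <- msupp p) (p@_m *: 'X^(m i0))%:P * 'X^(m i1)); split.
  have [m mp] : exists m, m \in msupp p.
    case E : (msupp p) => [|m l]; last by exists m; rewrite mem_head.
    by case: p0; apply/eqP; rewrite -msupp_eq0 E.
  apply/eqP => /polyP/(_ (m i1)); rewrite coef0 coef_sum => /polyP/(_ (m i0)).
  rewrite coef0 coef_sum (bigD1_seq m) ?msupp_uniq //=.
  rewrite coefCM coefXn eqxx mulr1 coefZ coefXn eqxx mulr1 big1 ?addr0.
    by move/eqP; rewrite mcoeff_eq0 mp.
  move=> m' nm; rewrite coefCM coefXn; case: eqP => [e1|_]; last by rewrite mulr0 coef0.
  rewrite mulr1 coefZ coefXn; case: eqP => [e0|_]; last by rewrite mulr0.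
  case/eqP: nm; apply/mnmP => i; case: (unliftP ord0 i) => [j ->|->] //.
  by rewrite (ord1 j).
rewrite -[RHS]hp /mmap raddf_sum /= horner_sum; apply: eq_bigr => m _.
rewrite rmorphM /= map_polyC map_polyXn hornerM hornerC hornerXn /=.
rewrite /mmap1 !big_ord_recl big_ord0 mulr1 mulrA /=.
by rewrite -mul_polyC rmorphM /= revalC rmorphXn /= revalX.
Qed.

Lemma alg_rel_not_indep u v s : alg_rel u v -> ~ alg_indep e [:: u, v & s].
Proof.
move=> [P [P0 hP]] h.
pose n := size [:: u, v & s]; pose i0 : 'I_n := ord0; pose i1 : 'I_n := lift ord0 ord0.
pose mm a b : 'X_{1..n} := (U_(i0) *+ a + U_(i1) *+ b)%MM.
have mmi a b a' b' : (mm a b == mm a' b') = (a == a') && (b == b').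
  apply/eqP/andP => [/mnmP E|[/eqP -> /eqP ->]//].
  have := E i0; have := E i1; rewrite !mnmDE !mulmnE !mnm1E.
  by rewrite !mul0n !mul1n !addn0 !add0n => -> ->.
pose q : {mpoly k[n]} := \sum_(j < size P) \sum_(i < size P`_j) P`_j`_i *: 'X_[mm i j].
have q0 : q = 0.
  apply: h; rewrite -[RHS]hP (@horner_coef_wide _ (size P)) ?size_poly // /q raddf_sum.
  apply: eq_bigr => j _; rewrite raddf_sum coef_map /=.
  rewrite /reval /= horner_evalE (@horner_coef_wide _ (size P`_j)) ?size_poly // mulr_suml.
  apply: eq_bigr => i _; rewrite coef_map /= mmapZ mmapX -mulrA; congr (_ * _).
  rewrite /mm /mmap1 !big_ord_recl /= big1 => [|i' _]; last first.
    by rewrite !mnmDE !mulmnE !mnm1E.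
  by rewrite !mnmDE !mulmnE !mnm1E /= !mul0n !mul1n addn0 add0n mulr1.
case/eqP: P0; apply/polyP => j; apply/polyP => i; rewrite !coef0.
have [jP|jP] := ltnP j (size P); last by rewrite [P`_j]nth_default ?coef0.
have [iP|iP] := ltnP i (size P`_j); last by rewrite nth_default.
have <- : q@_(mm i j) = P`_j`_i; last by rewrite q0 mcoeff0.
rewrite /q raddf_sum (bigD1 (Ordinal jP)) //= raddf_sum (bigD1 (Ordinal iP)) //=.
rewrite mcoeffZ mcoeffX eqxx mulr1 !big1 ?addr0 //.
  move=> j' jj; rewrite raddf_sum big1 // => i' _; rewrite /= mcoeffZ mcoeffX mmi.
  by rewrite [(_ == j)](negPf jj) andbF mulr0.
move=> i' ii; rewrite mcoeffZ mcoeffX mmi.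
by rewrite [(_ == i)](negPf ii) mulr0.
Qed.

(** Each generator [y] is algebraic over [k(t)], since [t] and [y] cannot be independent; the
    generators are adjoined one at a time. *)
Theorem fg_trdeg1_finite t : fg_field_ext e -> trdeg_le e 1 -> transc t ->
  fin_dim (csf_ext (simple_ext t)).
Proof.
move=> [s hs] td tt; apply/fin_dimP.
have [E [FE sE [b hb]]] : exists E : central_subfield L,
    [/\ forall x, simple_ext t x -> E x, forall x, x \in s -> E x & finite_over (simple_ext t) E].
  elim: (s) => [|y l [E [FE lE fE]]].
    by exists (simple_ext t); split=> //; apply: finite_over_self.
  have ay : algebraic_over (simple_ext t) y.
    by apply: alg_rel_algebraic => //; apply: not_alg_indep_rel => /td.
  have [E' [EE' E'y fE']] := adjoin_algebraic FE fE (algebraic_overW FE ay).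
  exists E'; split=> // [x /FE/EE'//|x]; by rewrite inE => /orP[/eqP ->//|/lE/EE'].
exists b => x; apply: hb; apply: hs => //.
- by split; [exact: csf_mem1|exact: csf_memB|exact: csf_memM|exact: csf_mem_inv].
- by move=> c; apply/FE/simple_ext_base.
Qed.

Lemma fin_dim_algebraic t y : fin_dim (csf_ext (simple_ext t)) -> algebraic_over (simple_ext t) y.
Proof. by move=> /fin_dimP[b hb]; apply: (@finite_over_algebraic _ (fun=> True)) => //; exists b. Qed.

(** If [x] and [y] were independent, [x] would be transcendental and algebraic over [k(t)], so by
    exchange [t] would be algebraic over [k(x)]. Then [k(x, t, y)] would be finite over [k(x)],
    which relates [x] and [y]. *)
Theorem finite_trdeg1 t : fin_dim (csf_ext (simple_ext t)) -> trdeg_le e 1.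
Proof.
move=> fd [//|x [//|y s]] ind; exfalso.
have tx : transc x.
  move=> p px; apply: contrapT => p0.
  have rel : alg_rel x y.
    by exists p%:P; rewrite polyC_eq0; split; [apply/eqP|rewrite map_polyC hornerC].
  exact: (alg_rel_not_indep rel ind).
have at_ : algebraic_over (simple_ext x) t.
  by apply: alg_rel_algebraic => //; apply/alg_rel_sym/algebraic_alg_rel/fin_dim_algebraic.
have [E1 [FE1 E1t fE1]] := adjoin_algebraic (fun _ h => h) (finite_over_self _) at_.
have tE1 : forall z, simple_ext t z -> E1 z.
  by apply: simple_ext_sub => // c; apply/FE1/simple_ext_base.
have [E2 [E12 E2y fE2]] := adjoin_algebraic FE1 fE1 (algebraic_overW tE1 (fin_dim_algebraic y fd)).
apply: (alg_rel_not_indep _ ind); apply: algebraic_alg_rel.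
apply: (finite_over_algebraic fE2); elim=> [|i IH]; first exact: csf_mem1.
by rewrite exprS; apply: csf_memM.
Qed.

Theorem finite_fg t : fin_dim (csf_ext (simple_ext t)) -> fg_field_ext e.
Proof.
move=> /fin_dimP[b hb]; exists (t :: b : seq L) => P [P1 PB PM PV] Pe Ps x.
have P0 : P 0 by rewrite -(subrr 1); apply: PB.
have PD u v : P u -> P v -> P (u + v).
  by move=> Pu Pv; rewrite -[v]opprK; apply: (PB) => //; rewrite -sub0r; apply: PB.
apply: (@lspan_ind _ (csf_ext (simple_ext t)) P b) (hb x) => //.
  move=> c u v Pu Pv; apply: (PD) => //; apply: (PM) => //.
  have [p [q [_ ->]]] := csfP c.
  have h p' : P (reval t p').
    apply: subring_horner => //; last by apply: Ps; rewrite mem_head.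
    by move=> i; rewrite coef_map; apply: Pe.
  by apply: PM => //; apply: PV.
by move=> y yb; apply: Ps; rewrite inE yb orbT.
Qed.

End FunctionFields.

(** A root of [\prod (X - b) + 1] avoids every [b] of the list. The empty list is separate because
    this polynomial is then constant. *)
Lemma closed_field_infinite (k : closedFieldType) : infinite_field k.
Proof.
case=> [|a s]; first by exists 0.
have sz : size (\prod_(b <- a :: s) ('X - b%:P) + 1) = (size s).+2.
  by rewrite size_polyDl size_prod_XsubC // size_poly1.
have /closed_rootP[x] : size (\prod_(b <- a :: s) ('X - b%:P) + 1) != 1%N by rewrite sz.
rewrite rootE hornerD hornerC => hx; exists x; apply/negP => xs.
have /rootP e : root (\prod_(b <- a :: s) ('X - b%:P)) x by rewrite root_prod_XsubC.
by move: hx; rewrite e add0r oner_eq0.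
Qed.

(** * Ideals of finite codimension and primeness *)

Section TwoSidedIdeals.
Variables (k : fieldType) (A : algType k).
Implicit Type I : A -> Prop.

Lemma fin_codimP I : fin_codim I <-> exists s, forall a, exists y, @lspan k A s y /\ I (a - y).
Proof.
split=> -[s hs]; exists s => a.
  have [c hc] := hs a; exists (\sum_(i < size s) c i *: s`_i); split=> //.
  by apply/in_spanP; exists c.
by have [y [/in_spanP[c ->] hy]] := hs a; exists c.
Qed.

Lemma ideal_subspace I : two_sided_ideal I -> @lsubspace k A I.
Proof.
move=> [I0 IB Il Ir]; split=> // c u v Iu Iv.
rewrite -[v]opprK; apply: (IB); last by rewrite -sub0r; apply: IB.
by rewrite -[c *: u]mulr_algl; apply: Il.
Qed.

Lemma fin_codim_dependent (T : eqType) I (r : seq T) (f : T -> A) s :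
  two_sided_ideal I -> (forall a, exists y, @lspan k A s y /\ I (a - y)) ->
  uniq r -> (size s < size r)%N ->
  exists c : T -> k, I (\sum_(i <- r) c i *: f i) /\ exists2 i, i \in r & c i != 0.
Proof.
move=> iI hs ur lt; have sI := ideal_subspace iI.
have /choice[g hg] : forall i, exists y, @lspan k A s y /\ I (f i - y) by move=> i; apply: hs.
have [|c [hc hn]] := @not_lfree_coef _ _ _ g _ ur.
  move=> fr; have := lfree_exchange fr (t := s); rewrite size_map leqNgt lt => h.
  by suff: false by []; apply: h => _ /mapP[i _ ->]; have [] := hg i.
exists c; split=> //.
have -> : \sum_(i <- r) c i *: f i = \sum_(i <- r) c i *: f i - \sum_(i <- r) c i *: g i.
  by rewrite hc subr0.
rewrite -sumrB.
apply: (big_ind I); [exact: sI.1| |move=> i _].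
  by move=> x y Ix Iy; rewrite -[x]scale1r; apply: sI.2.
by rewrite -scalerBr -[_ *: _]addr0; apply: sI.2; [have [] := hg i|apply: sI.1].
Qed.

Lemma generated_ideal (n : A) :
  two_sided_ideal (fun y => exists l : seq (A * A), y = \sum_(m <- l) m.1 * n * m.2).
Proof.
split.
- by exists [::]; rewrite big_nil.
- move=> _ _ [l ->] [l' ->]; exists (l ++ [seq (- m.1, m.2) | m <- l']).
  rewrite big_cat big_map -sumrN; congr (_ + _).
  by apply: eq_bigr => m _; rewrite !mulNr.
- move=> a _ [l ->]; exists [seq (a * m.1, m.2) | m <- l].
  by rewrite big_map mulr_sumr; apply: eq_bigr => m _; rewrite !mulrA.
- move=> a _ [l ->]; exists [seq (m.1, m.2 * a) | m <- l].
  by rewrite big_map mulr_suml; apply: eq_bigr => m _; rewrite !mulrA.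
Qed.

Lemma generated_ideal_gen (n : A) : exists l : seq (A * A), n = \sum_(m <- l) m.1 * n * m.2.
Proof. by exists [:: (1, 1)]; rewrite big_seq1 mul1r mulr1. Qed.

(* If I J = 0 for nonzero ideals, any n <> 0 in their intersection generates a
   finite-dimensional ideal: writing A = I + S = J + T gives AnA = SnT. *)
Theorem just_infinite_prime : just_infinite A -> prime_ring A.
Proof.
move=> [nfd jA] p q hpq; apply: contrapT => /not_orP[p0 q0].
pose I y := forall x, y * x * q = 0.
pose J y := forall i, I i -> i * y = 0.
have iI : two_sided_ideal I.
  split=> [x|x y hx hy z|a x hx y|a x hx y].
  - by rewrite !mul0r.
  - by rewrite !mulrBl hx hy subrr.
  - by rewrite -!mulrA (mulrA x) hx mulr0.
  - by rewrite -(mulrA x) hx.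
have iJ : two_sided_ideal J.
  have [_ _ _ Ir] := iI.
  split=> [i _|x y hx hy i Ii|a x hx i Ii|a x hx i Ii].
  - by rewrite mulr0.
  - by rewrite mulrBr hx // hy // subrr.
  - by rewrite mulrA hx //; apply: Ir.
  - by rewrite mulrA hx // mul0r.
have /fin_codimP[s hs] : fin_codim I by apply: jA => //; exists p.
have /fin_codimP[t ht] : fin_codim J.
  by apply: jA => //; exists q; split=> // i /(_ 1); rewrite mulr1.
have sI := ideal_subspace iI; have sJ := ideal_subspace iJ.
have [n [In Jn n0]] : exists n, [/\ I n, J n & n <> 0].
  apply: contrapT => hn.
  have [||b [_ Ib Sb]] := @lbasis_max k A I [::] (size t) Logic.I; first by [].
    move=> u fu Iu; rewrite leqNgt; apply/negP => lt.
    have [c [hc [i iu ci]]] := @fin_codim_dependent _ J u id t iJ ht (lfree_uniq fu) lt.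
    rewrite -(map_id u) in fu; case/eqP: ci; apply: (lfree_coef fu _ iu).
    apply: contrapT => n0; apply: hn; exists (\sum_(j <- u) c j *: j); split=> //.
    apply: (lsubspace_span sI Iu); rewrite big_seq; apply: lspan_sum => j ju.
    exact/lspanZ/lspan_mem.
  rewrite cats0 in Ib Sb; apply: nfd; apply/fin_dimP; exists (s ++ b) => a.
  have [y [hy Iay]] := hs a; apply/lspan_cat; exists y, (a - y).
  by split; [|apply: Sb|rewrite addrC subrK].
pose T := [seq x * n * y | x <- s, y <- t].
have anb a b : @lspan k A T (a * n * b).
  have [x [hx Iax]] := hs a; have [y [hy Jby]] := ht b.
  have -> : a * n * b = x * n * y.
    have -> : a * n = x * n by apply/eqP; rewrite -subr_eq0 -mulrBl; apply/eqP/Jn.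
    apply/eqP; rewrite -subr_eq0 -mulrBr; apply/eqP/Jby.
    by have [_ _ Il _] := iI; apply: Il.
  move: hx; apply: (@lspan_ind k A (fun x => lspan T (x * n * y))).
  - by rewrite !mul0r; apply: lspan0.
  - by move=> c u v hu hv; rewrite !mulrDl -!scalerAl; apply: lspanD => //; apply: lspanZ.
  move=> x' x's; move: hy; apply: (@lspan_ind k A (fun y => lspan T (x' * n * y))).
  - by rewrite mulr0; apply: lspan0.
  - by move=> c u v hu hv; rewrite mulrDr -scalerAr; apply: lspanD => //; apply: lspanZ.
  by move=> y' y't; apply/lspan_mem/allpairsP; exists (x', y').
have /fin_codimP[r hr] := jA _ (generated_ideal n) (ex_intro _ n (conj (generated_ideal_gen n) n0)).
apply: nfd; apply/fin_dimP; exists (r ++ T) => a.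
have [y [hy [l hl]]] := hr a; apply/lspan_cat; exists y, (a - y).
by split; [|rewrite hl; apply: lspan_sum|rewrite addrC subrK].
Qed.

End TwoSidedIdeals.

(** * The center over a polynomial subring *)

Section Center.
Variables (k : fieldType) (A : algType k).

Lemma central0 : central (0 : A).
Proof. by move=> a; rewrite mul0r mulr0. Qed.

Lemma central1 : central (1 : A).
Proof. by move=> a; rewrite mul1r mulr1. Qed.

Lemma centralD (z w : A) : central z -> central w -> central (z + w).
Proof. by move=> hz hw a; rewrite mulrDl mulrDr hz hw. Qed.

Lemma centralN (z : A) : central z -> central (- z).
Proof. by move=> hz a; rewrite mulNr mulrN hz. Qed.

Lemma centralB (z w : A) : central z -> central w -> central (z - w).
Proof. by move=> hz hw; apply: centralD => //; apply: centralN. Qed.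

Lemma centralM (z w : A) : central z -> central w -> central (z * w).
Proof. by move=> hz hw a; rewrite -mulrA hw mulrA hz mulrA. Qed.

Lemma central_scalar (c : k) : central (c%:A : A).
Proof. by move=> a; rewrite mulr_algl mulr_algr. Qed.

Lemma central_sum (T : Type) (r : seq T) (f : T -> A) :
  (forall i, central (f i)) -> central (\sum_(i <- r) f i).
Proof. by move=> h; apply: big_ind => //; [exact: central0|exact: centralD]. Qed.

Lemma central_horner (t : A) p : central t -> central (horner_alg t p).
Proof.
move=> ct; elim/poly_ind: p => [|p c IH]; first by rewrite rmorph0; apply: central0.
rewrite rmorphD rmorphM /= horner_algX horner_algC.
by apply: centralD; [apply: centralM|apply: central_scalar].
Qed.

End Center.

Section CenterOverPolynomials.
Variables (k : closedFieldType) (A : algType k).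
Hypothesis jA : just_infinite A.
Let pA := just_infinite_prime jA.

Lemma central_reg (w a : A) : central w -> w <> 0 -> w * a = 0 -> a = 0.
Proof.
move=> cw w0 wa; have [x|//|//] := pA (p := w) (q := a).
by rewrite cw -mulrA wa mulr0.
Qed.

(** Polynomials over [k] split into linear factors, and each [t - c] is a nonzero central element of
    a prime algebra, hence not a zero divisor. *)
Lemma horner_alg_neq0 (t : A) p : central t -> (forall c : k, t <> c%:A) ->
  horner_alg t p = 0 -> p = 0.
Proof.
move=> ct nt; have [n] := ubnP (size p); elim: n p => // n IH p.
rewrite ltnS => sp hp; have [/size_poly1P[c c0 pE]|/closed_rootP[c /factor_theorem[q qE]]] :=
  boolP (size p == 1%N).
  move: hp; rewrite pE horner_algC => /eqP.
  by rewrite scaler_eq0 (negPf c0) (oner_eq0 A).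
have [q0|qn] := eqVneq q 0; first by rewrite qE q0 mul0r.
have q0 : q = 0; last by rewrite q0 eqxx in qn.
apply: IH; first by apply: leq_trans sp; rewrite qE size_Mmonic ?monicXsubC // size_XsubC addn2.
move: hp; rewrite qE mulrC rmorphM rmorphB /= horner_algX horner_algC; apply: central_reg.
  by apply: centralD => //; apply/centralN/central_scalar.
by move/eqP; rewrite subr_eq0 => /eqP/nt.
Qed.

Lemma ideal_contains_poly (I : A -> Prop) (t : A) : two_sided_ideal I ->
  (exists x, I x /\ x <> 0) -> exists p, p != 0 /\ I (horner_alg t p).
Proof.
move=> iI nI; have /fin_codimP[s hs] := jA.2 I iI nI.
have [||c [hc [i ir ci]]] := @fin_codim_dependent k A _ I (iota 0 (size s).+1) (fun i => t ^+ i) s iI hs.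
- exact: iota_uniq.
- by rewrite size_iota.
exists (\sum_(j <- iota 0 (size s).+1) c j *: 'X^j); split.
  apply/eqP => /polyP/(_ i); rewrite coef0 coef_sum (bigD1_seq i) ?iota_uniq //=.
  rewrite coefZ coefXn eqxx mulr1 big1 ?addr0; first by move/eqP; rewrite (negPf ci).
  by move=> j ji; rewrite coefZ coefXn eq_sym (negPf ji) mulr0.
rewrite raddf_sum (eq_bigr (fun j => c j *: t ^+ j)) // => j _ /=.
by rewrite linearZ /= rmorphXn /= horner_algX mulr_algl.
Qed.

(** If the center were [k], finite rank over the center would make [A] finite-dimensional. *)
Lemma nonscalar_central : is_PI A -> exists t : A, central t /\ forall c : k, t <> c%:A.
Proof.
move=> /PI_mlin hid; apply: contrapT => hno.
have sc (z : A) : central z -> exists c : k, z = c%:A.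
  move=> cz; apply: contrapT => hn; apply: hno; exists z; split=> // c zc.
  by apply: hn; exists c.
have [s hs] := finite_rank_over_center pA (@closed_field_infinite k) hid.
apply: jA.1; apply/fin_dimP; exists s => a.
have [w [c [w0 cw cc e]]] := hs a; have [d wd] := sc w cw.
have d0 : d != 0 by apply/eqP => d0; apply: w0; rewrite wd d0 scale0r.
have -> : a = d^-1 *: (w * a) by rewrite wd mulr_algl scalerK.
rewrite e; apply: lspanZ; apply: lspan_sum => i _.
have [b ->] := sc _ (cc i); rewrite mulr_algl.
by apply/lspanZ/lspan_mem/mem_nth.
Qed.

Section Rank.
Variables (L : fieldType) (e : {rmorphism k -> L}) (iota : A -> L) (t : A).
Hypothesis fr : is_frac_field_of_center iota.
Hypothesis iotaC : forall c : k, iota c%:A = e c.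
Hypothesis ct : central t.
Hypothesis nt : forall c : k, t <> c%:A.

Let iotaD z w : central z -> central w -> iota (z + w) = iota z + iota w.
Proof. by case: fr => h _ _ _ _; apply: h. Qed.
Let iotaM z w : central z -> central w -> iota (z * w) = iota z * iota w.
Proof. by case: fr => _ h _ _ _; apply: h. Qed.
Let iota1 : iota 1 = 1.
Proof. by case: fr. Qed.
Let iota_inj z w : central z -> central w -> iota z = iota w -> z = w.
Proof. by case: fr => _ _ _ h _; apply: h. Qed.
Let iota0 : iota 0 = 0.
Proof. by rewrite -(scale0r 1) iotaC rmorph0. Qed.

Lemma center_frac_horner p : iota (horner_alg t p) = reval e (iota t) p.
Proof.
elim/poly_ind: p => [|p c IH]; first by rewrite rmorph0 iota0 rmorph0.
rewrite !rmorphD !rmorphM /= horner_algX horner_algC iotaD ?iotaM ?iotaC ?IH ?revalX ?revalC //.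
- exact: central_horner.
- by apply: centralM => //; apply: central_horner.
- exact: central_scalar.
Qed.

Let iota_sum (T : Type) (r : seq T) (f : T -> A) : (forall i, central (f i)) ->
  iota (\sum_(i <- r) f i) = \sum_(i <- r) iota (f i).
Proof.
move=> h; elim: r => [|i r IH]; first by rewrite !big_nil.
by rewrite !big_cons iotaD ?IH //; apply: central_sum.
Qed.

Lemma transc_center : transc e (iota t).
Proof.
move=> p; rewrite -center_frac_horner -iota0 => /iota_inj h; apply: (horner_alg_neq0 ct nt).
by apply: h; [apply: central_horner|apply: central0].
Qed.

(** A maximal family of central elements independent over [k(t)], with denominators cleared. It is
    made to contain [1] so that Cramer's rule can later isolate the determinant itself. *)
Lemma center_basis : fg_field_ext e -> trdeg_le e 1 ->
  exists n (b : 'I_n.+1 -> A) (i0 : 'I_n.+1),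
    [/\ forall i, central (b i), b i0 = 1,
        forall p : 'I_n.+1 -> {poly k}, \sum_i horner_alg t (p i) * b i = 0 -> forall i, p i = 0
      & forall z, central z -> exists g (p : 'I_n.+1 -> {poly k}),
          g != 0 /\ horner_alg t g * z = \sum_i horner_alg t (p i) * b i].
Proof.
move=> fg td; have /fin_dimP[s hs] := fg_trdeg1_finite fg td transc_center.
pose F := simple_ext e (iota t).
pose P (x : csf_ext F) := exists z, central z /\ x = iota z.
have [|||l [fl Pl Sl]] := @lbasis_max (csf F) (csf_ext F) P [:: 1] (size s).
- by split=> //; apply/eqP; rewrite oner_eq0.
- by move=> x; rewrite inE => /eqP ->; exists 1; rewrite iota1; split=> //; apply: central1.
- by move=> u fu _; apply: (lfree_exchange fu).
set l1 := l ++ [:: 1] in fl Pl Sl.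
have sl : size l1 = (size l).+1 by rewrite size_cat addn1.
have /choice[h hh] : forall x : csf_ext F, exists z, x \in l1 -> central z /\ x = iota z.
  move=> x; have [xl|] := boolP (x \in l1); last by exists 0.
  by have [z hz] := Pl x xl; exists z.
pose b (i : 'I_(size l).+1) := h l1`_i.
have hb i : central (b i) /\ l1`_i = iota (b i) by apply: hh; rewrite mem_nth // sl.
(* The vector [1] was put at the end of the list, hence the index [ord_max]. *)
exists (size l), b, ord_max; split.
- by move=> i; have [] := hb i.
- apply: iota_inj; [by have [] := hb ord_max|exact: central1|].
  by rewrite iota1 -(hb ord_max).2 nth_cat /= ltnn subnn.
- move=> p hp i; apply: transc_center.
  have /choice[c hc] : forall j : nat, exists c : csf F, csf_val c =
      if insub j is Some i' then reval e (iota t) (p i') else 0.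
    move=> j; apply: csf_lift; case: insub => [i'|]; first exact: simple_ext_reval.
    exact: csf_mem0.
  have cE (j : 'I_(size l).+1) : csf_val (c j) = reval e (iota t) (p j) by rewrite hc valK.
  rewrite -cE; have /lfreeP/(_ c) := fl; rewrite sl => h0; rewrite h0 //.
  rewrite -[RHS]iota0 -hp iota_sum; last first.
    by move=> j; apply: centralM; [apply: central_horner|have [] := hb j].
  apply: eq_bigr => j _; rewrite csf_scaleE cE iotaM ?center_frac_horner -?(hb j).2 //.
    exact: central_horner.
  by have [] := hb j.
move=> z cz; have [c hc] := lspan_nth (Sl (iota z) (ex_intro _ z (conj cz erefl))).
have [|D [N [D0 hN]]] := @common_denominator _ _ e (iota t) (size l).+1 (fun j => csf_val (c j)).
  by move=> j _; apply: csfP.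
exists D, (fun i : 'I_(size l).+1 => N i); split; first by apply/eqP => e0; rewrite e0 rmorph0 eqxx in D0.
have cs (i : 'I_(size l).+1) : central (horner_alg t (N i) * b i).
  by apply: centralM; [apply: central_horner|have [] := hb i].
have cb i := (hb i).1.
apply: iota_inj.
- by apply: centralM => //; apply: central_horner.
- exact: central_sum.
rewrite iotaM ?iota_sum ?center_frac_horner //; last exact: central_horner.
rewrite hc sl mulr_sumr; apply: eq_bigr => i _.
by rewrite csf_scaleE mulrA hN // iotaM // ?(hb i).2 ?center_frac_horner //; apply: central_horner.
Qed.

Lemma center_common_denominator n (x : nat -> L) : exists w (z : nat -> A),
  [/\ central w, iota w != 0, forall i, central (z i) &
    forall i, (i < n)%N -> iota w * x i = iota (z i)].
Proof.
elim: n => [|n [w [z [cw w0 cz hz]]]].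
  exists 1, (fun=> 1); rewrite iota1 oner_neq0.
  by split=> [||_|//]; [exact: central1| |exact: central1].
have [y [v [cy cv v0 hx]]] : exists z w, [/\ central z, central w, iota w != 0 & x n = iota z / iota w].
  by case: fr => _ _ _ _; apply.
exists (w * v), (fun i => if i == n then w * y else v * z i); split.
- exact: centralM.
- by rewrite iotaM // mulf_neq0.
- by move=> i; case: ifP => _; apply: centralM.
move=> i; rewrite ltnS leq_eqVlt; case: (eqVneq i n) => [-> _|_ /= li].
  by rewrite !iotaM // hx -mulrA; congr (_ * _); rewrite mulrC divfK.
by rewrite !iotaM // mulrAC hz // mulrC.
Qed.

(** A common denominator turns [N] elements independent over [k(t)] into central elements of [A],
    for which the hypothesis provides a forbidden relation. *)
Lemma center_frac_fin_dim N :
  (forall z : nat -> A, (forall i, central (z i)) -> exists p : nat -> {poly k},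
    \sum_(i < N) horner_alg t (p i) * z i = 0 /\ exists2 i, (i < N)%N & p i != 0) ->
  fin_dim (csf_ext (simple_ext e (iota t))).
Proof.
move=> dep; apply: contrapT => /not_fin_dim_lfree/(_ N)[s [/lfreeP fs sN]].
have [w [z [cw w0 cz hz]]] := center_common_denominator N (fun i => s`_i).
have [p [hp [i li]]] := dep z cz; case/eqP; apply: transc_center.
have /choice[c hc] : forall j, exists c : csf (simple_ext e (iota t)), csf_val c = reval e (iota t) (p j).
  by move=> j; apply: csf_lift; apply: simple_ext_reval.
rewrite -hc (fs c) ?sN //; apply: (mulfI w0); rewrite mulr0 mulr_sumr.
transitivity (iota (\sum_(j < N) horner_alg t (p j) * z j)); last by rewrite hp.
rewrite iota_sum => [|j]; last by apply: centralM => //; apply: central_horner.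
apply: eq_bigr => j _; rewrite csf_scaleE hc mulrCA hz // iotaM // ?center_frac_horner //.
exact: central_horner.
Qed.

End Rank.

Definition tspan (t : A) (s : seq A) (y : A) :=
  exists l : seq ({poly k} * A), (forall m, m \in l -> m.2 \in s) /\
    y = \sum_(m <- l) horner_alg t m.1 * m.2.

Lemma tspanD t s y z : tspan t s y -> tspan t s z -> tspan t s (y + z).
Proof.
move=> [l [hl ->]] [l' [hl' ->]]; exists (l ++ l'); rewrite big_cat; split=> // m.
by rewrite mem_cat => /orP[/hl|/hl'].
Qed.

Lemma tspan0 t s : tspan t s 0.
Proof. by exists [::]; rewrite big_nil. Qed.

Lemma tspanM t s p y : tspan t s y -> tspan t s (horner_alg t p * y).
Proof.
move=> [l [hl ->]]; exists [seq (p * m.1, m.2) | m <- l]; split.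
  by move=> _ /mapP[m /hl ml ->].
by rewrite big_map mulr_sumr; apply: eq_bigr => m _; rewrite rmorphM mulrA.
Qed.

(** The central denominator [w] of [a] is traded for a polynomial: the ideal [w A] contains some
    nonzero [h(t) = w x], where [x] is central too. Then [h(t) a] is the sum of the [x c_i s_i], and
    each central [x c_i] is expanded in the [b i] up to a polynomial factor. *)
Lemma finite_rank_over_poly (t : A) n (b : 'I_n.+1 -> A) : is_PI A -> central t ->
  (forall z, central z -> exists g (p : 'I_n.+1 -> {poly k}),
     g != 0 /\ horner_alg t g * z = \sum_i horner_alg t (p i) * b i) ->
  exists s, forall a, exists g, g != 0 /\ tspan t s (horner_alg t g * a).
Proof.
move=> /PI_mlin hid ct hb.
have [s hs] := finite_rank_over_center pA (@closed_field_infinite k) hid.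
exists [seq b i * x | i <- enum 'I_n.+1, x <- s] => a.
have [w [c [w0 cw cc e]]] := hs a.
have [||h [h0 [x hx]]] := @ideal_contains_poly (fun y => exists x, y = w * x) t.
- split=> [|_ _ [x ->] [y ->]|u _ [x ->]|u _ [x ->]].
  + by exists 0; rewrite mulr0.
  + by exists (x - y); rewrite mulrBr.
  + by exists (u * x); rewrite mulrA -cw mulrA.
  + by exists (x * u); rewrite mulrA.
- by exists w; split=> //; exists 1; rewrite mulr1.
have cx : central x.
  move=> y; apply/eqP; rewrite -subr_eq0; apply/eqP; apply: (central_reg cw w0).
  rewrite mulrBr !mulrA -hx (central_horner h ct) cw -mulrA -hx subrr //.
have claim m : (m <= size s)%N -> exists g, g != 0 /\
    tspan t [seq b i * x | i <- enum 'I_n.+1, x <- s]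
      (horner_alg t g * \sum_(i < m) x * c i * s`_i).
  elim: m => [_|m IH lm]; first by exists 1; rewrite oner_eq0 big_ord0 mulr0; split=> //; apply: tspan0.
  have [g [g0 hg]] := IH (ltnW lm); have [g' [p [g'0 hg']]] := hb _ (centralM cx (cc m)).
  exists (g * g'); rewrite mulf_neq0 // big_ord_recr mulrDr; split=> //; apply: tspanD.
    by rewrite mulrC rmorphM -mulrA; apply: tspanM.
  rewrite rmorphM -mulrA; apply: tspanM; rewrite mulrA hg'.
  exists [seq (p i, b i * s`_m) | i <- enum 'I_n.+1]; split.
    move=> _ /mapP[i _ ->]; apply/allpairsP; exists (i, s`_m).
    by rewrite mem_enum mem_nth.
  by rewrite big_map big_enum mulr_suml; apply: eq_bigr => i _; rewrite mulrA.
have [g [g0 hg]] := claim _ (leqnn _); exists (g * h); rewrite mulf_neq0 //; split=> //.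
move: hg; congr tspan; rewrite rmorphM -mulrA; congr (_ * _).
rewrite /= hx cw -mulrA e mulr_sumr; apply: eq_bigr => i _; exact/esym/mulrA.
Qed.

End CenterOverPolynomials.

(** * Ideals of base changes *)

(* K as a k-vector space through e. *)
Definition rscal (k K : fieldType) (e : {rmorphism k -> K}) : Type := K.

Section RestrictScalars.
Variables (k K : fieldType) (e : {rmorphism k -> K}).
HB.instance Definition _ := GRing.Zmodule.copy (rscal e) K.

Definition rscal_scale (c : k) (x : rscal e) : rscal e := e c * (x : K).

Fact rscal_scaleA a b x : rscal_scale a (rscal_scale b x) = rscal_scale (a * b) x.
Proof. by rewrite /rscal_scale rmorphM mulrA. Qed.
Fact rscal_scale1 : left_id 1 rscal_scale.
Proof. by move=> x; rewrite /rscal_scale rmorph1 mul1r. Qed.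
Fact rscal_scaleDr : right_distributive rscal_scale +%R.
Proof. by move=> c x y; rewrite /rscal_scale mulrDr. Qed.
Fact rscal_scaleDl x : {morph rscal_scale^~ x : a b / a + b}.
Proof. by move=> a b; rewrite /rscal_scale rmorphD mulrDl. Qed.
HB.instance Definition _ := GRing.Zmodule_isLmodule.Build k (rscal e)
  rscal_scaleA rscal_scale1 rscal_scaleDr rscal_scaleDl.

End RestrictScalars.

(** * Common eigenvectors over an algebraically closed field *)

Section CommutingMatrices.
Variables (k : closedFieldType) (K : fieldType) (e : {rmorphism k -> K}) (n : nat).

(** By Cayley-Hamilton a product of factors [N - z], with [z] in [k], kills [w]; the last nonzero
    partial product is an eigenvector. The predicate [G] carries along what is already known of [w],
    which each factor preserves. *)
Lemma eigenvector_in (N : 'M[k]_n.+1) (G : 'rV[K]_n.+1 -> Prop) w :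
  (forall w a, G w -> G (w *m (map_mx e N - (e a)%:M))) -> G w -> w != 0 ->
  exists w' a, [/\ G w', w' != 0 & w' *m map_mx e N = e a *: w'].
Proof.
move=> hG Gw w0; have [rs] := closed_field_poly_normal (char_poly N).
rewrite (monicP (char_poly_monic N)) scale1r => hrs.
have : \prod_(z <- rs) (map_mx e N - (e z)%:M) = 0.
  have := congr1 (map_mx e) (Cayley_Hamilton N); rewrite hrs map_mx0 => <-.
  rewrite rmorph_prod rmorph_prod; apply: eq_bigr => z _.
  by rewrite rmorphB /= horner_mx_X horner_mx_C map_mxB map_scalar_mx.
move/(congr1 (mulmx w)); rewrite mulmx0.
elim: rs w Gw w0 {hrs} => [|z rs IH] w Gw w0.
  by rewrite big_nil mulmx1 => w00; rewrite w00 eqxx in w0.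
rewrite big_cons -[_ * _]/(_ *m _) mulmxA => h.
have [u0|un] := eqVneq (w *m (map_mx e N - (e z)%:M)) 0; last first.
  by apply: IH h => //; apply: hG.
exists w, z; split=> //; move/eqP: u0.
by rewrite mulmxBr subr_eq0 mul_mx_scalar => /eqP.
Qed.

(* A kernel vector could be chosen to be a common eigenvector of the commuting
   matrices N m; its eigenvalues lie in k, so the independence of the kap m
   forces all of them to vanish. *)
Lemma det_comb_neq0 (T : eqType) (r : seq T) (kap : T -> rscal e) (N : T -> 'M[k]_n.+1) m1 :
  lfree (map kap r) -> (forall m m', N m *m N m' = N m' *m N m) ->
  m1 \in r -> \det (N m1) != 0 ->
  \det (\sum_(m <- r) (kap m : K) *: map_mx e (N m)) != 0.
Proof.
move=> fk cN m1r dN; apply/negP => /det0P[v v0 hv].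
set Y := \sum_(m <- r) _ in hv.
have cY m a : Y *m (map_mx e (N m) - (e a)%:M) = (map_mx e (N m) - (e a)%:M) *m Y.
  rewrite mulmxBr mulmxBl mul_mx_scalar mul_scalar_mx; congr (_ - _).
  rewrite /Y mulmx_suml mulmx_sumr; apply: eq_bigr => m' _.
  by rewrite -scalemxAl -scalemxAr -!map_mxM cN.
pose G (r' : seq T) (w : 'rV[K]_n.+1) := w *m Y = 0 /\
  forall m, m \in r' -> exists a, w *m map_mx e (N m) = e a *: w.
have [w [w0 [wY wN]]] : exists w, w != 0 /\ G r w.
  elim: (r) => [|m r' [w [w0 Gw]]]; first by exists v.
  have [|w' [a [[w'Y w'N] w'0 wa]]] := @eigenvector_in (N m) (G r') w _ Gw w0.
    move=> u a [uY uN]; split; first by rewrite -mulmxA -cY mulmxA uY mul0mx.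
    move=> m' /uN[b hb]; exists b.
    have c2 : (map_mx e (N m) - (e a)%:M) *m map_mx e (N m') =
        map_mx e (N m') *m (map_mx e (N m) - (e a)%:M).
      by rewrite mulmxBl mulmxBr mul_mx_scalar mul_scalar_mx -!map_mxM cN.
    by rewrite -mulmxA c2 mulmxA hb -scalemxAl.
  exists w'; split=> //; split=> // m'; rewrite inE => /orP[/eqP ->|/w'N//].
  by exists a.
have /choice[a ha] : forall m, exists a, m \in r -> w *m map_mx e (N m) = e a *: w.
  move=> m; have [mr|] := boolP (m \in r); last by exists 0.
  by have [a ha] := wN m mr; exists a.
have a0 m : m \in r -> a m = 0.
  apply: (lfree_coef fk); apply/eqP.
  have : (\sum_(m <- r) e (a m) * (kap m : K)) *: w = 0.
    rewrite -[RHS]wY /Y mulmx_sumr scaler_suml; apply: eq_big_seq => m' m'r.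
    by rewrite -scalemxAr ha // scalerA mulrC.
  by move/eqP; rewrite scaler_eq0 (negPf w0) orbF.
move: (ha m1 m1r); rewrite a0 // rmorph0 scale0r => h.
case/negP: dN; rewrite -(fmorph_eq0 e) -det_map_mx; apply/det0P.
by exists w.
Qed.

End CommutingMatrices.

Lemma horner_alg_sum (F : fieldType) (R : algType F) (a : R) (p : {poly F}) :
  horner_alg a p = \sum_(j < size p) p`_j *: a ^+ j.
Proof.
rewrite -{1}[p]coefK poly_def raddf_sum; apply: eq_bigr => j _.
by rewrite /= linearZ /= rmorphXn /= horner_algX mulr_algl.
Qed.

Section BaseChange.
Variables (k K : fieldType) (e : {rmorphism k -> K}) (A : algType k) (B : algType K).
Variable phi : A -> B.
Hypothesis hphi : is_base_change e phi.

Lemma base_changeD x y : phi (x + y) = phi x + phi y.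
Proof. by case: hphi => -[h _ _ _] _; apply: h. Qed.
Lemma base_changeM x y : phi (x * y) = phi x * phi y.
Proof. by case: hphi => -[_ h _ _] _; apply: h. Qed.
Lemma base_change1 : phi 1 = 1.
Proof. by case: hphi => -[]. Qed.
Lemma base_changeZ c x : phi (c *: x) = e c *: phi x.
Proof. by case: hphi => -[_ _ _ h] _; apply: h. Qed.
Lemma base_change0 : phi 0 = 0.
Proof. by rewrite -(scale0r 1) base_changeZ rmorph0 scale0r. Qed.
Lemma base_changeB x y : phi (x - y) = phi x - phi y.
Proof. by rewrite base_changeD -scaleN1r base_changeZ rmorphN1 scaleN1r. Qed.
Lemma base_change_sum (T : Type) (r : seq T) (P : pred T) (f : T -> A) :
  phi (\sum_(i <- r | P i) f i) = \sum_(i <- r | P i) phi (f i).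
Proof. exact: (big_morph phi base_changeD base_change0). Qed.

Lemma base_change_span b : exists s : seq A, lspan (map phi s) b.
Proof. by case: hphi => _ [h _]; have [s /in_spanP] := h b; exists s. Qed.

Lemma base_change_free s : @lfree k A s -> lfree (map phi s).
Proof. by case: hphi => _ [_ h] fs; apply/lin_indepP/h/lin_indepP. Qed.

Lemma base_change_not_fin_dim : ~ fin_dim A -> ~ fin_dim B.
Proof.
move=> nA /fin_dimP[s hs]; have [t [ft st]] := not_fin_dim_lfree nA (size s).+1.
have := lfree_exchange (base_change_free ft) (fun x _ => hs x).
by rewrite size_map st ltnn.
Qed.

Lemma base_change_lspan s a : @lspan k A s a -> lspan (map phi s) (phi a).
Proof.
apply: (@lspan_ind k A (fun a => lspan (map phi s) (phi a))).
- by rewrite base_change0; apply: lspan0.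
- by move=> c u v hu hv; rewrite base_changeD base_changeZ; apply: lspanD => //; apply: lspanZ.
- by move=> x xs; apply/lspan_mem/map_f.
Qed.

Lemma base_change_horner t p : phi (horner_alg t p) = horner_alg (phi t) (map_poly e p).
Proof.
elim/poly_ind: p => [|p c IH]; first by rewrite map_poly0 !rmorph0 base_change0.
rewrite !rmorphD !rmorphM /= map_polyX map_polyC !horner_algX !horner_algC.
by rewrite base_changeD base_changeM IH base_changeZ base_change1.
Qed.

Lemma base_change_ind (P : B -> Prop) :
  P 0 -> (forall c u v, P u -> P v -> P (c *: u + v)) -> (forall a, P (phi a)) -> forall b, P b.
Proof.
move=> P0 PD Pphi b; have [s] := base_change_span b.
by apply: lspan_ind => // _ /mapP[a _ ->].
Qed.

Definition quot_fin_dim (f : B) := exists s, forall b, exists y b', lspan s y /\ b = y + f * b'.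

(** From [B = S + f B] and [B = T + g B] follows [B = S + f T + f g B]. *)
Lemma quot_fin_dimM f g : quot_fin_dim f -> quot_fin_dim g -> quot_fin_dim (f * g).
Proof.
move=> [s hs] [t ht]; exists (s ++ [seq f * x | x <- t]) => b.
have [y [b1 [hy ->]]] := hs b; have [z [b2 [hz ->]]] := ht b1.
exists (y + f * z), b2; split; last by rewrite mulrDr addrA mulrA.
apply/lspan_cat; exists y, (f * z); split=> //.
by apply: lspan_map hz; apply: mull_linear.
Qed.

Lemma quot_fin_dim_phi f (s : seq B) :
  (forall a, exists y b', lspan s y /\ phi a = y + f * b') -> quot_fin_dim f.
Proof.
move=> h; exists s; apply: base_change_ind => //.
- by exists 0, 0; rewrite mulr0 addr0; split=> //; apply: lspan0.
- move=> c u v [y [b [hy ->]]] [y' [b' [hy' ->]]].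
  exists (c *: y + y'), (c *: b + b'); split; first by apply: lspanD => //; apply: lspanZ.
  by rewrite scalerDr mulrDr scalerAr addrACA.
Qed.

End BaseChange.

Section BaseChangeIdeals.
Variables (k : closedFieldType) (K : fieldType) (e : {rmorphism k -> K}).
Variables (A : algType k) (B : algType K) (phi : A -> B).
Hypothesis hphi : is_base_change e phi.
Hypothesis jA : just_infinite A.
Variable t : A.
Hypothesis ct : central t.
Hypothesis nt : forall c : k, t <> c%:A.

Local Notation ev := (horner_alg (phi t)).
Local Notation "p ^e" := (map_poly e p) (at level 2, format "p ^e").

Lemma quot_fin_dim_linear c : quot_fin_dim (ev ('X - (e c)%:P)).
Proof.
have nz : exists x, (exists a : A, x = (t - c%:A) * a) /\ x <> 0.
  exists (t - c%:A); split; first by exists 1; rewrite mulr1.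
  by move/eqP; rewrite subr_eq0 => /eqP/nt.
have ctc : central (t - c%:A) by apply: centralD => //; apply/centralN/central_scalar.
have [|s hs] := (fin_codimP _).1 (jA.2 _ _ nz).
  split=> [|_ _ [x ->] [y ->]|u _ [x ->]|u _ [x ->]].
  - by exists 0; rewrite mulr0.
  - by exists (x - y); rewrite mulrBr.
  - by exists (u * x); rewrite mulrA -ctc mulrA.
  - by exists (x * u); rewrite mulrA.
apply: (quot_fin_dim_phi hphi (s := map phi s)) => a.
have [y [hy [x hx]]] := hs a; exists (phi y), (phi x); split.
  exact: (base_change_lspan hphi).
have -> : 'X - (e c)%:P = map_poly e ('X - c%:P) by rewrite rmorphB /= map_polyX map_polyC.
rewrite -(base_change_horner hphi).
rewrite rmorphB /= horner_algX horner_algC -(base_changeM hphi) -hx -(base_changeD hphi).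
by rewrite addrC subrK.
Qed.

Lemma coprime_split_poly (f : {poly K}) (g : {poly k}) :
  (forall c, ~~ root f (e c)) -> g != 0 -> coprimep g^e f.
Proof.
move=> nr g0; have [rs ->] := closed_field_poly_normal g.
rewrite map_polyZ coprimepZl ?fmorph_eq0 ?lead_coef_eq0 //.
rewrite rmorph_prod; elim: rs => [|z rs IH]; first by rewrite big_nil coprime1p.
rewrite big_cons coprimepMl IH andbT rmorphB /= map_polyX map_polyC coprimep_sym.
by rewrite coprimep_XsubC; apply: nr.
Qed.

Hypothesis rank : exists s, forall a, exists g : {poly k}, g != 0 /\ tspan t s (horner_alg t g * a).

(** If [g(t) a] lies in the [k[t]]-span of [s], a Bezout relation [u g + v f = 1] puts [phi a] into
    the [K[t]]-span of [s] modulo [f], where coefficients can be reduced to remainders of division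
    by [f]. *)
Lemma quot_fin_dim_noroot (f : {poly K}) : f != 0 -> (forall c, ~~ root f (e c)) ->
  quot_fin_dim (ev f).
Proof.
move=> f0 nr; have [s hs] := rank.
pose T := [seq phi t ^+ j * phi x | j <- iota 0 (size f), x <- s].
pose P (b : B) := exists y b', lspan T y /\ b = y + ev f * b'.
have PD u v : P u -> P v -> P (u + v).
  move=> [y [b [hy ->]]] [y' [b' [hy' ->]]]; exists (y + y'), (b + b'); split.
    exact: lspanD.
  by rewrite mulrDr addrACA.
have Pf b : P (ev f * b) by exists 0, b; rewrite add0r; split=> //; apply: lspan0.
have Pm h x : x \in s -> P (ev h * phi x).
  move=> xs; exists (ev (h %% f) * phi x), (ev (h %/ f) * phi x); split; last first.
    by rewrite {1}(divp_eq h f) addrC mulrC rmorphD rmorphM mulrDl mulrA addrC.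
  have sz : (size (h %% f)%R <= size f)%N by rewrite ltnW // ltn_modp.
  rewrite horner_alg_sum mulr_suml; apply: lspan_sum => j _; rewrite -scalerAl.
  apply/lspanZ/lspan_mem/allpairsP; exists (nat_of_ord j, x).
  by rewrite mem_iota /= add0n (leq_trans (ltn_ord j) sz).
apply: (quot_fin_dim_phi hphi (s := T)) => a; rewrite -/(P _).
have [g [g0 [l [hl e1]]]] := hs a.
have /Bezout_eq1_coprimepP[[u v] /= uv] := coprime_split_poly nr g0.
have -> : phi a = ev u * phi (horner_alg t g * a) + ev f * (ev v * phi a).
  rewrite (base_changeM hphi) (base_change_horner hphi) !mulrA -!rmorphM -mulrDl -rmorphD.
  by rewrite [f * v]mulrC uv rmorph1 mul1r.
apply: (PD); last exact: Pf.
rewrite e1 (base_change_sum hphi) mulr_sumr big_seq; apply: (big_ind P) => //.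
  by exists 0, 0; rewrite mulr0 addr0; split=> //; apply: lspan0.
move=> m ml; rewrite (base_changeM hphi) (base_change_horner hphi) mulrA -rmorphM.
by apply: Pm; apply: hl.
Qed.

Lemma quot_fin_dim_poly (f : {poly K}) : f != 0 -> quot_fin_dim (ev f).
Proof.
have [n] := ubnP (size f); elim: n f => // n IH f; rewrite ltnS => sf f0.
have [[c /factor_theorem[q qE]]|hn] := pselect (exists c, root f (e c)); last first.
  by apply: quot_fin_dim_noroot => // c; apply/negP => rc; apply: hn; exists c.
have q0 : q != 0 by apply: contra f0 => /eqP q0; rewrite qE q0 mul0r.
rewrite qE rmorphM; apply: quot_fin_dimM; last exact: quot_fin_dim_linear.
by apply: IH => //; apply: leq_trans sf; rewrite qE size_Mmonic ?monicXsubC // size_XsubC addn2.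
Qed.

Hypothesis meets : forall I : A -> Prop, two_sided_ideal I -> (exists x, I x /\ x <> 0) ->
  exists z, [/\ I z, z <> 0 & central z].

Let comb (l : seq (K * A)) : B := \sum_(m <- l) m.1 *: phi m.2.

(** The scalars of any expansion are rewritten in a [k]-basis of their span, and the elements of [A]
    are collected accordingly. *)
Lemma independent_expansion (b : B) : b <> 0 ->
  exists l : seq (K * A), [/\ @lfree k (rscal e) (map fst l),
    exists2 m, m \in l & m.2 <> 0 & b = comb l].
Proof.
move=> b0; have [s /lspan_nth[c]] := base_change_span hphi b; rewrite size_map => bE.
have [r [fr _ hr]] := @lbasis_extract k (rscal e) [seq (c i : rscal e) | i <- iota 0 (size s)].
have ur := lfree_uniq fr.
have /choice[d hd] : forall i, exists d : rscal e -> k,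
    (i < size s)%N -> (c i : rscal e) = \sum_(x <- r) d x *: x.
  move=> i; have [li|] := boolP (i < size s)%N; last by exists (fun=> 0).
  have [|d hd] := @lspan_coef k (rscal e) (rscal e) id r (c i) ur.
    by rewrite map_id; apply: hr; apply: (map_f (fun i => c i)); rewrite mem_iota.
  by exists d.
pose l := [seq (x : K, \sum_(i < size s) d i x *: s`_i) | x <- r].
have bl : b = comb l.
  rewrite bE /comb big_map /=; under [RHS]eq_bigr do rewrite (base_change_sum hphi) scaler_sumr.
  rewrite exchange_big /=; apply: eq_bigr => i _.
  rewrite (nth_map 0) // (hd i (ltn_ord i)) scaler_suml; apply: eq_bigr => x _.
  by rewrite (base_changeZ hphi) scalerA mulrC.
exists l; split=> //.
  by rewrite -map_comp (eq_map (g := id)) ?map_id.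
apply: contrapT => hn; apply: b0; rewrite bl /comb big_seq big1 // => m ml.
have -> : m.2 = 0 by apply: contrapT => m0; apply: hn; exists m.
by rewrite (base_change0 hphi) scaler0.
Qed.

(* Take an expansion in J of minimal length; after normalizing its first
   coefficient to be central, commutators with A shorten it. *)
Lemma central_expansion (J : B -> Prop) (l : seq (K * A)) : two_sided_ideal J ->
  @lfree k (rscal e) (map fst l) -> (exists2 m, m \in l & m.2 <> 0) -> J (comb l) ->
  exists l' : seq (K * A), [/\ @lfree k (rscal e) (map fst l'),
    exists2 m, m \in l' & m.2 <> 0, forall m, m \in l' -> central m.2 & J (comb l')].
Proof.
move=> [J0 JB Jl Jr]; have [n] := ubnP (size l).
elim: n l => // n IH [|[x a] l] /=; first by move=> _ _ [].
rewrite ltnS => sl [nx fl] nz; have [a0|/eqP a0] := eqVneq a 0.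
  rewrite /comb big_cons a0 (base_change0 hphi) scaler0 add0r => Jc; apply: (IH l) => //.
  case: nz => m; rewrite inE => /orP[/eqP -> /(_ a0)//|ml m0]; by exists m.
move=> Jc.
have [z [[u zE] z0 cz]] := meets (generated_ideal a) (ex_intro _ a (conj (generated_ideal_gen a) a0)).
(* The operation that turns [a] into the central [z] is applied to all coefficients at once. It
   comes from multiplications by elements of [A], so the result stays in [J] with the same
   scalars. *)
pose tr b := \sum_(m <- u) m.1 * b * m.2.
have trE l1 : comb [seq (m.1, tr m.2) | m <- l1] = \sum_(m <- u) phi m.1 * comb l1 * phi m.2.
  rewrite /comb big_map; under [RHS]eq_bigr do rewrite mulr_sumr mulr_suml.
  rewrite exchange_big /=; apply: eq_bigr => m _.
  rewrite /tr (base_change_sum hphi) scaler_sumr; apply: eq_bigr => v _.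
  by rewrite !(base_changeM hphi) -scalerAr -scalerAl.
have Jtr : J (comb [seq (m.1, tr m.2) | m <- (x, a) :: l]).
  rewrite trE; apply: (big_ind J) => //.
    by move=> b c Jb Jc'; rewrite -[c]opprK; apply: (JB) => //; rewrite -sub0r; apply: JB.
  by move=> m _; apply/Jr/Jl.
set l1 := [seq (m.1, tr m.2) | m <- l].
have fl1 : map fst l1 = map fst l by rewrite -map_comp.
have [hc|] := pselect (forall m, m \in l1 -> central m.2).
  exists ((x, z) :: l1); split.
  - by rewrite /= fl1.
  - by exists (x, z); rewrite ?mem_head.
  - by move=> m; rewrite inE => /orP[/eqP ->//|/hc].
  - by rewrite zE.
(* A coefficient not commuting with [y] survives the commutator with [y], while the central [z]
   disappears. *)
move=> /existsNP[m /not_implyP[ml1 /existsNP[y hy]]].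
pose co b := y * b - b * y.
apply: (IH [seq (m.1, co m.2) | m <- l1]).
- by rewrite !size_map.
- by rewrite -map_comp (eq_map (g := fst)) // fl1.
- exists (m.1, co m.2); first exact: (map_f (fun m : K * A => (m.1, co m.2))).
  by rewrite /co /= => /eqP; rewrite subr_eq0 => /eqP h; apply: hy.
have coE l2 : comb [seq (m.1, co m.2) | m <- l2] = phi y * comb l2 - comb l2 * phi y.
  rewrite /comb big_map mulr_sumr mulr_suml -sumrB; apply: eq_bigr => v _.
  by rewrite /co (base_changeB hphi) !(base_changeM hphi) scalerBr scalerAr scalerAl.
have := coE ((x, z) :: l1); rewrite /= {1}/comb big_cons /=.
have -> : co z = 0 by rewrite /co cz subrr.
rewrite (base_change0 hphi) scaler0 add0r -/(comb _) => ->.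
have Jz : J (comb ((x, z) :: l1)) by rewrite zE.
by apply: JB; [apply: Jl|apply: Jr].
Qed.

End BaseChangeIdeals.

(** * Polynomials in ideals of the base change *)

Section BaseChangeJustInfinite.
Variables (k : closedFieldType) (K : fieldType) (e : {rmorphism k -> K}).
Variables (A : algType k) (B : algType K) (phi : A -> B).
Hypothesis hphi : is_base_change e phi.
Hypothesis jA : just_infinite A.
Variables (t : A) (n : nat) (b : 'I_n.+1 -> A) (i0 : 'I_n.+1).
Hypothesis ct : central t.
Hypothesis cb : forall i, central (b i).
Hypothesis b1 : b i0 = 1.
Hypothesis bfree : forall p : 'I_n.+1 -> {poly k},
  \sum_i horner_alg t (p i) * b i = 0 -> forall i, p i = 0.
Hypothesis bspan : forall z, central z -> exists g (p : 'I_n.+1 -> {poly k}),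
  g != 0 /\ horner_alg t g * z = \sum_i horner_alg t (p i) * b i.

Local Notation pe := (horner_alg t).
Local Notation ev := (horner_alg (phi t)).

Let pe_inj p : pe p = 0 -> p = 0.
Proof.
move=> h; have := @bfree (fun i => if i == i0 then p else 0) _ i0.
rewrite eqxx; apply; rewrite (bigD1 i0) //= eqxx h mul0r add0r big1 // => i /negPf ->.
by rewrite rmorph0 mul0r.
Qed.

Lemma common_multiplier (zs : seq A) : (forall z, z \in zs -> central z) ->
  exists g, g != 0 /\ forall z, z \in zs -> exists p : 'I_n.+1 -> {poly k},
    pe g * z = \sum_i pe (p i) * b i.
Proof.
elim: zs => [|z zs IH] hz; first by exists 1; rewrite oner_eq0.
have [|g [g0 hg]] := IH; first by move=> y ys; apply: hz; rewrite inE ys orbT.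
have [g' [p' [g'0 hp']]] := bspan (hz z (mem_head _ _)).
have mulp h y : (exists p : 'I_n.+1 -> {poly k}, y = \sum_i pe (p i) * b i) ->
    exists p : 'I_n.+1 -> {poly k}, pe h * y = \sum_i pe (p i) * b i.
  move=> [p ->]; exists (fun i => h * p i).
  by rewrite mulr_sumr; apply: eq_bigr => i _; rewrite rmorphM mulrA.
exists (g * g'); rewrite mulf_neq0 //; split=> // y; rewrite inE => /orP[/eqP ->|/hg hy].
  by rewrite rmorphM -mulrA; apply: mulp; exists p'.
by rewrite mulrC rmorphM -mulrA; apply: mulp.
Qed.

Lemma mult_matrix_unique (P Q : 'I_n.+1 -> {poly k}) :
  \sum_i pe (P i) * b i = \sum_i pe (Q i) * b i -> forall i, P i = Q i.
Proof.
move=> h i; apply/eqP; rewrite -subr_eq0; apply/eqP.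
apply: (bfree (p := fun i => P i - Q i)).
rewrite -[RHS](subrr (\sum_i pe (P i) * b i)) {2}h -sumrB; apply: eq_bigr => j _.
by rewrite rmorphB mulrBl.
Qed.

(* A nonzero element of J of the form \sum_m m.1 *: phi m.2 with central m.2,
   multiplied by a denominator, acts on the K[t]-span of the phi (b i) by a
   matrix X; Cramer's rule puts \det X into J. *)
Lemma ideal_contains_ev (J : B -> Prop) : (forall I : A -> Prop, two_sided_ideal I ->
    (exists x, I x /\ x <> 0) -> exists z, [/\ I z, z <> 0 & central z]) ->
  two_sided_ideal J -> (exists x, J x /\ x <> 0) -> exists f, f != 0 /\ J (ev f).
Proof.
move=> meets iJ [x [Jx x0]]; have [J0 JB Jl Jr] := iJ.
have JS (T : Type) (r : seq T) (f : T -> B) : (forall i, J (f i)) -> J (\sum_(i <- r) f i).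
  move=> h; apply: (big_ind J) => //.
  by move=> u v Ju Jv; rewrite -[v]opprK; apply: (JB) => //; rewrite -sub0r; apply: JB.
have [l0 [fl0 nz0 xE]] := independent_expansion hphi x0; rewrite xE in Jx.
have [l [fl [m1 m1l m10] cl Jc]] := central_expansion hphi meets iJ fl0 nz0 Jx.
have [|g [g0 hg]] := @common_multiplier [seq m.2 * b j | m <- l, j <- enum 'I_n.+1].
  by move=> _ /allpairsP[[m j] /= [ml _ ->]]; apply: centralM => //; apply: cl.
(* [M m] is the matrix of multiplication by [pe g * m.2] on the [b i]. The value 0 outside [l] makes
   all these matrices commute, as [det_comb_neq0] requires. *)
have /choice[M hM] : forall m : K * A, exists N : 'M[{poly k}]_n.+1,
    (m \in l -> forall j, pe g * (m.2 * b j) = \sum_i pe (N j i) * b i) /\ (m \notin l -> N = 0).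
  move=> m; have [ml|] := boolP (m \in l); last by exists 0.
  have /choice[p hp] : forall j, exists p : 'I_n.+1 -> {poly k}, pe g * (m.2 * b j) = \sum_i pe (p i) * b i.
    by move=> j; apply: hg; apply/allpairsP; exists (m, j); rewrite mem_enum.
  exists (\matrix_(j, i) p j i); split=> // _ j; rewrite hp.
  by apply: eq_bigr => i _; rewrite mxE.
have Mcomb m (v : 'I_n.+1 -> {poly k}) : m \in l ->
    pe g * (m.2 * \sum_j pe (v j) * b j) = \sum_i pe (\sum_j v j * M m j i) * b i.
  move=> ml; transitivity (\sum_j pe (v j) * (pe g * (m.2 * b j))).
    rewrite !mulr_sumr; apply: eq_bigr => j _; have cv := central_horner (v j) ct.
    by rewrite (mulrA (pe g)) mulrA -(cv (pe g * m.2)) !mulrA.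
  rewrite (eq_bigr (fun j => \sum_i pe (v j * M m j i) * b i)) => [|j _]; last first.
    rewrite (hM m).1 // mulr_sumr; apply: eq_bigr => i _.
    by rewrite rmorphM mulrA.
  rewrite exchange_big /=; apply: eq_bigr => i _.
  by rewrite raddf_sum mulr_suml.
have cM m m' : M m *m M m' = M m' *m M m.
  have [ml|ml] := boolP (m \in l); last by rewrite (hM m).2 // mul0mx mulmx0.
  have [ml'|ml'] := boolP (m' \in l); last by rewrite (hM m').2 // mul0mx mulmx0.
  apply/matrixP => j i; rewrite !mxE; move: i; apply: mult_matrix_unique.
  rewrite -!Mcomb // -!(hM _).1 // !mulrA.
  have cg := central_horner g ct.
  rewrite -!(mulrA (pe g)) -!(cg m.2) -!(cg m'.2) !mulrA; congr (_ * _); rewrite -!mulrA.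
  by rewrite (cl m ml m'.2).
(* A kernel vector would give a combination of the [b j] annihilated by the regular element
   [pe g * m1.2], against [bfree]. *)
have detM : \det (M m1) != 0.
  apply/negP => /det0P[v v0 hv]; have := Mcomb m1 (v 0) m1l.
  rewrite [RHS]big1 => [|i _]; last first.
    by have /rowP/(_ i) := hv; rewrite !mxE => ->; rewrite rmorph0 mul0r.
  move/(central_reg jA (central_horner g ct)) => h1.
  have /h1/(central_reg jA (cl _ m1l) m10)/bfree h2 : pe g <> 0.
    by move/pe_inj => g00; rewrite g00 eqxx in g0.
  by case/eqP: v0; apply/rowP => i; rewrite mxE h2.
(* At the point [c] of [k] the matrix [M m1] stays invertible, and [X] specializes to a combination
   of matrices over [k] with independent scalars. *)
have [c _ hc] := infinite_nonroot (@closed_field_infinite k) detM.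
pose X : 'M[{poly K}]_n.+1 := \sum_(m <- l) m.1%:P *: map_mx (map_poly e) (M m).
exists (\det X); split.
  have : (\det X).[e c] != 0.
    rewrite -horner_evalE -det_map_mx.
    have -> : map_mx (horner_eval (e c)) X =
        \sum_(m <- l) (m.1 : K) *: map_mx e (map_mx (horner_eval c) (M m)).
      rewrite /X raddf_sum; apply: eq_bigr => m _; apply/matrixP => i j.
      by rewrite !mxE /= !horner_evalE hornerM hornerC horner_map.
    apply: (@det_comb_neq0 k K e n _ l (fun m : K * A => m.1) (fun m => map_mx (horner_eval c) (M m)) m1) => //.
    - by move=> m m'; rewrite -!map_mxM cM.
    - by rewrite det_map_mx; move: hc; rewrite rootE.
  by apply: contra => /eqP ->; rewrite horner0.
pose y j := phi (pe g) * (\sum_(m <- l) m.1 *: phi m.2) * phi (b j).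
have Jy j : J (y j) by apply/Jr/Jl.
have yE j : y j = \sum_i ev (X j i) * phi (b i).
  rewrite /y mulr_sumr mulr_suml.
  rewrite (eq_big_seq (fun m => m.1 *: \sum_i ev (map_poly e (M m j i)) * phi (b i))) => [|m ml]; last first.
    rewrite -scalerAr -scalerAl -!(base_changeM hphi) -mulrA (hM m).1 //.
    rewrite (base_change_sum hphi); congr (_ *: _); apply: eq_bigr => i _.
    by rewrite (base_changeM hphi) (base_change_horner hphi).
  under eq_bigr do rewrite scaler_sumr.
  rewrite exchange_big /=; apply: eq_bigr => i _.
  rewrite /X summxE raddf_sum mulr_suml; apply: eq_bigr => m _.
  by rewrite !mxE /= rmorphM /= horner_algC mulr_algl scalerAl.
(* Row [i0] of [\adj X *m X] applied to the [b i] leaves [\det X] times [b i0], which is 1. *)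
have -> : ev (\det X) = \sum_j ev ((\adj X) i0 j) * y j.
  under eq_bigr do rewrite yE mulr_sumr.
  rewrite exchange_big /= (eq_bigr (fun i => ev ((\adj X *m X) i0 i) * phi (b i))) => [|i _]; last first.
    rewrite mxE raddf_sum mulr_suml; apply: eq_bigr => j _.
    by rewrite /= rmorphM mulrA.
  rewrite mul_adj_mx (bigD1 i0) //= mxE eqxx mulr1n b1 (base_change1 hphi) mulr1 big1 ?addr0 //.
  by move=> i ni; rewrite mxE eq_sym (negPf ni) mulr0n rmorph0 mul0r.
by apply: JS => j; apply: Jl.
Qed.

Hypothesis nt : forall c : k, t <> c%:A.
Hypothesis rank : exists s, forall a, exists g : {poly k}, g != 0 /\ tspan t s (horner_alg t g * a).

Theorem base_change_just_infinite : (forall I : A -> Prop, two_sided_ideal I ->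
    (exists x, I x /\ x <> 0) -> exists z, [/\ I z, z <> 0 & central z]) -> just_infinite B.
Proof.
move=> meets; split; first by apply: (base_change_not_fin_dim hphi); case: jA.
move=> J iJ nJ; have [f [f0 Jf]] := ideal_contains_ev meets iJ nJ.
have [s hs] := quot_fin_dim_poly hphi jA ct nt rank f0.
apply/fin_codimP; exists s => x; have [y [b' [hy ->]]] := hs x; exists y; split=> //.
by rewrite addrAC subrr add0r; have [_ _ _ Jr] := iJ; apply: Jr.
Qed.

End BaseChangeJustInfinite.

(** * Central localization *)

Record denominators (R : nzRingType) (F : ideal_filter R) := Denominators {
  dnm :> R -> Prop;
  dnm1 : dnm 1;
  dnmB : forall x y, dnm x -> dnm y -> dnm (x - y);
  dnmM : forall x y, dnm x -> dnm y -> dnm (x * y);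
  dnm_comm : forall w, dnm w -> forall x, w * x = x * w;
  dnm_reg : forall w x, dnm w -> w <> 0 -> x * w = 0 -> x = 0;
  dnm_flt : forall w, dnm w -> w <> 0 -> F (fun x => exists y, x = w * y)
}.

Section Fractions.
Variables (R : nzRingType) (F : ideal_filter R) (Z : denominators F).
Local Notation Q := (germ F).
Local Notation iota := (germ_emb F).

Lemma dnm_central w : Z w -> forall q : Q, iota w * q = q * iota w.
Proof. by move=> Zw; apply: germ_central => a; rewrite -!germ_embM (dnm_comm Zw). Qed.

Lemma dnm_neq0M v w : Z v -> Z w -> v <> 0 -> w <> 0 -> v * w <> 0.
Proof. by move=> Zv Zw v0 w0 /(dnm_reg Zw w0). Qed.

(** Division by [w] is a right module map on the ideal [w R], which belongs to the filter; its germ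
    inverts [w]. *)
Lemma dnm_inv w : Z w -> w <> 0 -> exists d : Q, d * iota w = 1.
Proof.
move=> Zw w0; pose I x := exists y, x = w * y.
have /choice[f hf] : forall x, exists y, I x -> x = w * y.
  by move=> x; have [[y ->]|n] := pselect (I x); [exists y|exists 0].
have winj x y : w * x = w * y -> x = y.
  move=> h; apply/eqP; rewrite -subr_eq0; apply/eqP; apply: (dnm_reg Zw w0).
  by rewrite mulrBl -!(dnm_comm Zw) h subrr.
have [|q hq] := germ_of_map (dnm_flt Zw w0) (f := f).
  split=> [x y Ix Iy|x a Ix]; apply: winj.
    rewrite mulrBr -!hf //.
    by case: Ix => x' ->; case: Iy => y' ->; exists (x' - y'); rewrite mulrBr.
  rewrite mulrA -!hf //.
  by case: Ix => x' ->; exists (x' * a); rewrite mulrA.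
have Iw : I w by exists 1; rewrite mulr1.
exists q; rewrite hq // -(germ_emb1 F); congr germ_emb; apply: winj.
by rewrite -hf // mulr1.
Qed.

Lemma dnm_germ_reg w (q : Q) : Z w -> w <> 0 -> q * iota w = 0 -> q = 0.
Proof.
move=> Zw w0 h; have [d hd] := dnm_inv Zw w0.
by rewrite -[q]mulr1 -hd -(dnm_central Zw) mulrA h mul0r.
Qed.

Definition frac_mem (c : Q) := exists z w, [/\ Z z, Z w, w <> 0 & c * iota w = iota z].

Lemma frac_mem_emb z : Z z -> frac_mem (iota z).
Proof.
move=> Zz; exists z, 1; rewrite germ_emb1 mulr1; split=> //; first exact: dnm1.
by apply/eqP; rewrite oner_eq0.
Qed.

Fact frac_mem1 : frac_mem 1.
Proof. by rewrite -(germ_emb1 F); apply/frac_mem_emb/dnm1. Qed.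

Fact frac_memB c d : frac_mem c -> frac_mem d -> frac_mem (c - d).
Proof.
move=> [z [w [Zz Zw w0 hc]]] [z' [w' [Zz' Zw' w'0 hd]]].
exists (z * w' - z' * w), (w * w'); split.
- by apply: dnmB; apply: dnmM.
- exact: dnmM.
- exact: dnm_neq0M.
by rewrite mulrBl germ_embB !germ_embM -hc -hd -!mulrA [iota w * iota w'](dnm_central Zw).
Qed.

Fact frac_memM c d : frac_mem c -> frac_mem d -> frac_mem (c * d).
Proof.
move=> [z [w [Zz Zw w0 hc]]] [z' [w' [Zz' Zw' w'0 hd]]].
exists (z * z'), (w' * w); split; [exact: dnmM|exact: dnmM|exact: dnm_neq0M|].
by rewrite !germ_embM -mulrA (mulrA d) hd (dnm_central Zz') mulrA hc.
Qed.

Fact frac_mem_comm c : frac_mem c -> forall y, c * y = y * c.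
Proof.
move=> [z [w [Zz Zw w0 hc]]] y; apply/eqP; rewrite -subr_eq0; apply/eqP.
apply: (dnm_germ_reg Zw w0); rewrite mulrBl -!mulrA hc -(dnm_central Zw) mulrA hc.
by rewrite (dnm_central Zz) subrr.
Qed.

Fact frac_memV c : frac_mem c -> c != 0 -> exists d, frac_mem d /\ c * d = 1.
Proof.
move=> [z [w [Zz Zw w0 hc]]] c0.
have z0 : z <> 0.
  move=> z0; case/eqP: c0; apply: (dnm_germ_reg Zw w0).
  by rewrite hc z0 germ_emb0.
have [d hd] := dnm_inv Zz z0; exists (iota w * d); split; last first.
  by rewrite mulrA hc (dnm_central Zz).
by exists w, z; rewrite -mulrA hd mulr1.
Qed.

Definition frac_field :=
  CentralSubfield frac_mem1 frac_memB frac_memM frac_mem_comm frac_memV.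

Lemma frac_common_denominator n (c : nat -> csf frac_field) :
  exists D N, [/\ Z D, D <> 0, forall i, Z (N i) &
    forall i, (i < n)%N -> csf_val (c i) * iota D = iota (N i)].
Proof.
elim: n => [|n [D [N [ZD D0 ZN hN]]]].
  exists 1, (fun=> 1); split=> //; [exact: dnm1| |by move=> _; apply: dnm1].
  by apply/eqP; rewrite oner_eq0.
have [z [w [Zz Zw w0 hc]]] := csfP (c n).
exists (w * D), (fun i => if i == n then z * D else N i * w); split.
- exact: dnmM.
- exact: dnm_neq0M.
- by move=> i; case: ifP => _; apply: dnmM.
move=> i; rewrite ltnS leq_eqVlt; case: (eqVneq i n) => [-> _|_ /= li].
  by rewrite !germ_embM mulrA hc.
by rewrite !germ_embM (dnm_central Zw) mulrA hN.
Qed.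

Lemma germ_emb_sum n (x : nat -> R) : iota (\sum_(i < n) x i) = \sum_(i < n) iota (x i).
Proof. exact: (raddf_sum (germ_emb F)). Qed.

Lemma frac_sum_denominator n (c : nat -> csf frac_field) (x N : nat -> R) D : Z D ->
  (forall i, (i < n)%N -> csf_val (c i) * iota D = iota (N i)) ->
  (\sum_(i < n) c i *: (iota (x i) : csf_ext frac_field)) * iota D =
    iota (\sum_(i < n) N i * x i).
Proof.
move=> ZD h; rewrite (csf_sumE n c (fun i => iota (x i))) mulr_suml.
rewrite (germ_emb_sum n (fun i => N i * x i)).
apply: eq_bigr => i _.
by rewrite germ_embM -h // -!mulrA (dnm_central ZD).
Qed.

End Fractions.

(** * The fraction field of the center *)

Section CenterFractions.
Variables (k : fieldType) (A : algType k).
Hypothesis primeA : prime_ring A.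

Local Notation MF := (martindale_filter primeA).

Fact center_comm (w : A) : central w -> forall x, w * x = x * w.
Proof. by []. Qed.

Fact center_reg (w x : A) : central w -> w <> 0 -> x * w = 0 -> x = 0.
Proof.
move=> cw w0 h; have [y|//|//] := primeA (p := x) (q := w).
by rewrite -mulrA -cw mulrA h mul0r.
Qed.

Fact center_flt (w : A) : central w -> w <> 0 -> MF (fun x => exists y, x = w * y).
Proof.
move=> cw w0; split; last by exists w; split=> //; exists 1; rewrite mulr1.
split=> [|_ _ [x ->] [y ->]|u _ [x ->]|u _ [x ->]].
- by exists 0; rewrite mulr0.
- by exists (x - y); rewrite mulrBr.
- by exists (u * x); rewrite mulrA -cw mulrA.
- by exists (x * u); rewrite mulrA.
Qed.

Definition center_denominators : denominators MF :=
  Denominators (@central1 k A) (@centralB k A) (@centralM k A) center_comm center_reg center_flt.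

Definition center_frac : fieldType := csf (frac_field center_denominators).

Lemma center_to_frac_subproof (a : A) : exists x : center_frac,
  central a -> csf_val x = germ_emb MF a.
Proof.
have [ca|n] := pselect (central a); last by exists 0.
have [x hx] := csf_lift (S := frac_field center_denominators) (frac_mem_emb (Z := center_denominators) ca).
by exists x.
Qed.

(** The map [iota] of the statement is total on [A] but constrained on the center only; elsewhere
    the value is arbitrary. *)
Definition center_to_frac (a : A) : center_frac := sval (cid (center_to_frac_subproof a)).

Lemma center_to_fracE a : central a -> csf_val (center_to_frac a) = germ_emb MF a.
Proof. by rewrite /center_to_frac; case: cid. Qed.

Lemma center_to_frac_field : is_frac_field_of_center center_to_frac.
Proof.
split.
- move=> z w cz cw; apply: val_inj; rewrite /= !center_to_fracE ?germ_embD //.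
  exact: centralD.
- move=> z w cz cw; apply: val_inj; rewrite /= !center_to_fracE ?germ_embM //.
  exact: centralM.
- by apply: val_inj; rewrite /= center_to_fracE ?germ_emb1 //; apply: central1.
- move=> z w cz cw /(congr1 (@csf_val _ _)); rewrite !center_to_fracE //.
  exact: germ_emb_inj.
move=> x; have [z [w [cz cw w0 hx]]] := csfP x; exists z, w.
have iw0 : center_to_frac w != 0.
  apply/eqP => /(congr1 (@csf_val _ _)); rewrite center_to_fracE // => h; apply: w0.
  by apply: (@germ_emb_inj _ MF); rewrite germ_emb0 h.
split=> //; apply: (mulIf iw0); rewrite divfK //; apply: val_inj.
by rewrite /= !center_to_fracE.
Qed.

Definition base_to_frac (c : k) : center_frac := center_to_frac c%:A.

Fact base_to_frac_zmod : zmod_morphism base_to_frac.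
Proof.
move=> a b; apply: val_inj; rewrite /= !center_to_fracE; try exact: central_scalar.
by rewrite scalerBl germ_embB.
Qed.

Fact base_to_frac_monoid : monoid_morphism base_to_frac.
Proof.
split=> [|a b]; apply: val_inj; rewrite /= !center_to_fracE; try exact: central_scalar.
  by rewrite scale1r germ_emb1.
by rewrite -germ_embM -scalerAl mul1r scalerA.
Qed.
HB.instance Definition _ := GRing.isZmodMorphism.Build k center_frac base_to_frac base_to_frac_zmod.
HB.instance Definition _ := GRing.isMonoidMorphism.Build k center_frac base_to_frac base_to_frac_monoid.

End CenterFractions.

(** * Base change to the rational function field *)

Section RationalBaseChange.
Variables (k : fieldType) (A : algType k).

Local Notation lift := (map_poly (in_alg A)).

Lemma lift_comm (s : {poly k}) (q : {poly A}) : lift s * q = q * lift s.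
Proof.
elim/poly_ind: s => [|s c IH]; first by rewrite rmorph0 mul0r mulr0.
rewrite rmorphD rmorphM /= map_polyX map_polyC /= mulrDl mulrDr; congr (_ + _).
  by rewrite -mulrA -commr_polyX mulrA IH mulrA.
by apply/polyP => i; rewrite coefCM coefMC mulr_algl mulr_algr.
Qed.

Lemma lift_eq0 (s : {poly k}) : (lift s == 0) = (s == 0).
Proof. exact: map_poly_eq0. Qed.

Lemma lift_reg (s : {poly k}) (x : {poly A}) : s != 0 -> x * lift s = 0 -> x = 0.
Proof.
move=> s0; have r : GRing.rreg (lift s).
  apply: rreg_lead => y z; rewrite lead_coef_map /= !mulr_algr.
  by apply: scalerI; rewrite lead_coef_eq0.
by move=> h; apply: r; rewrite h mul0r.
Qed.

(** Restricting to ideals that meet [k[X]] nontrivially gives every germ a denominator in [k[X]], so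
    the germs form the localization there. *)
Definition lift_flt (I : {poly A} -> Prop) := ring_ideal I /\ exists s, s != 0 /\ I (lift s).

Fact lift_fltT : lift_flt (fun=> True).
Proof. by split=> //; exists 1; rewrite oner_eq0. Qed.

Fact lift_flt_mul I J L : lift_flt I -> lift_flt J -> ring_ideal L ->
  (forall x y, I x -> J y -> L (x * y)) -> lift_flt L.
Proof.
move=> [_ [s [s0 Is]]] [_ [r [r0 Jr]]] iL h; split=> //.
by exists (s * r); rewrite mulf_neq0 // rmorphM; split=> //; apply: h.
Qed.

Fact lift_flt_reg I x : lift_flt I -> (forall y, I y -> x * y = 0) -> x = 0.
Proof. by move=> [_ [s [s0 Is]]] h; apply: (lift_reg s0); apply: h. Qed.

Definition lift_filter :=
  IdealFilter (fun I (h : lift_flt I) => h.1) lift_fltT lift_flt_mul lift_flt_reg.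

Definition is_lift (x : {poly A}) := exists s, x = lift s.

Fact is_lift1 : is_lift 1.
Proof. by exists 1; rewrite rmorph1. Qed.
Fact is_liftB x y : is_lift x -> is_lift y -> is_lift (x - y).
Proof. by move=> [s ->] [r ->]; exists (s - r); rewrite rmorphB. Qed.
Fact is_liftM x y : is_lift x -> is_lift y -> is_lift (x * y).
Proof. by move=> [s ->] [r ->]; exists (s * r); rewrite rmorphM. Qed.
Fact is_lift_comm w : is_lift w -> forall x, w * x = x * w.
Proof. by move=> [s ->] x; apply: lift_comm. Qed.
Fact is_lift_reg w x : is_lift w -> w <> 0 -> x * w = 0 -> x = 0.
Proof. by move=> [s ->] /eqP; rewrite lift_eq0; apply: lift_reg. Qed.
Fact is_lift_flt w : is_lift w -> w <> 0 -> lift_filter (fun x => exists y, x = w * y).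
Proof.
move=> [s ->] /eqP; rewrite lift_eq0 => s0; split; last first.
  by exists s; split=> //; exists 1; rewrite mulr1.
split=> [|_ _ [x ->] [y ->]|u _ [x ->]|u _ [x ->]].
- by exists 0; rewrite mulr0.
- by exists (x - y); rewrite mulrBr.
- by exists (u * x); rewrite mulrA -lift_comm mulrA.
- by exists (x * u); rewrite mulrA.
Qed.

Definition lift_denominators :=
  Denominators is_lift1 is_liftB is_liftM is_lift_comm is_lift_reg is_lift_flt.

(* K is the field k(X) and B = A (x)_k k(X), realized as the localization of
   A[X] at the nonzero elements of k[X]. *)
Local Notation S := (frac_field lift_denominators).
Local Notation K := (csf S).
Local Notation B := (csf_ext S).
Local Notation iota := (germ_emb lift_filter).

Lemma lift_frac (p : {poly k}) : exists c : K, csf_val c = iota (lift p).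
Proof. by apply: (csf_lift (S := S)); apply: frac_mem_emb; exists p. Qed.

Definition base_to_rat (c : k) : K := sval (cid (lift_frac c%:P)).

Lemma base_to_ratE c : csf_val (base_to_rat c) = iota (c%:A)%:P.
Proof. by rewrite /base_to_rat; case: cid => x /= ->; rewrite map_polyC. Qed.

Fact base_to_rat_zmod : zmod_morphism base_to_rat.
Proof.
move=> a b; apply: val_inj; rewrite /= !base_to_ratE.
by rewrite scalerBl polyCB germ_embB.
Qed.

Fact base_to_rat_monoid : monoid_morphism base_to_rat.
Proof.
split=> [|a b]; apply: val_inj; rewrite /= !base_to_ratE ?scale1r ?germ_emb1 //.
by rewrite -germ_embM -polyCM -scalerAl mul1r scalerA.
Qed.
HB.instance Definition _ := GRing.isZmodMorphism.Build k K base_to_rat base_to_rat_zmod.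
HB.instance Definition _ := GRing.isMonoidMorphism.Build k K base_to_rat base_to_rat_monoid.

Definition rat_emb (a : A) : B := iota a%:P.

Lemma germ_dom_lift (b : germ lift_filter) : exists s (p : {poly A}), s != 0 /\ b * iota (lift s) = iota p.
Proof.
have [I [[iI [s [s0 Is]]] hI]] := germ_dom b; have [p hp] := hI _ Is.
by exists s, p.
Qed.

Lemma is_lift_neq0 s : s != 0 -> lift s <> 0.
Proof. by move=> s0; apply/eqP; rewrite lift_eq0. Qed.

Lemma rat_base_change : is_base_change base_to_rat rat_emb.
Proof.
split; [split|split].
- by move=> x y; rewrite /rat_emb polyCD germ_embD.
- by move=> x y; rewrite /rat_emb polyCM germ_embM.
- by rewrite /rat_emb germ_emb1.
- move=> c x; rewrite csf_scaleE base_to_ratE /rat_emb -germ_embM -polyCM.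
  by rewrite mulr_algl.
- move=> b; have [s [p [s0 hb]]] := germ_dom_lift b; exists p; apply/in_spanP.
  (* With [b = p / s], the scalar attached to the coefficient of degree [i] of [p] is [X^i / s]. *)
  have /choice[c hc] : forall i : nat, exists c : K, csf_val c * iota (lift s) = iota (lift 'X^i).
    move=> i; have [d hd] := dnm_inv (Z := lift_denominators) (ex_intro _ s erefl) (is_lift_neq0 s0).
    have [|c hc] := @csf_lift _ S (iota (lift 'X^i) * d).
      exists (lift 'X^i), (lift s); split; [by exists 'X^i|by exists s|exact: is_lift_neq0|].
      by rewrite -mulrA hd mulr1.
    by exists c; rewrite hc -mulrA hd mulr1.
  have -> : b = \sum_(i < size p) c i *: rat_emb p`_i.
    apply/eqP; rewrite -subr_eq0; apply/eqP.
    apply: (dnm_germ_reg (Z := lift_denominators) (ex_intro _ s erefl) (is_lift_neq0 s0)).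
    rewrite mulrBl hb mulr_suml.
    apply/eqP; rewrite subr_eq0; apply/eqP; rewrite -{1}[p]coefK poly_def (raddf_sum iota).
    apply: eq_bigr => i _; rewrite /= csf_scaleE /rat_emb -mulrA.
    rewrite -[iota _ * iota (lift s)]germ_embM -lift_comm germ_embM mulrA hc -germ_embM.
    by rewrite lift_comm map_polyXn mul_polyC.
  apply: lspan_sum => i _; apply/lspanZ/lspan_mem/map_f/mem_nth.
  exact: ltn_ord.
- move=> s /lin_indepP/lfreeP fs.
  suff : @lfree K B (map rat_emb s) by move/lin_indepP.
  apply/lfreeP => c; rewrite size_map => hc i li.
  have [D [N [[s0 DE] D0 ZN hN]]] := frac_common_denominator (size s) c.
  have /choice[M hM] : forall j, exists M, N j = lift M by move=> j; apply: ZN.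
  have e0 : \sum_(j < size s) lift (M j) * (s`_j)%:P = 0.
    apply: (@germ_emb_inj _ lift_filter); rewrite germ_emb0.
    have ZD : lift_denominators D by exists s0.
    have := frac_sum_denominator (fun j => (s`_j)%:P) ZD hN.
    have -> : \sum_(j < size s) c j *: (iota (s`_j)%:P : B) = 0.
      by apply: etrans hc; apply: eq_bigr => j _; rewrite (nth_map 0).
    rewrite mul0r => /esym; congr (iota _ = _).
    by apply: eq_bigr => j _; rewrite hM.
  (* Comparing the coefficients of [X^l] reduces independence over [k(X)] to independence over
     [k]. *)
  have M0 : M i = 0.
    apply/polyP => l; rewrite coef0; apply: (fs (fun j => (M j)`_l)) => //.
    have /polyP/(_ l) := e0; rewrite coef0 coef_sum; apply: etrans; apply: eq_bigr => j _.
    by rewrite coefMC coef_map /= mulr_algl.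
  apply: val_inj => /=; apply: (dnm_germ_reg (Z := lift_denominators) (w := D)) => //.
    by exists s0.
  by rewrite hN // hM M0 rmorph0 germ_emb0.
Qed.

Section Evaluation.
Variable t : A.
Hypothesis ct : central t.

Let comm_t (q : {poly A}) : comm_poly q t.
Proof. by rewrite /comm_poly -ct. Qed.

(* 'X - t generates an ideal of finite codimension in B, so sufficiently many
   central elements are dependent modulo it over k(X); evaluating the cleared
   relation at 'X = t makes the multiple of 'X - t disappear. *)
Lemma rat_dependent : just_infinite B -> exists N, forall z : nat -> A,
  (forall i, central (z i)) -> exists p : nat -> {poly k},
    \sum_(i < N) horner_alg t (p i) * z i = 0 /\ exists2 i, (i < N)%N & p i != 0.
Proof.
move=> jB; pose del := iota ('X - t%:P).
have cdel q : del * q = q * del.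
  apply: germ_central => a; rewrite /del -!germ_embM; congr germ_emb.
  rewrite mulrBl mulrBr commr_polyX; congr (_ - _).
  by apply/polyP => i; rewrite coefCM coefMC ct.
pose I (b : B) := exists b', b = (del : B) * b'.
have iI : two_sided_ideal I.
  split=> [|_ _ [x ->] [y ->]|u _ [x ->]|u _ [x ->]].
  - by exists 0; rewrite mulr0.
  - by exists (x - y); rewrite mulrBr.
  - exists (u * x); rewrite [RHS]mulrA; rewrite [X in _ = X * _]cdel; exact: mulrA.
  - by exists (x * u); rewrite mulrA.
have nI : exists x, I x /\ x <> 0.
  exists (del : B); split; first by exists 1; rewrite mulr1.
  rewrite -(germ_emb0 lift_filter) => /germ_emb_inj/eqP.
  by rewrite polyXsubC_eq0.
have /fin_codimP[s hs] := jB.2 I iI nI.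
exists (size s).+1 => z cz.
have [||c [[b' hb'] [i0 ir ci]]] := @fin_codim_dependent K B _ I (seq.iota 0 (size s).+1)
    (fun i => rat_emb (z i)) s iI hs.
- exact: iota_uniq.
- by rewrite size_iota.
have [D [N [[d DE] D0 ZN hN]]] := frac_common_denominator (size s).+1 c.
have /choice[M hM] : forall j, exists M, N j = lift M by move=> j; apply: ZN.
have [r [q [r0 hq]]] := germ_dom_lift b'.
have li0 : (i0 < (size s).+1)%N by move: ir; rewrite mem_iota.
(* [D] clears the denominators of the [c i], and [r] that of the cofactor [b'] of ['X - t]. *)
exists (fun i => M i * r); split; last first.
  exists i0 => //; rewrite mulf_neq0 //; apply: contra ci => /eqP Mi.
  apply/eqP/val_inj => /=; apply: (dnm_germ_reg (Z := lift_denominators) (w := D)) => //.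
    by exists d.
  by rewrite hN // hM Mi rmorph0 germ_emb0.
have key : (\sum_(i < (size s).+1) N i * (z i)%:P) * lift r = ('X - t%:P) * q * D.
  apply: (@germ_emb_inj _ lift_filter); rewrite !germ_embM -hq.
  have ZD : lift_denominators D by exists d.
  rewrite -(frac_sum_denominator (fun i => (z i)%:P) ZD hN).
  have e : \sum_(i < (size s).+1) c i *: (iota (z i)%:P : B) = (del : B) * b'.
    by rewrite -hb' -(big_mkord xpredT (fun i => c i *: (iota (z i)%:P : B))).
  rewrite e -!mulrA; congr (_ * (_ * _)).
  by apply: (dnm_central (Z := lift_denominators)); exists d.
have /(congr1 (fun f => f.[t])) := key.
rewrite -[X in _ = X.[_]]mulrA !hornerM_comm // hornerXsubC subrr [RHS]mul0r horner_sum.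
rewrite mulr_suml => e; apply: etrans e; apply: eq_bigr => i _.
rewrite hM hornerM_comm // hornerC rmorphM -!mulrA; congr (_ * _).
by rewrite (central_horner _ ct).
Qed.
End Evaluation.

End RationalBaseChange.

Theorem theorem5p5 (k : closedFieldType) (A : algType k) :
  just_infinite A -> is_PI A ->
  (stably_just_infinite A <->
   exists (L : fieldType) (e : {rmorphism k -> L}) (iota : A -> L),
     [/\ is_frac_field_of_center iota,
         (forall c : k, iota (c%:A) = e c),
         fg_field_ext e &
         trdeg_le e 1]).
Proof.
move=> jA pi; have [t [ct nt]] := nonscalar_central jA pi.
split=> [[_ st]|[L [e [iota [fr iotaC fg td]]]]].
  have pA := just_infinite_prime jA; have fr := center_to_frac_field pA.
  have [N dep] := rat_dependent ct (st _ _ _ _ (rat_base_change A)).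
  have iotaC c : center_to_frac pA c%:A = base_to_frac pA c by [].
  have fd := center_frac_fin_dim jA fr iotaC ct nt dep.
  exists (center_frac pA), (base_to_frac pA), (center_to_frac pA).
  by split=> //; [apply: finite_fg fd|apply: finite_trdeg1 fd].
split=> // K e' B phi hphi.
have [n [b [i0 [cb b1 bfree bspan]]]] := center_basis jA fr iotaC ct nt fg td.
have rank := finite_rank_over_poly jA pi ct bspan.
apply: (base_change_just_infinite hphi jA ct cb b1 bfree bspan nt rank) => I iI nI.
exact: (ideal_meets_center (just_infinite_prime jA) (@closed_field_infinite k) (PI_mlin pi) iI nI).
Qed.
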